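(* Let $\mathcal{B}_{s}$ be the state-space system $\mathcal{B}_{s} = \lbrace (\mathbf{u}, \mathbf{y}, \mathbf{x}) \in \mathcal{L}_{2}^{\text{loc}}(\mathbb{R}, \mathbb{R}^{n}) \times \mathcal{L}_{2}^{\text{loc}}(\mathbb{R}, \mathbb{R}^{m}) \times \mathcal{L}_{2}^{\text{loc}}(\mathbb{R}, \mathbb{R}^{d}) \text{ such that } \tfrac{d\mathbf{x}}{dt} = A\mathbf{x} + B\mathbf{u} \text{ and } \mathbf{y} = C\mathbf{x} + D\mathbf{u}\rbrace$ with $A \in \mathbb{R}^{d \times d}$, $B \in \mathbb{R}^{d \times n}$, $C \in \mathbb{R}^{m \times d}$, $D \in \mathbb{R}^{m \times n}$, and let $\mathcal{B}_{s}^{(\mathbf{u},\mathbf{y})} \coloneqq \lbrace (\mathbf{u}, \mathbf{y}) \mid \exists \mathbf{x} \text{ such that } (\mathbf{u},\mathbf{y},\mathbf{x}) \in \mathcal{B}_{s}\rbrace$. For $\mathbf{x}_{0} \in \mathbb{R}^{d}$ let $S_{a}^{\sigma_{g}}(\mathbf{x}_{0})$ be the available storage, i.e., the supremum of $\int_{t_{0}}^{t_{1}}(\mathbf{y}^{T}\mathbf{y}-\mathbf{u}^{T}\mathbf{u})(t)dt$ over all $t_{1} \geq t_{0}$ and $(\mathbf{u}, \mathbf{y}, \mathbf{x}) \in \mathcal{B}_{s}$ with $\mathbf{x}(t_{0}) = \mathbf{x}_{0}$ (equal to $\infty$ if this set is unbounded above). Let $V_{o} \coloneqq \text{col}(C,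 CA, \ldots, CA^{d-1})$ and $\Lambda(X) \coloneqq \begin{bmatrix}-A^{T}X - XA-C^{T}C& -C^{T}D-XB\\ -D^{T}C-B^{T}X& I - D^{T}D\end{bmatrix}$. The following are equivalent: 1. $S_{a}^{\sigma_{g}}(\mathbf{x}_{0}) < \infty$ for all $\mathbf{x}_{0} \in \mathbb{R}^{d}$ (i.e., $\mathcal{B}_{s}$ is non-expansive). 2. The external behavior $\mathcal{B}_{s}^{(\mathbf{u}, \mathbf{y})}$ takes the form $\lbrace (\mathbf{u}, \mathbf{y}) \in \mathcal{L}_{2}^{\text{loc}}(\mathbb{R}, \mathbb{R}^{n}) \times \mathcal{L}_{2}^{\text{loc}}(\mathbb{R}, \mathbb{R}^{m}) \mid P(\tfrac{d}{dt})\mathbf{u} = Q(\tfrac{d}{dt})\mathbf{y} \rbrace$ for polynomial matrices $P \in \mathbb{R}^{m \times n}[\xi]$, $Q \in \mathbb{R}^{m \times m}[\xi]$, where $(P, Q)$ is a bounded-real pair. 3. There exists $X \in \mathbb{R}^{d \times d}_{s}$ such that $X \geq 0$ and $\Lambda(X) \geq 0$. 4. $S_{a}^{\sigma_{g}}(\mathbf{x}_{0}) = \mathbf{x}_{0}^{T}X_{-}\mathbf{x}_{0}$, where $X_{-} \in \mathbb{R}^{d \times d}_{s}$ satisfies (i) $X_{-} \geq 0$; (ii) $\Lambda(X_{-}) \geq 0$; (iii) if $\mathbf{z} \in \mathbb{R}^{d}$, then $V_{o}\mathbf{z} = 0 \iff X_{-}\mathbf{z} = 0$; and (iv) if $X \in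 \mathbb{R}^{d \times d}_{s}$ satisfies $X \geq 0$ and $\Lambda(X) \geq 0$, then $X_{-} \leq X$. Moreover, if $(C,A)$ is observable and conditions 1–4 hold, then (i) $\text{spec}(A) \in \mathbb{C}_{-}$; and (ii) if $X \in \mathbb{R}_{s}^{d \times d}$ satisfies $\Lambda(X) \geq 0$, then $X_{-} \leq X$.
   Context: $(P,Q)$ with $P \in \mathbb{R}^{m \times n}[\xi]$, $Q \in \mathbb{R}^{m \times m}[\xi]$ is a bounded-real pair if (a) $Q(\lambda)Q(\bar{\lambda})^{T} - P(\lambda)P(\bar{\lambda})^{T} \geq 0$ for all $\lambda \in \overline{\mathbb{C}}_{+}$; (b) $\text{rank}([P \;\; -Q](\lambda)) = m$ for all $\lambda \in \overline{\mathbb{C}}_{+}$; (c) if $\mathbf{p} \in \mathbb{R}^{m}[\xi]$ and $\lambda \in \mathbb{C}$ satisfy $\mathbf{p}^{T}(QQ^{\star} - PP^{\star}) = 0$ and $\mathbf{p}(\lambda)^{T}[P \;\; -Q](\lambda) = 0$, then $\mathbf{p}(\lambda) = 0$, where $Q^{\star}(\xi) \coloneqq Q(-\xi)^{T}$. $\mathbb{R}^{d\times d}_{s}$ denotes real symmetric matrices; $\mathbb{C}_{-}$ is the open left half-plane; $(C,A)$ observable means $\text{rank}(V_{o}) = d$. No controllability or observability assumptions are made in the equivalence. *)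

(* Defs.v *)
From HB Require Import structures.
From mathcomp Require Import all_boot all_order all_algebra.
From mathcomp Require Import all_classical all_reals all_analysis.
From mathcomp Require Import complex.

Set Implicit Arguments.
Unset Strict Implicit.
Unset Printing Implicit Defensive.

Import Order.TTheory GRing.Theory Num.Theory.
Local Open Scope classical_set_scope.
Local Open Scope ring_scope.

Section Defs.
Variable R : realType.

Local Notation mu := (@lebesgue_measure R).

Definition L2loc (k : nat) (f : R -> 'cV[R]_k) : Prop :=
  forall i : 'I_k,
    measurable_fun setT (fun t => f t i 0) /\
    forall a b : R,
      (\int[mu]_(t in `[a, b]) ((f t i 0) ^+ 2)%:E < +oo)%E.

(* ---------- The state-space behaviour B_s ----------
   dx/dt = A x + B u is read in the (standard) weak / integral sense:
   x is the (continuous) representative satisfying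
   x(t1) - x(t0) = int_{t0}^{t1} (A x + B u); y = C x + D u holds a.e. *)
Definition Bs (d n m : nat) (A : 'M[R]_d) (B : 'M[R]_(d, n))
    (C : 'M[R]_(m, d)) (D : 'M[R]_(m, n))
    (u : R -> 'cV[R]_n) (y : R -> 'cV[R]_m) (x : R -> 'cV[R]_d) : Prop :=
  [/\ L2loc u, L2loc y, L2loc x,
      (forall t0 t1 : R, t0 <= t1 -> forall i : 'I_d,
          x t1 i 0 - x t0 i 0 =
          Rintegral mu `[t0, t1] (fun t => (A *m x t + B *m u t) i 0))
    & {ae mu, forall t, y t = C *m x t + D *m u t}].

Definition Bs_ext (d n m : nat) (A : 'M[R]_d) (B : 'M[R]_(d, n))
    (C : 'M[R]_(m, d)) (D : 'M[R]_(m, n))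
    (u : R -> 'cV[R]_n) (y : R -> 'cV[R]_m) : Prop :=
  exists x : R -> 'cV[R]_d, Bs A B C D u y x.

Definition supply (n m : nat) (u : R -> 'cV[R]_n) (y : R -> 'cV[R]_m) (t : R) : R :=
  ((y t)^T *m y t - (u t)^T *m u t) 0 0.

Definition avail_storage (d n m : nat) (A : 'M[R]_d) (B : 'M[R]_(d, n))
    (C : 'M[R]_(m, d)) (D : 'M[R]_(m, n)) (t0 : R) (x0 : 'cV[R]_d) : \bar R :=
  ereal_sup [set r : \bar R | exists (t1 : R) (u : R -> 'cV[R]_n)
      (y : R -> 'cV[R]_m) (x : R -> 'cV[R]_d),
      [/\ t0 <= t1, Bs A B C D u y x, x t0 = x0 &
          r = (\int[mu]_(t in `[t0, t1]) (supply u y t)%:E)%E]].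

Definition coefmx (p q : nat) (P : 'M[{poly R}]_(p, q)) (k : nat) : 'M[R]_(p, q) :=
  map_mx (fun a : {poly R} => a`_k) P.

Definition degbound (p q : nat) (P : 'M[{poly R}]_(p, q)) : nat :=
  (\max_(i < p) \max_(j < q) size (P i j))%N.

Definition test_fun (phi : R -> R) : Prop :=
  (forall (k : nat) (t : R), derivable (derive1n k phi) t 1) /\
  exists M : R, forall t : R, M < `|t| -> phi t = 0.

(* pairing <row i of P(d/dt) w, phi> = sum_k (-1)^k int phi^(k) (P_k w)_i *)
Definition dpair (p q : nat) (P : 'M[{poly R}]_(p, q)) (w : R -> 'cV[R]_q)
    (i : 'I_p) (phi : R -> R) : R :=
  \sum_(k < degbound P)
     (-1) ^+ k * Rintegral mu setT
        (fun t => derive1n k phi t * (coefmx P k *m w t) i 0).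

Definition kernel_eq (p n m : nat) (P : 'M[{poly R}]_(p, n)) (Q : 'M[{poly R}]_(p, m))
    (u : R -> 'cV[R]_n) (y : R -> 'cV[R]_m) : Prop :=
  forall (i : 'I_p) (phi : R -> R), test_fun phi -> dpair P u i phi = dpair Q y i phi.

Definition evalC (p q : nat) (P : 'M[{poly R}]_(p, q)) (lam : R[i]) : 'M[R[i]]_(p, q) :=
  map_mx (fun a : {poly R} => (map_poly (real_complex R) a).[lam]) P.

Definition pstar (p q : nat) (P : 'M[{poly R}]_(p, q)) : 'M[{poly R}]_(q, p) :=
  map_mx (fun a : {poly R} => a \Po (- 'X)) P^T.

Definition psdC (k : nat) (M : 'M[R[i]]_k) : Prop :=
  forall v : 'cV[R[i]]_k, 0 <= ((map_mx conjc v)^T *m M *m v) 0 0.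

Definition bounded_real_pair (m n : nat) (P : 'M[{poly R}]_(m, n))
    (Q : 'M[{poly R}]_m) : Prop :=
  [/\ (forall lam : R[i], 0 <= complex.Re lam ->
         psdC (evalC Q lam *m (evalC Q (conjc lam))^T
               - evalC P lam *m (evalC P (conjc lam))^T)),
      (forall lam : R[i], 0 <= complex.Re lam ->
         \rank (row_mx (evalC P lam) (- evalC Q lam)) = m)
    & (forall (pv : 'cV[{poly R}]_m) (lam : R[i]),
         pv^T *m (Q *m pstar Q - P *m pstar P) = 0 ->
         (evalC pv lam)^T *m row_mx (evalC P lam) (- evalC Q lam) = 0 ->
         evalC pv lam = 0)].

Definition psd (k : nat) (M : 'M[R]_k) : Prop :=
  forall v : 'cV[R]_k, 0 <= (v^T *m M *m v) 0 0.

Definition symmx (k : nat) (M : 'M[R]_k) : Prop := M^T = M.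

Definition Lambda (d n m : nat) (A : 'M[R]_d) (B : 'M[R]_(d, n))
    (C : 'M[R]_(m, d)) (D : 'M[R]_(m, n)) (X : 'M[R]_d) : 'M[R]_(d + n) :=
  block_mx (- A^T *m X - X *m A - C^T *m C) (- C^T *m D - X *m B)
           (- D^T *m C - B^T *m X) (1%:M - D^T *m D).

Definition obsmx (d m : nat) (A : 'M[R]_d) (C : 'M[R]_(m, d)) :=
  \mxcol_(k < d) (C *m A ^+ k).

Definition observable (d m : nat) (A : 'M[R]_d) (C : 'M[R]_(m, d)) : Prop :=
  \rank (obsmx A C) = d.

Definition hurwitz (d : nat) (A : 'M[R]_d) : Prop :=
  forall lam : R[i], eigenvalue (map_mx (real_complex R) A) lam -> complex.Re lam < 0.

End Defs.

(* Main.v *)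
(** The available storage satisfies the parallelogram law, because the supply is
quadratic and trajectories can be prolonged by zero input at no loss; so it is a
quadratic form [x^T Xm x] as soon as it is finite. Dynamic programming turns its
definition into the dissipation inequality, that is [Lambda(Xm) >= 0], and every
other nonnegative solution dominates it.

From [Xm] to a kernel representation: a triangular basis [Q] of the module of
rows [q] such that [q(s) C = e(s) (s - A)] for some [e], together with the
corresponding [E], gives [P = E B + Q D]. The kernel of [Xm] being the
unobservable subspace, (P, Q) is bounded-real; the state is reconstructed from
the external variables by a polynomial observer, in the sense of distributions.

From a bounded-real pair to a solution of the matrix inequality: exponential
trajectories yield [E] with [E (s - A) = Q C] and [P = E B + Q D]. Unobservable
modes are factored out, which makes [A] Hurwitz. For a controllable pair the
inequality is solved by continuation in the output gain. Uncontrollable modes are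
added one at a time: the spectral factor of the solution of least trace has full
row rank in the right half-plane, and the coprimeness condition (c) on the pair
provides the compatibility needed to extend the solution. *)

Require Import Defs.
From HB Require Import structures.
From mathcomp Require Import all_boot all_order all_algebra.
From mathcomp Require Import all_classical all_reals all_analysis.
From mathcomp Require Import measurable_realfun.
From mathcomp Require Import complex.
From mathcomp Require Import ring lra.

Set Implicit Arguments.
Unset Strict Implicit.
Unset Printing Implicit Defensive.

Import Order.TTheory GRing.Theory Num.Theory.
Import numFieldNormedType.Exports.
Local Open Scope classical_set_scope.
Local Open Scope ring_scope.

(** * Hermitian forms and Lyapunov's theorem *)

(** The algebra is done over [R[i]], where eigenvectors exist; the real part of a complex solution
    solves the real inequality. Controllability is what bounds the solutions of the dissipation
    inequality, so that the feasible gains form a closed set. Without it the inequality can fail for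
    a contractive transfer function, and here condition (c) has to enter. Splitting off an
    uncontrollable mode [l] leaves a linear equation whose coefficient is the value of the spectral
    factor at [- conjc l], solvable when a certain vector is orthogonal to the kernel of that value.
    Each kernel vector extends to a polynomial trajectory without dissipation, and the adjoint of
    such a trajectory yields a row annihilated by [Q Q* - P P*]; condition (c) allows the zeros at
    [l] to be divided out, and evaluation at [l] gives the orthogonality. In the other direction (a)
    and (c) come from one energy identity, [rep_contraction], whose terms are nonnegative in the
    closed right half-plane and vanish on the imaginary axis in the situation of (c). Signals are
    only locally square integrable, so kernel equations are handled as functionals on test
    functions. *)

Section HermitianForms.
Variable R : rcfType.
Local Notation K := R[i].
Local Notation re := (@complex.Re R).

Fact ctr_key : unit. Proof. by []. Qed.
(* Locked: unfolding it during unification makes rewriting very slow. *)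
Definition ctr m n (M : 'M[K]_(m, n)) : 'M[K]_(n, m) :=
  locked_with ctr_key (map_mx conjc M)^T.

Lemma ctrE m n (M : 'M[K]_(m, n)) : ctr M = (map_mx conjc M)^T.
Proof. by rewrite /ctr unlock. Qed.

Lemma ctr_mxE m n (M : 'M[K]_(m, n)) i j : ctr M i j = conjc (M j i).
Proof. by rewrite ctrE !mxE. Qed.

Lemma ctrK m n (M : 'M[K]_(m, n)) : ctr (ctr M) = M.
Proof. by apply/matrixP=> i j; rewrite !ctr_mxE conjcK. Qed.

Lemma ctrM m n p (M : 'M[K]_(m, n)) (N : 'M[K]_(n, p)) :
  ctr (M *m N) = ctr N *m ctr M.
Proof. by rewrite !ctrE map_mxM trmx_mul. Qed.

Lemma ctrD m n (M N : 'M[K]_(m, n)) : ctr (M + N) = ctr M + ctr N.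
Proof. by rewrite !ctrE map_mxD linearD. Qed.

Lemma ctrN m n (M : 'M[K]_(m, n)) : ctr (- M) = - ctr M.
Proof. by rewrite !ctrE map_mxN linearN. Qed.

Lemma ctrB m n (M N : 'M[K]_(m, n)) : ctr (M - N) = ctr M - ctr N.
Proof. by rewrite ctrD ctrN. Qed.

Lemma ctrZ m n a (M : 'M[K]_(m, n)) : ctr (a *: M) = conjc a *: ctr M.
Proof. by rewrite !ctrE map_mxZ linearZ. Qed.

Lemma ctr0 m n : ctr (0 : 'M[K]_(m, n)) = 0.
Proof. by rewrite !ctrE map_mx0 trmx0. Qed.

Lemma ctr_scalar n a : ctr (a%:M : 'M[K]_n) = (conjc a)%:M.
Proof. by rewrite !ctrE map_scalar_mx tr_scalar_mx. Qed.

Lemma ctr1 n : ctr (1%:M : 'M[K]_n) = 1%:M.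
Proof. by rewrite ctr_scalar rmorph1. Qed.

Lemma ctr_row_mx m n1 n2 (M : 'M[K]_(m, n1)) (N : 'M[K]_(m, n2)) :
  ctr (row_mx M N) = col_mx (ctr M) (ctr N).
Proof. by rewrite !ctrE map_row_mx tr_row_mx. Qed.

Lemma ctr_col_mx m1 m2 n (M : 'M[K]_(m1, n)) (N : 'M[K]_(m2, n)) :
  ctr (col_mx M N) = row_mx (ctr M) (ctr N).
Proof. by rewrite !ctrE map_col_mx tr_col_mx. Qed.

Lemma ctr_block_mx m1 m2 n1 n2 (M : 'M[K]_(m1, n1)) (N : 'M[K]_(m1, n2))
    (P : 'M[K]_(m2, n1)) (Q : 'M[K]_(m2, n2)) :
  ctr (block_mx M N P Q) = block_mx (ctr M) (ctr P) (ctr N) (ctr Q).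
Proof. by rewrite !ctrE map_block_mx tr_block_mx. Qed.

Lemma ctr_eq0 m n (M : 'M[K]_(m, n)) : ctr M = 0 -> M = 0.
Proof. by move=> h; rewrite -[M]ctrK h ctr0. Qed.

Lemma ctr_unit n (M : 'M[K]_n) : (ctr M \in unitmx) = (M \in unitmx).
Proof. by rewrite ctrE unitmx_tr map_unitmx. Qed.

(** The real inner product underlying the Hermitian one. Its values lie in [R], so estimates are
    left to [lra]; imaginary parts are recovered by testing with all complex vectors, as in
    [rd_mx_eq]. *)
Definition rd n (x y : 'cV[K]_n) : R := re ((ctr x *m y) 0 0).

Lemma reD : {morph re : x y / x + y}. Proof. by case=> ? ? [? ?]. Qed.
Lemma reN : {morph re : x / - x}. Proof. by case=> ? ?. Qed.
Lemma re_conj x : re (conjc x) = re x. Proof. by case: x. Qed.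
Lemma re_sum (I : Type) (r : seq I) (P : pred I) (F : I -> K) :
  re (\sum_(i <- r | P i) F i) = \sum_(i <- r | P i) re (F i).
Proof. by apply: (big_morph _ reD). Qed.

Lemma rdDr n (x y z : 'cV[K]_n) : rd x (y + z) = rd x y + rd x z.
Proof. by rewrite /rd mulmxDr mxE reD. Qed.
Lemma rdNr n (x y : 'cV[K]_n) : rd x (- y) = - rd x y.
Proof. by rewrite /rd mulmxN mxE reN. Qed.
Lemma rdC n (x y : 'cV[K]_n) : rd x y = rd y x.
Proof.
rewrite /rd -re_conj; congr (re _).
have -> : conjc ((ctr x *m y) 0 0) = ctr (ctr x *m y) 0 0 by rewrite ctr_mxE.
by rewrite ctrM ctrK.
Qed.
Lemma rdDl n (x y z : 'cV[K]_n) : rd (x + y) z = rd x z + rd y z.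
Proof. by rewrite rdC rdDr !(rdC z). Qed.
Lemma rdNl n (x y : 'cV[K]_n) : rd (- x) y = - rd x y.
Proof. by rewrite rdC rdNr rdC. Qed.
Lemma rdBl n (x y z : 'cV[K]_n) : rd (x - y) z = rd x z - rd y z.
Proof. by rewrite rdDl rdNl. Qed.
Lemma rdBr n (x y z : 'cV[K]_n) : rd x (y - z) = rd x y - rd x z.
Proof. by rewrite rdDr rdNr. Qed.
Lemma rd0r n (x : 'cV[K]_n) : rd x 0 = 0.
Proof. by rewrite /rd mulmx0 mxE. Qed.
Lemma rd0l n (x : 'cV[K]_n) : rd 0 x = 0.
Proof. by rewrite rdC rd0r. Qed.
Lemma rdZr n a (x y : 'cV[K]_n) : rd x (a%:C%C *: y) = a * rd x y.
Proof. by rewrite /rd -scalemxAr mxE; case: (_ 0 0) => u v /=; rewrite mul0r subr0. Qed.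
Lemma rdZl n a (x y : 'cV[K]_n) : rd (a%:C%C *: x) y = a * rd x y.
Proof. by rewrite rdC rdZr rdC. Qed.
Lemma rd_ctr m n (M : 'M[K]_(m, n)) x y : rd x (M *m y) = rd (ctr M *m x) y.
Proof. by rewrite /rd ctrM ctrK mulmxA. Qed.
Lemma rd_ctrl m n (M : 'M[K]_(m, n)) x y : rd (M *m x) y = rd x (ctr M *m y).
Proof. by rewrite rd_ctr ctrK. Qed.

Lemma rdE n (x y : 'cV[K]_n) :
  rd x y = \sum_i (re (x i 0) * re (y i 0) + complex.Im (x i 0) * complex.Im (y i 0)).
Proof.
rewrite /rd mxE re_sum; apply: eq_bigr => i _; rewrite ctr_mxE.
by case: (x i 0) (y i 0) => a b [c e] /=; rewrite mulNr opprK.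
Qed.
Lemma rd_ge0 n (x : 'cV[K]_n) : 0 <= rd x x.
Proof. by rewrite rdE sumr_ge0 // => i _; rewrite addr_ge0 // -expr2 sqr_ge0. Qed.
Lemma rd_eq0 n (x : 'cV[K]_n) : rd x x = 0 -> x = 0.
Proof.
rewrite rdE => /eqP; rewrite psumr_eq0; last first.
  by move=> i _; rewrite addr_ge0 // -expr2 sqr_ge0.
move=> /allP h; apply/colP => i; rewrite mxE.
have /(_ (mem_index_enum _)) := h i.
rewrite -!expr2 paddr_eq0 ?sqr_ge0 // !sqrf_eq0 => /andP[/eqP h1 /eqP h2].
by apply/eqP; rewrite eq_complex h1 h2 /= !eqxx.
Qed.
Lemma rd_gt0 n (x : 'cV[K]_n) : x != 0 -> 0 < rd x x.
Proof.
move=> h; rewrite lt_def rd_ge0 andbT; apply: contra h => /eqP h.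
by apply/eqP/rd_eq0.
Qed.
Lemma rd_addsq n (x y : 'cV[K]_n) :
  rd (x + y) (x + y) = rd x x + 2 * rd x y + rd y y.
Proof. by rewrite rdDl !rdDr (rdC y x); ring. Qed.
Lemma rd_subsq n (x y : 'cV[K]_n) :
  rd (x - y) (x - y) = rd x x - 2 * rd x y + rd y y.
Proof. by rewrite rd_addsq !rdNr rdNl; ring. Qed.
Lemma rd_add_le n (x y : 'cV[K]_n) :
  rd (x + y) (x + y) <= 2 * rd x x + 2 * rd y y.
Proof. by have := rd_ge0 (x - y); rewrite rd_subsq rd_addsq; lra. Qed.
Lemma rd_nondeg n (y : 'cV[K]_n) : (forall x, rd x y = 0) -> y = 0.
Proof. by move=> h; apply: rd_eq0. Qed.

Lemma rd_scale_self n l (x : 'cV[K]_n) : rd x (l *: x) = re l * rd x x.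
Proof.
rewrite !rdE mulr_sumr; apply: eq_bigr => i _; rewrite mxE.
by case: l (x i 0) => a b [c e] /=; ring.
Qed.
Lemma rd_scale2 n l (x y : 'cV[K]_n) :
  rd (l *: x) (l *: y) = (re l ^+ 2 + complex.Im l ^+ 2) * rd x y.
Proof.
rewrite !rdE mulr_sumr; apply: eq_bigr => i _; rewrite !mxE.
by case: l (x i 0) (y i 0) => a b [c e] [f g] /=; ring.
Qed.

Lemma quad_discr (a b c : R) : 0 <= c ->
  (forall t, 0 <= a + t * b *+ 2 + t ^+ 2 * c) -> b ^+ 2 <= a * c.
Proof.
move=> c0 h; have [c_eq0|cn0] := eqVneq c 0.
  rewrite c_eq0 mulr0; suff -> : b = 0 by rewrite expr0n.
  apply/eqP/negPn/negP => bn0.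
  (* This [t] makes the affine function of [t] equal to -1. *)
  have := h (- (a + 1) / (2 * b)).
  rewrite c_eq0 mulr0 addr0.
  have -> : - (a + 1) / (2 * b) * b *+ 2 = - (a + 1) by field.
  by lra.
have cp : 0 < c by rewrite lt_def cn0.
have := h (- b / c); rewrite -(pmulr_rge0 _ cp).
have -> : c * (a + - b / c * b *+ 2 + (- b / c) ^+ 2 * c) = a * c - b ^+ 2.
  by field.
by rewrite subr_ge0.
Qed.

Definition herm n (M : 'M[K]_n) := ctr M = M.
Definition psdh n (M : 'M[K]_n) := forall v, 0 <= rd v (M *m v).

Lemma psdh_CS n (M : 'M[K]_n) x y : herm M -> psdh M ->
  (rd x (M *m y)) ^+ 2 <= rd x (M *m x) * rd y (M *m y).
Proof.
move=> hM pM; apply: quad_discr; first exact: pM.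
move=> t; have := pM (x + t%:C%C *: y).
rewrite mulmxDr -scalemxAr !(rdDr, rdDl, rdZr, rdZl).
have -> : rd y (M *m x) = rd x (M *m y) by rewrite rd_ctr hM rdC.
by congr (_ <= _); rewrite -mulr_natl; ring.
Qed.

Lemma rd_CS n (x y : 'cV[K]_n) : (rd x y) ^+ 2 <= rd x x * rd y y.
Proof.
have h1 : herm (1%:M : 'M[K]_n) by exact: ctr1.
have h2 : psdh (1%:M : 'M[K]_n) by move=> v; rewrite mul1mx rd_ge0.
by have := psdh_CS x y h1 h2; rewrite !mul1mx.
Qed.

Lemma psdh_ker n (M : 'M[K]_n) v : herm M -> psdh M -> rd v (M *m v) = 0 ->
  M *m v = 0.
Proof.
move=> hM pM h; apply: rd_nondeg => x.
have := psdh_CS x v hM pM; rewrite h mulr0 => /(conj (sqr_ge0 _)) /andP /le_anti.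
by move=> /esym /eqP; rewrite sqrf_eq0 => /eqP.
Qed.

Lemma rd_sum_le (I : finType) n (v : I -> 'cV[K]_n) :
  rd (\sum_i v i) (\sum_i v i) <= #|I|%:R * \sum_i rd (v i) (v i).
Proof.
have rds (w : I -> 'cV[K]_n) x : rd x (\sum_i w i) = \sum_i rd x (w i).
  by apply: (big_morph (rd x) (rdDr x) (rd0r x)).
have -> : rd (\sum_i v i) (\sum_i v i) = \sum_i \sum_j rd (v i) (v j).
  by rewrite rds; apply: eq_bigr => i _; rewrite rdC rds.
have -> : #|I|%:R * (\sum_i rd (v i) (v i)) =
   \sum_i \sum_j ((rd (v i) (v i) + rd (v j) (v j)) / 2).
  under [RHS]eq_bigr => i _ do rewrite -mulr_suml big_split /= sumr_const.
  rewrite -mulr_suml big_split /= sumr_const sumrMnl.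
  by rewrite -mulr2n -[_ *+ 2]mulr_natr mulfK ?pnatr_eq0 // mulr_natl.
apply: ler_sum => i _; apply: ler_sum => j _.
have := rd_ge0 (v i - v j); rewrite !(rdBl, rdBr) (rdC (v j) (v i)).
by lra.
Qed.

(** The constant is [n] times the squared Frobenius norm of [M]. For a factor [G] of
    [X = ctr G *m G] that norm is the trace of [X], and so the trace bounds a positive semidefinite
    matrix in [psdh_bound]. *)
Lemma mulmx_bound_col m n (M : 'M[K]_(m, n)) x :
  rd (M *m x) (M *m x) <= n%:R * (\sum_j rd (col j M) (col j M)) * rd x x.
Proof.
have -> : M *m x = \sum_j (x j 0 *: col j M).
  apply/colP => i; rewrite mxE summxE; apply: eq_bigr => j _.
  by rewrite !mxE mulrC.
apply: le_trans (rd_sum_le _) _; rewrite card_ord -mulrA.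
apply: ler_wpM2l; first exact: ler0n.
rewrite mulr_suml; apply: ler_sum => j _; rewrite rd_scale2 mulrC.
apply: ler_wpM2l; first exact: rd_ge0.
rewrite rdE (bigD1 j) //= -!expr2 lerDl sumr_ge0 // => i _.
by rewrite addr_ge0 // -expr2 sqr_ge0.
Qed.

Lemma mulmx_bound m n (M : 'M[K]_(m, n)) :
  exists2 c : R, 0 <= c & forall x, rd (M *m x) (M *m x) <= c * rd x x.
Proof.
exists (n%:R * \sum_j rd (col j M) (col j M)); last exact: mulmx_bound_col.
by rewrite mulr_ge0 ?ler0n ?sumr_ge0 // => j _; rewrite rd_ge0.
Qed.

Lemma rd_delta n (i : 'I_n) (x : 'cV[K]_n) : rd (delta_mx i 0) x = re (x i 0).
Proof.
rewrite rdE (bigD1 i) //= big1 ?addr0 => [|j ji]; rewrite !mxE ?eqxx ?(negbTE ji) /=.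
  by rewrite mul1r mul0r addr0.
by rewrite !mul0r addr0.
Qed.

Lemma rd_mx_eq m n (M N : 'M[K]_(m, n)) :
  (forall v w, rd v (M *m w) = rd v (N *m w)) -> M = N.
Proof.
move=> h; apply/matrixP => i j; apply/eqP; rewrite -subr_eq0; apply/eqP.
have : (M - N) *m delta_mx j 0 = 0 :> 'cV_m.
  by apply: rd_nondeg => v; rewrite mulmxBl rdBr h subrr.
by rewrite -colE => /colP /(_ i); rewrite !mxE.
Qed.

Definition mtr n (M : 'M[K]_n) : R := \sum_i re (M i i).

Lemma mtr_delta n (M : 'M[K]_n) : mtr M = \sum_i rd (delta_mx i 0) (M *m delta_mx i 0).
Proof. by apply: eq_bigr => i _; rewrite rd_delta -colE mxE. Qed.

Lemma mtr_ge0 n (M : 'M[K]_n) : psdh M -> 0 <= mtr M.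
Proof. by move=> h; rewrite mtr_delta sumr_ge0. Qed.

Lemma mtrZ n (a : R) (M : 'M[K]_n) : mtr (a%:C%C *: M) = a * mtr M.
Proof.
rewrite /mtr mulr_sumr; apply: eq_bigr => i _; rewrite mxE.
by case: (M i i) => u v /=; rewrite mul0r subr0.
Qed.

Lemma mtrB n (M N : 'M[K]_n) : mtr (M - N) = mtr M - mtr N.
Proof. by rewrite /mtr -sumrB; apply: eq_bigr => i _; rewrite !mxE reD reN. Qed.

Lemma mtr_ctrmul m n (M : 'M[K]_(m, n)) : mtr (ctr M *m M) = \sum_j rd (col j M) (col j M).
Proof.
rewrite mtr_delta; apply: eq_bigr => j _.
by rewrite -mulmxA rd_ctr ctrK -colE.
Qed.

Lemma mtr_row n (e : 'rV[K]_n) : mtr (ctr e *m e) = rd (ctr e) (ctr e).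
Proof.
rewrite rdE /mtr; apply: eq_bigr => i _; rewrite !mxE big_ord1 !ctr_mxE.
by rewrite (ord1 ord0); case: (e 0 i) => a b /=; ring.
Qed.

End HermitianForms.

(** * Completion to a basis and eigenvectors *)

Section FieldLemmas.
Variable F : fieldType.

Lemma row_complete d (eta : 'rV[F]_(1 + d)) : eta != 0 ->
  exists2 T : 'M[F]_(1 + d), T \in unitmx & row_mx 1%:M 0 *m T = eta.
Proof.
move=> eta0; have rk : \rank eta = 1%N by rewrite rank_rV eta0.
have u1 : col_ebase eta \in unitmx by apply: col_ebase_unit.
exists (col_ebase eta 0 0 *: row_ebase eta).
  rewrite unitmxZ ?row_ebase_unit //.
  by move: u1; rewrite unitmxE det_mx11.
rewrite -[RHS](mulmx_ebase eta) rk [X in X *m pid_mx _]mx11_scalar.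
rewrite mul_scalar_mx -scalemxAl -scalemxAr; congr (_ *: (_ *m _)).
by rewrite pid_mx_row.
Qed.

Lemma col_complete d (v : 'cV[F]_(1 + d)) : v != 0 ->
  exists2 T : 'M[F]_(1 + d), T \in unitmx & T *m col_mx 1%:M 0 = v.
Proof.
move=> v0; have [|T Tu hT] := @row_complete d v^T.
  by apply: contra v0 => /eqP h; rewrite -[v]trmxK h trmx0.
exists T^T; first by rewrite unitmx_tr.
by apply: trmx_inj; rewrite trmx_mul trmxK tr_col_mx trmx1 trmx0.
Qed.

Lemma singular_col n (M : 'M[F]_n) : M \notin unitmx ->
  exists2 v : 'cV[F]_n, v != 0 & M *m v = 0.
Proof.
move=> h; have : kermx M^T != 0.
  by rewrite kermx_eq0 row_free_unit unitmx_tr.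
case/rowV0Pn => w /sub_kermxP hw w0; exists w^T.
  by apply: contra w0 => /eqP e; rewrite -[w]trmxK e trmx0.
by apply: trmx_inj; rewrite trmx_mul trmxK trmx0.
Qed.

Lemma left_right_eigen n (A : 'M[F]_n) l (eta : 'rV[F]_n) : eta != 0 ->
  eta *m A = l *: eta -> exists2 v : 'cV[F]_n, v != 0 & A *m v = l *: v.
Proof.
move=> eta0 h; have [|v v0 hv] := @singular_col n (A - l%:M).
  apply/negP => hu; case/negP: eta0; apply/eqP.
  apply: (can_inj (mulmxK hu)).
  by rewrite mul0mx mulmxBr h mul_mx_scalar subrr.
exists v => //; apply/eqP.
by rewrite -mul_scalar_mx -subr_eq0 -mulmxBl hv.
Qed.

End FieldLemmas.

(** * Gram factors of positive semidefinite matrices *)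

Section Factor.
Variable R : rcfType.
Local Notation K := R[i].
Local Notation re := (@complex.Re R).

(** Spectral theorem: scale the rows of the diagonalizing unitary matrix by the square roots of the
    eigenvalues. *)
Lemma herm_factor n (M : 'M[K]_n) : herm M -> psdh M ->
  exists G : 'M[K]_n, M = ctr G *m G.
Proof.
move=> hM pM.
have nM : M \is normalmx.
  apply: hermitian_normalmx; apply/is_hermitianmxP.
  by rewrite expr0 scale1r -{1}hM ctrE -map_trmx.
have := orthomx_spectralP nM.
rewrite invmx_unitary ?spectral_unitarymx //.
set U := spectralmx M; set s := spectral_diag M => eM.
have eU : map_mx Num.conj U^T = ctr U by rewrite ctrE map_trmx.
have UU : U *m ctr U = 1%:M by rewrite -eU; apply/unitarymxP/spectral_unitarymx.
rewrite {}eU in eM.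
have s0 i : 0 <= s 0 i.
  have := pM (ctr U *m delta_mx i 0); rewrite {1}eM !mulmxA.
  rewrite -(mulmxA _ U) UU mulmx1 -mulmxA rd_ctrl ctrK mulmxA UU mul1mx.
  have -> : diag_mx s *m (delta_mx i 0 : 'cV_n) = s 0 i *: delta_mx i 0.
    by rewrite mul_diag_mx; apply/colP => j; rewrite !mxE; case: eqP => [->|]; rewrite ?mulr0.
  rewrite rd_scale_self => h.
  have : s 0 i \is Num.real.
    have := hermitian_spectral_diag_real (A := M).
    have -> : M \is hermsymmx.
      by apply/is_hermitianmxP; rewrite expr0 scale1r -{1}hM ctrE -map_trmx.
    by move=> /(_ isT) /mxOverP; apply.
  move=> /RRe_real <-; rewrite ler0c; move: h.
  rewrite pmulr_lge0 // rd_gt0 //; apply/negP => /eqP /colP /(_ i).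
  by rewrite !mxE !eqxx => /eqP; rewrite oner_eq0.
pose r := map_mx (@sqrtc R) s.
exists (diag_mx r *m U); rewrite ctrM -mulmxA (mulmxA (ctr (diag_mx r))).
have -> : ctr (diag_mx r) *m diag_mx r = diag_mx s.
  rewrite ctrE map_diag_mx tr_diag_mx mulmx_diag; congr diag_mx.
  apply/rowP => j; rewrite !mxE.
  have h : 0 <= sqrtc (s 0 j) by rewrite sqrtc_ge0.
  have hc : conjc (sqrtc (s 0 j)) = sqrtc (s 0 j).
    by move: (ger0_Im h); case: (sqrtc _) => a b /= ->; rewrite oppr0.
  by rewrite [X in X * _]hc -expr2 sqr_sqrtc.
by rewrite mulmxA.
Qed.

(** The factor [G0] of [herm_factor] may have dependent rows. In its rank factorization the Gram
    matrix of the column base is invertible, hence has an invertible factor [G1], which is moved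
    onto the row base. Full row rank is what [min_factor_free] needs. *)
Lemma herm_factor_free n (M : 'M[K]_n) : herm M -> psdh M ->
  exists (r : nat) (G : 'M[K]_(r, n)), row_free G /\ M = ctr G *m G.
Proof.
move=> hM pM; have [G0 eM] := herm_factor hM pM.
pose H := ctr (col_base G0) *m col_base G0.
have hH : herm H by rewrite /herm ctrM ctrK.
have pH : psdh H by move=> v; rewrite -mulmxA rd_ctr ctrK rd_ge0.
have [G1 eH] := herm_factor hH pH.
have G1u : G1 \in unitmx.
  apply: contraT => /singular_col [v v0 hv]; case/negP: v0; apply/eqP.
  have : rd v (H *m v) = 0 by rewrite eH -mulmxA hv mulmx0 rd0r.
  rewrite -mulmxA rd_ctr ctrK => /rd_eq0 hc.
  have /row_fullP [Z hZ] := col_base_full G0.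
  by rewrite -[v]mul1mx -hZ -mulmxA hc mulmx0.
exists (\rank G0), (G1 *m row_base G0); split.
  by rewrite /row_free mxrankMfree ?row_base_free // mxrank_unit.
rewrite ctrM -mulmxA (mulmxA (ctr G1)) -eH /H eM -{1 2}(mulmx_base G0).
by rewrite ctrM !mulmxA.
Qed.

Lemma psdh_bound n (X : 'M[K]_n) v : herm X -> psdh X ->
  rd v (X *m v) <= n%:R * mtr X * rd v v.
Proof.
move=> hX pX; have [G ->] := herm_factor hX pX.
rewrite mtr_ctrmul -mulmxA rd_ctr ctrK; exact: mulmx_bound_col.
Qed.

Lemma psdh_bound2 n (X : 'M[K]_n) v w : herm X -> psdh X ->
  `|rd v (X *m w)| <= n%:R * mtr X * (rd v v + rd w w).
Proof.
move=> hX pX; have h1 := psdh_bound v hX pX; have h2 := psdh_bound w hX pX.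
have h3 := pX (v - w); have h4 := pX (v + w); have h5 := pX v; have h6 := pX w.
have e : rd w (X *m v) = rd v (X *m w) by rewrite rd_ctr hX rdC.
rewrite mulmxBr rdBl !rdBr e in h3; rewrite mulmxDr rdDl !rdDr e in h4.
by rewrite ler_norml mulrDr; apply/andP; split; lra.
Qed.

End Factor.

(** * Lyapunov forms of Hurwitz matrices *)

Section Lyapunov.
Variable R : rcfType.
Local Notation K := R[i].
Local Notation re := (@complex.Re R).

Definition hurw d (A : 'M[K]_d) :=
  forall l (v : 'cV_d), v != 0 -> A *m v = l *: v -> re l < 0.

Lemma hurw_left d (A : 'M[K]_d) l (eta : 'rV_d) : hurw A -> eta != 0 ->
  eta *m A = l *: eta -> re l < 0.
Proof.
by move=> hA e0 /(left_right_eigen e0) [v v0 hv]; apply: hA v0 hv.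
Qed.

Lemma hurw_unit d (A : 'M[K]_d) l : hurw A -> 0 <= re l -> l%:M - A \in unitmx.
Proof.
move=> hA hl; apply: contraT => /singular_col [v v0].
rewrite mulmxBl mul_scalar_mx => /eqP; rewrite subr_eq0 => /eqP h.
by have := hA l v v0 (esym h); rewrite ltNge hl.
Qed.

Lemma exists_eigen d (A : 'M[K]_d.+1) :
  exists l, exists2 v : 'cV_d.+1, v != 0 & A *m v = l *: v.
Proof.
have [l /eigenvalueP [w hw w0]] := @eigenvalue_closed R[i] _ A isT.
by exists l; apply: left_right_eigen w0 hw.
Qed.

Lemma split_right d (A : 'M[K]_(1 + d)) l v : v != 0 -> A *m v = l *: v ->
  exists T (a : 'rV_d) A1, [/\ T \in unitmx, T *m col_mx 1%:M 0 = v &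
    invmx T *m A *m T = block_mx l%:M a 0 A1].
Proof.
move=> v0 hv; have [T Tu hT] := col_complete v0.
pose A' := invmx T *m A *m T.
have h : A' *m col_mx 1%:M 0 = l *: col_mx 1%:M 0.
  by rewrite -mulmxA hT -mulmxA hv -scalemxAr -hT mulKmx.
exists T, (ursubmx A'), (drsubmx A'); split => //.
rewrite -/A' -[LHS]submxK; move: h.
rewrite -[A' in A' *m _]submxK mul_block_col !mulmx1 !mulmx0 !addr0.
rewrite scale_col_mx scaler0 scalemx1.
by move=> /eq_col_mx [-> ->].
Qed.

Lemma split_left d (A : 'M[K]_(1 + d)) l eta : eta != 0 -> eta *m A = l *: eta ->
  exists T (a : 'cV_d) A1, [/\ T \in unitmx, row_mx 1%:M 0 *m T = eta &
    T *m A *m invmx T = block_mx l%:M 0 a A1].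
Proof.
move=> e0 he; have [T Tu hT] := row_complete e0.
pose A' := T *m A *m invmx T.
have h : row_mx 1%:M 0 *m A' = l *: row_mx 1%:M 0.
  by rewrite !mulmxA hT he -scalemxAl -hT mulmxK.
exists T, (dlsubmx A'), (drsubmx A'); split => //.
rewrite -/A' -[LHS]submxK; move: h.
rewrite -[A' in _ *m A']submxK mul_row_block !mul1mx !mul0mx !addr0.
rewrite scale_row_mx scaler0 scalemx1.
by move=> /eq_row_mx [-> ->].
Qed.

Lemma rd_col_mx m n (x x' : 'cV[K]_m) (y y' : 'cV[K]_n) :
  rd (col_mx x y) (col_mx x' y') = rd x x' + rd y y'.
Proof. by rewrite /rd ctr_col_mx mul_row_col mxE reD. Qed.

Lemma rd_young n (x y : 'cV[K]_n) s : 0 < s -> 2 * rd x y <= s * rd x x + s^-1 * rd y y.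
Proof.
move=> s0; have := rd_ge0 (s%:C%C *: x - y).
rewrite !(rdBl, rdBr, rdZl, rdZr) (rdC y x) => h.
rewrite -(ler_pM2l s0) mulrDr [s * (s^-1 * _)]mulrA mulfV ?gt_eqF // mul1r.
by lra.
Qed.

(** Induction on the dimension. In coordinates where an eigenvector is split off, the block diagonal
    form with corner [a] and the form of the rest works once [a] is so small that Young's inequality
    absorbs the coupling [b] into the decay of the rest. *)
Lemma lyap_exists d (A : 'M[K]_d) : hurw A -> exists (P : 'M[_]_d) (c : R),
  [/\ 0 < c, herm P, (forall v, c * rd v v <= rd v (P *m v)) &
      forall v, 2 * rd (P *m v) (A *m v) <= - c * rd v v].
Proof.
elim: d A => [|d IH] A hA.
  exists 0, 1; split=> [||v|v]; rewrite ?ltr01 //; first by rewrite /herm ctr0.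
    by rewrite [v]flatmx0 mulmx0 !rd0r mulr0.
  by rewrite [v]flatmx0 !mulmx0 !rd0r !mulr0.
have [l [v v0 hv]] := exists_eigen A.
have [T [b [A1 [Tu _ eA]]]] := split_right v0 hv.
have sl : 0 < - re l by rewrite oppr_gt0; exact: hA v0 hv.
set s := - re l in sl.
have [|P1 [c1 [c10 hP1 pP1 lP1]]] := IH A1.
  (* An eigenvector of [A1] lifts to one of [A] unless its eigenvalue is [l], which is already known
     to lie in the left half-plane. *)
  move=> m w w0 hw; have [ml|nml] := eqVneq m l; first by rewrite ml; exact: hA v0 hv.
  pose z := T *m col_mx ((m - l)^-1 *: (b *m w)) w.
  apply: (hA m z).
    apply: contra w0 => /eqP /(congr1 (mulmx (invmx T))).
    by rewrite mulKmx // mulmx0 -col_mx0 => /eq_col_mx [_ ->].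
  have -> : A *m z = T *m (block_mx l%:M b 0 A1 *m col_mx ((m - l)^-1 *: (b *m w)) w).
    by rewrite -eA -!mulmxA mulKVmx.
  rewrite mul_block_col mul0mx add0r hw mul_scalar_mx /z [RHS]scalemxAr scale_col_mx.
  congr (_ *m col_mx _ _).
  rewrite !scalerA -[X in _ + X]scale1r -scalerDl; congr (_ *: _).
  have nz : m - l != 0 by rewrite subr_eq0.
  by rewrite -[1](mulfV nz) -mulrDl; congr (_ / _); ring.
have [kb kb0 hkb] := mulmx_bound b.
(* Chosen so that [a / s * (kb + 1) = c1 / 2], half the decay of [P1]. *)
pose a := c1 * s / (2 * (kb + 1)).
have a0 : 0 < a by rewrite divr_gt0 ?mulr_gt0 // ltr_wpDl.
pose P' : 'M[K]_(1 + d) := block_mx (a%:C%C)%:M 0 0 P1.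
have [c' c'0 [c'1 c'2]] : exists2 c', 0 < c' & [/\ c' <= a, c' <= c1 & c' <= a * s /\ c' <= c1 / 2].
  exists (Num.min (Num.min a (a * s)) (c1 / 2)).
    by rewrite !lt_min a0 mulr_gt0 // divr_gt0.
  rewrite !ge_min !lexx !orbT /=; split => //.
  by apply/orP; right; lra.
move=> [c'3 c'4].
have hP' : herm P'.
  by rewrite /herm /P' ctr_block_mx !ctr0 hP1 ctr_scalar conjc_real.
have pP' w : c' * rd w w <= rd w (P' *m w).
  rewrite -[w]vsubmxK mul_block_col !mul0mx addr0 add0r mul_scalar_mx !rd_col_mx rdZr.
  rewrite mulrDr lerD //; first by rewrite ler_wpM2r ?rd_ge0.
  by apply: le_trans (pP1 _); rewrite ler_wpM2r ?rd_ge0.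
have lP' w : 2 * rd (P' *m w) (block_mx l%:M b 0 A1 *m w) <= - c' * rd w w.
  rewrite -[w]vsubmxK !mul_block_col !mul0mx addr0 !add0r !mul_scalar_mx !rd_col_mx.
  set x := usubmx w; set y := dsubmx w.
  rewrite rdZl rdDr rd_scale_self.
  have h1 := rd_young x (b *m y) sl.
  have h2 := lP1 y.
  have h3 : a * (s^-1 * rd (b *m y) (b *m y)) <= c1 / 2 * rd y y.
    apply: (@le_trans _ _ (a * (s^-1 * ((kb + 1) * rd y y)))).
      rewrite ler_pM2l // ler_pM2l ?invr_gt0 //; apply: le_trans (hkb _) _.
      by rewrite mulrDl mul1r lerDl rd_ge0.
    rewrite le_eqVlt; apply/orP; left; apply/eqP; rewrite /a; field.
    by rewrite !gt_eqF //= ltr_wpDl.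
  have h4 : c' * rd x x <= a * s * rd x x by rewrite ler_wpM2r ?rd_ge0.
  have h5 : c' * rd y y <= c1 / 2 * rd y y by rewrite ler_wpM2r ?rd_ge0.
  have h6 : a * (2 * rd x (b *m y)) <= a * (s * rd x x) + a * (s^-1 * rd (b *m y) (b *m y)).
    by rewrite -mulrDr ler_pM2l.
  have -> : re l = - s by rewrite opprK.
  by lra.
have [kT kT0 hkT] := mulmx_bound T.
pose S := invmx T.
have kT1 : 0 < kT + 1 by rewrite ltr_wpDl.
have bd w : c' / (kT + 1) * rd w w <= c' * rd (S *m w) (S *m w).
  rewrite -mulrA ler_pM2l // mulrC ler_pdivrMr //.
  rewrite -{1 2}(mulKVmx Tu w); apply: le_trans (hkT _) _.
  by rewrite mulrC mulrDr mulr1 lerDl rd_ge0.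
exists (ctr S *m P' *m S), (c' / (kT + 1)); split.
- by rewrite divr_gt0.
- by rewrite /herm !ctrM ctrK hP' mulmxA.
- move=> w; apply: le_trans (bd w) _.
  by rewrite -!mulmxA rd_ctr ctrK.
- move=> w; rewrite -!mulmxA rd_ctrl ctrK.
  have -> : S *m (A *m w) = block_mx l%:M b 0 A1 *m (S *m w).
    by rewrite -eA -!mulmxA mulKVmx.
  apply: le_trans (lP' _) _; rewrite !mulNr lerN2; exact: bd.
Qed.

Lemma herm_neg_eigen n (M : 'M[K]_n) : herm M ->
  (forall (k : R) (v : 'cV_n), v != 0 -> M *m v = k%:C%C *: v -> 0 <= k) -> psdh M.
Proof.
move=> hM h.
have hs : M \is hermsymmx.
  by apply/is_hermitianmxP; rewrite expr0 scale1r -{1}hM ctrE -map_trmx.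
have := orthomx_spectralP (hermitian_normalmx hs).
rewrite invmx_unitary ?spectral_unitarymx //.
have := hermitian_spectral_diag_real hs.
set U := spectralmx M; set s := spectral_diag M => hr eM.
have eU : map_mx Num.conj U^T = ctr U by rewrite ctrE map_trmx.
have UU : U *m ctr U = 1%:M by rewrite -eU; apply/unitarymxP/spectral_unitarymx.
rewrite {}eU in eM.
have sr i : s 0 i = (re (s 0 i))%:C%C.
  by rewrite RRe_real //; move/mxOverP: hr; apply.
have s0 i : 0 <= re (s 0 i).
  apply: (h _ (ctr U *m delta_mx i 0)).
    apply/negP => /eqP /(congr1 (mulmx U)); rewrite mulmxA UU mul1mx mulmx0.
    by move=> /colP /(_ i); rewrite !mxE !eqxx => /eqP; rewrite oner_eq0.
  rewrite {1}eM !mulmxA -(mulmxA _ U) UU mulmx1 -mulmxA -sr scalemxAr.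
  congr (_ *m _); rewrite mul_diag_mx; apply/colP => j; rewrite !mxE.
  by case: eqP => [->|]; rewrite ?mulr0.
move=> v; rewrite eM -!mulmxA rd_ctr ctrK; move: (U *m v) => w.
rewrite rdE sumr_ge0 // => i _; rewrite mul_diag_mx !mxE sr.
case: (w i 0) (s0 i) => a b /= hk.
rewrite !mul0r subr0 addr0 !(mulrCA _ (complex.Re _)) -mulrDr.
by rewrite mulr_ge0 // addr_ge0 // -expr2 sqr_ge0.
Qed.

(** With a strict Lyapunov form [P], diagonalize [X] relative to [P]: for [X w = k P w] the
    hypothesis reads [k * rd (P w) (A w) <= 0], and the second factor is negative, so [k >= 0]. This
    takes the place of integrating along exp(tA). *)
Lemma lyap_pos d (A X : 'M[K]_d) : hurw A -> herm X ->
  (forall v, rd (X *m v) (A *m v) <= 0) -> psdh X.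
Proof.
move=> hA hX h; have [P [c [c0 hP pP lP]]] := lyap_exists hA.
have pP0 : psdh P by move=> v; apply: le_trans (pP v); rewrite mulr_ge0 ?rd_ge0 ?ltW.
have [G eP] := herm_factor hP pP0.
have Gu : G \in unitmx.
  apply: contraT => /singular_col [v v0 hv].
  have := pP v; rewrite eP -mulmxA hv mulmx0 rd0r leNgt.
  by rewrite mulr_gt0 ?rd_gt0.
pose S := invmx G.
pose X' := ctr S *m X *m S.
suff pX' : psdh X'.
  move=> v; have := pX' (G *m v).
  by rewrite /X' -!mulmxA mulKmx // rd_ctr ctrK mulKmx.
apply: herm_neg_eigen; first by rewrite /herm /X' !ctrM ctrK hX mulmxA.
move=> k v v0 hv; pose w := S *m v.
have vw : v = G *m w by rewrite mulKVmx.
have Xw : X *m w = k%:C%C *: (P *m w).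
  rewrite eP -mulmxA -vw.
  apply: (can_inj (mulKmx (_ : ctr S \in unitmx))); first by rewrite ctr_unit unitmx_inv.
  rewrite /w -scalemxAr !mulmxA hv -ctrM mulmxV // ctr1.
  by rewrite mul1mx.
have := h w; rewrite Xw rdZl => h1.
have w0 : w != 0 by apply: contra v0 => /eqP e; rewrite vw e mulmx0.
have h2 := lP w; have h3 := rd_gt0 w0.
have h4 : rd (P *m w) (A *m w) < 0.
  by have := mulr_gt0 c0 h3; lra.
by move: h1; rewrite nmulr_lle0.
Qed.

End Lyapunov.

(** * The dissipation inequality for controllable Hurwitz systems *)

Section GeneralizedLimit.
Variable R : realType.

Definition bseq (u : nat -> R) := exists M, forall k, `|u k| <= M.

Lemma bseqD u v : bseq u -> bseq v -> bseq (fun k => u k + v k).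
Proof.
move=> [M hM] [N hN]; exists (M + N) => k.
by apply: le_trans (ler_normD _ _) _; rewrite lerD.
Qed.

Lemma bseqZ c u : bseq u -> bseq (fun k => c * u k).
Proof. by move=> [M hM]; exists (`|c| * M) => k; rewrite normrM ler_wpM2l. Qed.

Lemma bseq_cst c : bseq (fun=> c). Proof. by exists `|c|. Qed.

Lemma bseq_sum (I : Type) (r : seq I) (u : I -> nat -> R) :
  (forall i, bseq (u i)) -> bseq (fun k => \sum_(i <- r) u i k).
Proof.
move=> h; elim: r => [|i r IH].
  by exists 0 => k; rewrite big_nil normr0.
have [M hM] := bseqD (h i) IH.
by exists M => k; rewrite big_cons.
Qed.

(* The limit along a free ultrafilter. *)
Lemma glim_exists : exists L : (nat -> R) -> R,
  [/\ forall u v, bseq u -> bseq v -> L (fun k => u k + v k) = L u + L v,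
      forall c u, bseq u -> L (fun k => c * u k) = c * L u,
      forall u, bseq u -> (forall k, 0 <= u k) -> 0 <= L u &
      forall u l, u @ \oo --> l -> L u = l].
Proof.
have [U [UU sU]] := @ultraFilterLemma nat \oo _.
have PU : ProperFilter U by exact: ultra_proper.
have cv u : bseq u -> cvg (u @ U).
  move=> [M hM].
  have hA : (u @ U) [set` `[- M, M]%R].
    by apply: (@filterE _ U _ (u @^-1` [set` `[- M, M]%R])) => k /=; rewrite in_itv /= -ler_norml.
  have [p [_ hp]] := @segment_compact R (- M) M (u @ U) _ hA.
  apply/cvg_ex; exists p => B hB.
  have [//|hn] := in_ultra_setVsetC (u @^-1` B) UU.
  have [|x [hx hx']] := hp (~` B) B _ hB; last by [].
  exact: hn.
exists (fun u => lim (u @ U)); split.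
- by move=> u v hu hv; apply/cvg_lim => //; apply: cvgD; exact: cv.
- by move=> c u hu; apply/cvg_lim => //; apply: cvgM; [exact: cvg_cst|exact: cv].
- by move=> u hu h; apply: limr_ge; [exact: cv | exact: filterE].
- by move=> u l hu; apply/cvg_lim => //; apply: cvg_trans hu; exact: cvg_app.
Qed.

End GeneralizedLimit.

(** * Compactness of the solutions of the dissipation inequality *)

Section KYP.
Variable R : realType.
Local Notation K := R[i].
Local Notation re := (@complex.Re R).
Local Notation im := (@complex.Im R).

Definition is_glim (L : (nat -> R) -> R) :=
  [/\ forall u v, bseq u -> bseq v -> L (fun k => u k + v k) = L u + L v,
      forall c u, bseq u -> L (fun k => c * u k) = c * L u,
      forall u, bseq u -> (forall k, 0 <= u k) -> 0 <= L u &
      forall u l, u @ \oo --> l -> L u = l].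

Lemma glim_cst L c : is_glim L -> L (fun=> c) = c.
Proof. by case=> _ _ _; apply; exact: cvg_cst. Qed.

Lemma glim_sum L (I : Type) (r : seq I) (u : I -> nat -> R) : is_glim L ->
  (forall i, bseq (u i)) ->
  L (fun k => \sum_(i <- r) u i k) = \sum_(i <- r) L (u i).
Proof.
move=> hL hu; elim: r => [|i r IH].
  by rewrite big_nil -[RHS](glim_cst 0 hL); congr L; apply/funext => k; rewrite big_nil.
case: (hL) => hD _ _ _; rewrite big_cons -IH -hD //; last exact: bseq_sum.
by congr L; apply/funext => k; rewrite big_cons.
Qed.

Lemma glim_le L u v : is_glim L -> bseq u -> bseq v -> (forall k, u k <= v k) ->
  L u <= L v.
Proof.
move=> [hD hZ h0 _] hu hv h; rewrite -subr_ge0 -mulN1r -hZ // -hD //; last exact: bseqZ.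
apply: h0 => [|k]; first by apply: bseqD => //; exact: bseqZ.
by rewrite mulN1r subr_ge0.
Qed.

Lemma rd_entries m n (v : 'cV[K]_m) (M : 'M[K]_(m, n)) w :
  rd v (M *m w) = \sum_i \sum_j (re (conjc (v i 0) * w j 0) * re (M i j)
                               - im (conjc (v i 0) * w j 0) * im (M i j)).
Proof.
rewrite /rd mxE re_sum; apply: eq_bigr => i _; rewrite ctr_mxE !mxE mulr_sumr re_sum.
apply: eq_bigr => j _.
by case: (v i 0) (M i j) (w j 0) => a b [c d] [e f] /=; ring.
Qed.

(** A trace bound makes every entry bounded, so the generalized limit can be taken entrywise; by
    linearity it commutes with each form [rd v (X w)]. *)
Lemma psd_limit L n (X : nat -> 'M[K]_n) M : is_glim L ->
  (forall k, herm (X k)) -> (forall k, psdh (X k)) -> (forall k, mtr (X k) <= M) ->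
  exists Xl, herm Xl /\ forall v w, bseq (fun k => rd v (X k *m w)) /\
    L (fun k => rd v (X k *m w)) = rd v (Xl *m w).
Proof.
move=> hL hX pX tX.
have bX v w : bseq (fun k => rd v (X k *m w)).
  exists (n%:R * M * (rd v v + rd w w)) => k.
  apply: le_trans (psdh_bound2 v w (hX k) (pX k)) _.
  by rewrite ler_wpM2r ?addr_ge0 ?rd_ge0 // ler_wpM2l.
have bre i j : bseq (fun k => re (X k i j)).
  have [N hN] := bX (delta_mx i 0) (delta_mx j 0); exists N => k.
  by have := hN k; rewrite rd_delta -colE mxE.
have bim i j : bseq (fun k => im (X k i j)).
  have [N hN] := bX (Complex 0 1 *: delta_mx i 0) (delta_mx j 0); exists N => k.
  have := hN k; rewrite -colE; congr (`| _ | <= _).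
  rewrite rdE (bigD1 i) //= big1 ?addr0 => [|l li]; rewrite !mxE ?eqxx ?(negbTE li) /=.
    by case: (X k i j) => a b /=; ring.
  by ring.
pose Xl : 'M[K]_n := \matrix_(i, j) Complex (L (fun k => re (X k i j))) (L (fun k => im (X k i j))).
have eL v w : L (fun k => rd v (X k *m w)) = rd v (Xl *m w).
  transitivity (L (fun k => \sum_i \sum_j (re (conjc (v i 0) * w j 0) * re (X k i j)
                               + (- im (conjc (v i 0) * w j 0)) * im (X k i j)))).
    congr L; apply/funext => k; rewrite rd_entries; apply: eq_bigr => i _.
    by apply: eq_bigr => j _; rewrite mulNr.
  have bb i j : bseq (fun k => re (conjc (v i 0) * w j 0) * re (X k i j)
                               + (- im (conjc (v i 0) * w j 0)) * im (X k i j)).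
    by apply: bseqD; apply: bseqZ.
  rewrite glim_sum //; last by move=> i; apply: bseq_sum.
  rewrite rd_entries; apply: eq_bigr => i _; rewrite glim_sum //.
  apply: eq_bigr => j _; case: (hL) => hD hZ _ _.
  rewrite hD ?hZ //; try exact: bseqZ.
  by rewrite !mxE mulNr.
exists Xl; split => //; apply: rd_mx_eq => v w.
rewrite rd_ctr ctrK rdC -!eL; congr L; apply/funext => k.
by rewrite rd_ctr hX rdC.
Qed.

Section System.
Variables (d n m : nat) (A : 'M[K]_d) (B : 'M[K]_(d, n)) (Cm : 'M[K]_(m, d)) (D : 'M[K]_(m, n)).

(** The storage with matrix [X] grows no faster than the supply |u|^2 - g |y|^2. At [g = 1] this is
    positivity of [Lambda]; at [g = 0] it has the solution 0, where the continuation starts. *)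
Definition diss g (X : 'M[K]_d) := forall x u,
  2 * rd (X *m x) (A *m x + B *m u) <=
  rd u u - g * rd (Cm *m x + D *m u) (Cm *m x + D *m u).

(** The Popov-Belevitch-Hautus form of controllability: its failure hands over the mode to be split
    off. *)
Definition ctrb := forall l (eta : 'rV_d), eta *m A = l *: eta -> eta *m B = 0 -> eta = 0.

(** Contractivity of the transfer function on the imaginary axis, written with the state so that no
    resolvent occurs. *)
Definition fdi := forall l x u, re l = 0 -> l *: x = A *m x + B *m u ->
  rd (Cm *m x + D *m u) (Cm *m x + D *m u) <= rd u u.

Hypothesis hA : hurw A.

Lemma diss_psd g X : 0 <= g -> herm X -> diss g X -> psdh X.
Proof.
move=> g0 hX dX; apply: lyap_pos hA hX _ => v.
have := dX v 0; rewrite !mulmx0 !addr0 rd0r.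
by have := mulr_ge0 g0 (rd_ge0 (Cm *m v)); lra.
Qed.

(** For fixed [x] and [u] both sides are affine in [X] and in the gain, so the inequality survives
    the generalized limit. The trace is carried along for [diss_min]. *)
Lemma diss_closed L (X : nat -> 'M[K]_d) (g : nat -> R) gl M : is_glim L ->
  (forall k, 0 <= g k) -> (g @ \oo --> gl) ->
  (forall k, herm (X k)) -> (forall k, diss (g k) (X k)) -> (forall k, mtr (X k) <= M) ->
  exists Xl, [/\ herm Xl, diss gl Xl & mtr Xl = L (fun k => mtr (X k))].
Proof.
move=> hL g0 hg hX dX tX.
have pX k := diss_psd (g0 k) (hX k) (dX k).
have [Xl [hXl eX]] := psd_limit hL hX pX tX.
exists Xl; split => //.
  move=> x u; set y := Cm *m x + D *m u; set z := A *m x + B *m u.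
  have [b1 e1] := eX z x.
  rewrite rdC -e1; case: (hL) => hD hZ hp hc.
  have hg' : (fun k => rd u u + - rd y y * g k) @ \oo --> rd u u + - rd y y * gl.
    by apply: cvgD; [exact: cvg_cst | apply: cvgM => //; exact: cvg_cst].
  rewrite [gl * _]mulrC -mulNr -(hc _ _ hg') -hZ //; apply: glim_le => //.
  - exact: bseqZ.
  - apply: bseqD; first exact: bseq_cst.
    apply: bseqZ.
    have /cvg_seq_bounded [N [_ /(_ (N + 1))]] : cvgn g by apply/cvg_ex; exists gl.
    rewrite ltrDl ltr01 => /(_ isT) hN; exists (N + 1) => k; exact: hN.
  - by move=> k; have := dX k x u; rewrite rdC -/y -/z; lra.
rewrite mtr_delta; under eq_bigr => i _ do rewrite -(eX _ _).2.
rewrite -glim_sum //; last by move=> i; exact: (eX _ _).1.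
by congr L; apply/funext => k; rewrite mtr_delta.
Qed.

Lemma diss_min g : 0 <= g -> (exists X, herm X /\ diss g X) ->
  exists X, [/\ herm X, diss g X & forall Y, herm Y -> diss g Y -> mtr X <= mtr Y].
Proof.
move=> g0 [X0 [hX0 dX0]].
pose S := [set t | exists X, [/\ herm X, diss g X & t = mtr X]].
have S0 : lbound S 0.
  by move=> _ [X [hX dX ->]]; apply/mtr_ge0/(diss_psd g0 hX dX).
have hS : has_inf S by split; [exists (mtr X0), X0|exists 0].
have [L hL] := glim_exists R.
have h k : exists X, [/\ herm X, diss g X & mtr X < inf S + k.+1%:R^-1].
  have [//|t [X [hX dX ->]] ht] := @inf_adherent _ S (k.+1%:R^-1) _ hS.
  by exists X.
have /choice [X hX] := h.
have [| | | |k|Xl [hXl dXl tXl]] := @diss_closed L X (fun=> g) g (inf S + 1) hL.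
- by [].
- exact: cvg_cst.
- by move=> k; case: (hX k).
- by move=> k; case: (hX k).
- have [_ _ /ltW h1] := hX k; apply: le_trans h1 _; rewrite lerD2l.
  by rewrite invf_le1 ?ltr0n // ler1n.
exists Xl; split => // Y hY dY.
apply: (@le_trans _ _ (inf S)); last by apply: ge_inf; [exists 0|exists Y].
rewrite tXl; case: (hL) => _ _ _ hc.
rewrite (hc _ (inf S)) //.
apply: (@squeeze_cvgr _ _ _ _ (fun=> inf S) (fun k => inf S + k.+1%:R^-1)).
- apply: nearW => k; case: (hX k) => h1 h2 /ltW ->; rewrite andbT.
  by apply: ge_inf; [exists 0|exists (X k)].
- exact: cvg_cst.
- rewrite -[X in _ --> X]addr0; apply: cvgD; first exact: cvg_cst.
  exact: cvg_harmonic.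
Qed.

(** Otherwise normalize solutions of growing trace. In the limit [Z] of trace 1 the supply
    disappears and [2 * rd (Z x) (A x + B u) <= 0] for all [x] and [u]. Hence [Z B = 0] and the
    kernel of [Z] is invariant under [A], so the row space of [Z] contains a left eigenvector of [A]
    that [B] annihilates. *)
Lemma ctrb_bound : ctrb -> exists M, forall g X, 0 <= g -> herm X -> diss g X -> mtr X <= M.
Proof.
move=> cAB; apply/not_existsP => hn.
have h k : exists X, exists g, [/\ 0 <= g, herm X, diss g X & k.+1%:R < mtr X].
  apply/not_existsP => hk; apply: (hn k.+1%:R) => g X g0 hX dX.
  by rewrite leNgt; apply/negP => hlt; apply: (hk X); exists g.
have /choice [X hX] := h.
have tp k : 0 < mtr (X k) by have [g [_ _ _ h1]] := hX k; apply: le_lt_trans h1.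
pose Y k := ((mtr (X k))^-1)%:C%C *: X k.
have hY k : herm (Y k).
  by have [g [_ h1 _ _]] := hX k; rewrite /herm /Y ctrZ h1 conjc_real.
have pY k : psdh (Y k).
  have [g [g0 h1 h2 _]] := hX k => v; rewrite -scalemxAl rdZr.
  by rewrite mulr_ge0 ?invr_ge0 ?(ltW (tp k)) //; exact: (diss_psd g0 h1 h2).
have tY k : mtr (Y k) = 1 by rewrite mtrZ mulVf // gt_eqF.
have [L hL] := glim_exists R.
have [|Z [hZ eZ]] := @psd_limit L d Y 1 hL hY pY; first by move=> k; rewrite tY.
have tZ : mtr Z = 1.
  rewrite mtr_delta; under eq_bigr => i _ do rewrite -(eZ _ _).2.
  rewrite -glim_sum //; last by move=> i; exact: (eZ _ _).1.
  by rewrite -[RHS](glim_cst 1 hL); congr L; apply/funext => k; rewrite -mtr_delta tY.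
have pZ : psdh Z.
  by move=> v; rewrite -(eZ _ _).2; case: (hL) => _ _ h0 _; apply: h0; [exact: (eZ _ _).1|move=> k; exact: pY].
have ineq x u : 2 * rd (Z *m x) (A *m x + B *m u) <= 0.
  have [b1 e1] := eZ (A *m x + B *m u) x.
  rewrite rdC -e1; case: (hL) => hD hM hp hc.
  have cv : (fun k => rd u u * k.+1%:R^-1) @ \oo --> 0.
    rewrite -[X in _ --> X](mulr0 (rd u u)); apply: cvgM; first exact: cvg_cst.
    exact: cvg_harmonic.
  rewrite -(hc _ _ cv) -hM //; apply: glim_le => //; first exact: bseqZ.
    apply: bseqZ; exists 1 => k.
    by rewrite ger0_norm ?invr_ge0 // invf_le1 ?ltr0n // ler1n.
  move=> k; have [g [g0 h1 h2 h3]] := hX k.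
  rewrite -scalemxAl rdZr mulrCA mulrC ler_pdivrMr //.
  rewrite rdC; apply: le_trans (h2 x u) _.
  apply: (@le_trans _ _ (rd u u)).
    by rewrite gerBl mulr_ge0 // rd_ge0.
  rewrite -mulrA ler_peMr ?rd_ge0 // mulrC ler_pdivlMr ?ltr0n // mul1r; exact: ltW.
have ZB : Z *m B = 0.
  apply: rd_mx_eq => x u; rewrite mul0mx rd0r -mulmxA rd_ctr hZ.
  apply/eqP; apply: contraT => nz.
  pose b := rd (Z *m x) (B *m u); pose a := rd (Z *m x) (A *m x).
  (* With this multiple of [u] the left side equals 2. *)
  have := ineq x (((1 - a) / b)%:C%C *: u).
  rewrite -scalemxAr rdDr rdZr -/a -/b mulfVK // => h1; lra.
have kZ N (V : 'M[K]_(d, N)) : Z *m V = 0 -> Z *m (A *m V) = 0.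
  move=> hV; apply: rd_mx_eq => v w; rewrite mul0mx rd0r -!mulmxA.
  set x := V *m w; have Zx : Z *m x = 0 by rewrite mulmxA hV mul0mx.
  (* [S] is positive semidefinite and its form vanishes on the kernel of [Z], so [S x = 0], which
     there reads [Z A x = 0]. *)
  pose S := - (ctr A *m Z + Z *m A).
  have hS : herm S by rewrite /herm /S ctrN ctrD !ctrM ctrK hZ addrC.
  have pS : psdh S.
    move=> z; have := ineq z 0; rewrite mulmx0 addr0 /S mulNmx rdNr mulmxDl rdDr.
    rewrite -!mulmxA [rd z (ctr A *m _)]rd_ctr ctrK [rd z (Z *m _)]rd_ctr hZ (rdC (A *m z)); lra.
  have : S *m x = 0.
    apply: psdh_ker => //; rewrite /S mulNmx mulmxDl -!mulmxA Zx mulmx0 add0r.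
    by rewrite rdNr rd_ctr hZ Zx rd0l oppr0.
  rewrite /S mulNmx mulmxDl -!mulmxA Zx mulmx0 add0r => /eqP.
  by rewrite oppr_eq0 => /eqP ->; rewrite rd0r.
have Z0 : Z != 0.
  apply/eqP => Z0; move: tZ; rewrite Z0 /mtr big1 => [/eqP|i _]; last by rewrite mxE.
  by rewrite eq_sym oner_eq0.
have stab : (row_base Z *m A <= row_base Z)%MS.
  rewrite eq_row_base (eqmxMr _ (eq_row_base Z)) submxE -mulmxA kZ //.
  by rewrite mulmx_coker.
have [A' eA'] := submxP stab.
have [r er] : exists r, \rank Z = r.+1.
  by move: Z0; rewrite -mxrank_eq0; case: (\rank Z) => // r _; exists r.
have [|l hl] := @eigenvalue_closed R[i] _ A'; first by rewrite er.
have [w hw w0] := eigenvalueP hl.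
case/negP: w0; apply/eqP; apply: (row_free_inj (row_base_free Z)).
rewrite mul0mx; apply: (cAB l).
  by rewrite -mulmxA eA' mulmxA hw -scalemxAl.
have /submxP [G ->] : (row_base Z <= Z)%MS by rewrite eq_row_base.
by rewrite -!mulmxA ZB !mulmx0.
Qed.

End System.
End KYP.

(** * Spectral factors of solutions of least trace *)

Section KYP.
Variable R : realType.
Local Notation K := R[i].
Local Notation re := (@complex.Re R).
Local Notation im := (@complex.Im R).

Section System.
Variables (d n m : nat) (A : 'M[K]_d) (B : 'M[K]_(d, n)) (Cm : 'M[K]_(m, d)) (D : 'M[K]_(m, n)).

Local Notation diss := (diss A B Cm D).

(** The dissipation matrix is [ctr (row_mx L W) *m row_mx L W]. By [slack], the supply minus the
    growth of the storage is then the squared norm of [L x + W u]. *)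
Definition spectral_factor (g : R) X r (L : 'M[K]_(r, d)) (W : 'M[K]_(r, n)) :=
  [/\ - (ctr A *m X) - X *m A - g%:C%C *: (ctr Cm *m Cm) = ctr L *m L,
      - (X *m B) - g%:C%C *: (ctr Cm *m D) = ctr L *m W &
      1%:M - g%:C%C *: (ctr D *m D) = ctr W *m W].

Let form11 X g x : herm X ->
  rd x ((- (ctr A *m X) - X *m A - g%:C%C *: (ctr Cm *m Cm)) *m x) =
  - (2 * rd (X *m x) (A *m x)) - g * rd (Cm *m x) (Cm *m x).
Proof.
move=> hX; rewrite mulmxBl mulmxBl mulNmx -scalemxAl rdBr rdBr rdNr rdZr.
rewrite -(mulmxA (ctr A)) -(mulmxA X) -(mulmxA (ctr Cm)).
rewrite (rd_ctr (ctr A)) (rd_ctr (ctr Cm)) [rd x (X *m _)]rd_ctr hX !ctrK [rd (A *m x) _]rdC.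
by ring.
Qed.

Let form12 X g x u : herm X ->
  rd x ((- (X *m B) - g%:C%C *: (ctr Cm *m D)) *m u) =
  - rd (X *m x) (B *m u) - g * rd (Cm *m x) (D *m u).
Proof.
move=> hX; rewrite mulmxBl mulNmx -scalemxAl rdBr rdNr rdZr.
rewrite -(mulmxA X) -(mulmxA (ctr Cm)).
by rewrite (rd_ctr (ctr Cm)) (rd_ctr X) hX ctrK.
Qed.

Let form22 g u :
  rd u ((1%:M - g%:C%C *: (ctr D *m D)) *m u) = rd u u - g * rd (D *m u) (D *m u).
Proof.
rewrite mulmxBl mul1mx -scalemxAl rdBr rdZr -(mulmxA (ctr D)).
by rewrite (rd_ctr (ctr D)) ctrK.
Qed.

Let slackE g X x u :
  rd u u - g * rd (Cm *m x + D *m u) (Cm *m x + D *m u)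
  - 2 * rd (X *m x) (A *m x + B *m u) =
  (- (2 * rd (X *m x) (A *m x)) - g * rd (Cm *m x) (Cm *m x)) +
  2 * (- rd (X *m x) (B *m u) - g * rd (Cm *m x) (D *m u)) +
  (rd u u - g * rd (D *m u) (D *m u)).
Proof.
rewrite rdDr [rd _ (Cm *m x)]rdDl [rd _ (D *m u)]rdDl (rdC (D *m u) (Cm *m x)) rdDr.
by ring.
Qed.

Lemma rd_block n1 n2 (P : 'M[K]_n1) (Q : 'M[K]_(n1, n2)) (S : 'M[K]_n2) x u :
  rd (col_mx x u) (block_mx P Q (ctr Q) S *m col_mx x u) =
  rd x (P *m x) + 2 * rd x (Q *m u) + rd u (S *m u).
Proof.
rewrite mul_block_col rd_col_mx rdDr rdDr (rd_ctr (ctr Q)) ctrK (rdC (Q *m u)).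
by ring.
Qed.

Lemma diss_factor g X : herm X -> diss g X ->
  exists r (L : 'M[K]_(r, d)) (W : 'M[K]_(r, n)),
    row_free (row_mx L W) /\ spectral_factor g X L W.
Proof.
move=> hX dX.
have h1 : herm (- (ctr A *m X) - X *m A - g%:C%C *: (ctr Cm *m Cm)).
  rewrite /herm ctrB ctrB ctrN ctrZ conjc_real ctrM ctrM ctrM !ctrK hX.
  by rewrite [- (X *m A) - _]addrC.
have h3 : herm (1%:M - g%:C%C *: (ctr D *m D)).
  by rewrite /herm ctrB ctr1 ctrZ conjc_real ctrM ctrK.
have q1 x := form11 g x hX.
have q2 x u := form12 g x u hX.
have q3 u := form22 g u.
rewrite /spectral_factor.
move: (- (ctr A *m X) - X *m A - _) (- (X *m B) - _) (1%:M - _) h1 h3 q1 q2 q3.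
move=> P Q S hP hS q1 q2 q3.
have hH : herm (block_mx P Q (ctr Q) S) by rewrite /herm ctr_block_mx ctrK hP hS.
have [|r [G [fG eG]]] := herm_factor_free hH.
  move=> v; rewrite -[v]vsubmxK rd_block q1 q2 q3.
  by have := dX (usubmx v) (dsubmx v); rewrite -subr_ge0 slackE.
exists r, (lsubmx G), (rsubmx G); rewrite hsubmxK; split => //.
move: eG; rewrite -[G]hsubmxK ctr_row_mx mul_col_row => /eq_block_mx [e1 e2 _ e4].
by rewrite row_mxKl row_mxKr.
Qed.

Lemma slack g X r (L : 'M[K]_(r, d)) (W : 'M[K]_(r, n)) x u : herm X ->
  spectral_factor g X L W ->
  rd u u - g * rd (Cm *m x + D *m u) (Cm *m x + D *m u)
  - 2 * rd (X *m x) (A *m x + B *m u) = rd (L *m x + W *m u) (L *m x + W *m u).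
Proof.
move=> hX [e1 e2 e3].
rewrite slackE -form11 // -form12 // -form22 e1 e2 e3.
rewrite -(mulmxA _ L) -(mulmxA _ W) -(mulmxA _ W) (rd_ctr (ctr L)) (rd_ctr (ctr L)) (rd_ctr (ctr W)) !ctrK.
rewrite [RHS]rdDr [rd (_ + _) (L *m x)]rdDl [rd (_ + _) (W *m u)]rdDl (rdC (W *m u) (L *m x)).
by ring.
Qed.

Hypothesis hA : hurw A.

(* If [w] annihilates the spectral factor at [mu] in the open right half-plane
   then subtracting a multiple of the rank-one matrix [ctr e *m e], where
   [e = w L (mu - A)^-1], keeps the dissipation inequality ("zero flipping"). *)
Lemma min_factor_free g X r (L : 'M[K]_(r, d)) (W : 'M[K]_(r, n)) mu :
  herm X -> diss g X -> (forall Y, herm Y -> diss g Y -> mtr X <= mtr Y) ->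
  row_free (row_mx L W) -> spectral_factor g X L W -> 0 < re mu ->
  row_free (W + L *m invmx (mu%:M - A) *m B).
Proof.
move=> hX dX minX fr sf mu0; apply/row_freeP; apply/row_freeP.
rewrite -kermx_eq0; apply/rowV0P => w /sub_kermxP hw.
have Mu : mu%:M - A \in unitmx by apply: hurw_unit => //; exact: ltW.
pose e := w *m L *m invmx (mu%:M - A).
have eA : e *m (mu%:M - A) = w *m L by rewrite mulmxKV.
have eB : e *m B = - (w *m W).
  by apply/eqP; rewrite -addr_eq0 addrC /e -!mulmxA -mulmxDr mulmxA hw.
have [k k0 hk] := mulmx_bound w.
(* Since |w f|^2 <= k |f|^2, this weight lets Young's inequality pay for the cross term with |f|^2
   and the gain 2 t Re mu |e x|^2. *)
pose t := 2 * re mu / (k + 1).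
have t0 : 0 < t by rewrite divr_gt0 ?mulr_gt0 // ltr_wpDl.
pose Y := X - t%:C%C *: (ctr e *m e).
have hY : herm Y by rewrite /herm /Y ctrB ctrZ ctrM ctrK hX conjc_real.
have dY : diss g Y.
  move=> x u; have := slack x u hX sf; set f := L *m x + W *m u.
  have e1 : e *m (A *m x + B *m u) = mu *: (e *m x) - w *m f.
    have : e *m (mu%:M - A) *m x = w *m L *m x by rewrite eA.
    rewrite mulmxBr mulmxBl mul_mx_scalar -scalemxAl => /eqP.
    rewrite subr_eq => /eqP ->.
    rewrite mulmxDr [e *m (B *m u)]mulmxA eB mulNmx /f mulmxDr !mulmxA.
    by rewrite opprD addrACA subrr add0r.
  rewrite /Y mulmxBl rdBl -scalemxAl rdZl -[ctr e *m e *m x]mulmxA.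
  rewrite [rd (ctr e *m _) _]rd_ctrl ctrK e1 rdBr rd_scale_self.
  have h1 := rd_young (e *m x) (w *m f) (mulr_gt0 (ltr0n R 2) mu0).
  have h2 : t * ((2 * re mu)^-1 * rd (w *m f) (w *m f)) <= rd f f.
    apply: (@le_trans _ _ (t * ((2 * re mu)^-1 * ((k + 1) * rd f f)))).
      rewrite ler_pM2l // ler_pM2l ?invr_gt0 ?mulr_gt0 //; apply: le_trans (hk f) _.
      by rewrite mulrDl mul1r lerDl rd_ge0.
    rewrite le_eqVlt; apply/orP; left; apply/eqP; rewrite /t; field.
    by rewrite !gt_eqF //= ltr_wpDl.
  have h3 : t * (2 * rd (e *m x) (w *m f)) <= t * (2 * re mu * rd (e *m x) (e *m x)) + t * ((2 * re mu)^-1 * rd (w *m f) (w *m f)).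
    by rewrite -mulrDr ler_pM2l.
  lra.
(* The trace of [Y] is smaller by [t] times the squared norm of [e], so minimality forces [e = 0];
   then [w] annihilates [row_mx L W]. *)
have := minX Y hY dY.
rewrite /Y mtrB mtrZ lerBrDl gerDr pmulr_rle0 // => te.
have e0 : e = 0.
  apply: ctr_eq0; apply: rd_eq0; apply/eqP; rewrite eq_le rd_ge0 andbT.
  by rewrite -mtr_row.
apply: (row_free_inj fr); rewrite mul0mx mul_mx_row -row_mx0; congr row_mx.
  by rewrite -eA e0 mul0mx.
by apply/eqP; rewrite -oppr_eq0 -eB e0 mul0mx.
Qed.

Lemma fdi_feedthrough : fdi A B Cm D -> forall u, rd (D *m u) (D *m u) <= rd u u.
Proof.
move=> hf u; apply/ler_addgt0Pr => eps eps0.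
(* [(i w - A)^-1 B u] tends to 0 as [w] grows. *)
have [ka ka0 hka] := mulmx_bound A; have [kc kc0 hkc] := mulmx_bound Cm.
have b0 := rd_ge0 (B *m u); set b := rd (B *m u) (B *m u) in b0.
have small e : 0 < e -> exists l x, [/\ re l = 0, l *: x = A *m x + B *m u & rd x x <= e].
  (* As [l] is i times the square root of [w2], one has w2 |x|^2 = |A x + B u|^2 <= 2 ka |x|^2 + 2
     b; the summands of [w2] turn this into (1 + 2 b / e) |x|^2 <= 2 b. *)
  move=> e0; pose w2 := 2 * ka + 1 + 2 * b / e.
  have be0 : 0 <= 2 * b / e by rewrite divr_ge0 ?mulr_ge0 // ltW.
  have w20 : 0 < w2 by rewrite /w2; lra.
  pose l : K := Complex 0 (Num.sqrt w2).
  have lu : l%:M - A \in unitmx by apply: hurw_unit.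
  pose x := invmx (l%:M - A) *m (B *m u).
  have hx : l *: x = A *m x + B *m u.
    by apply/eqP; rewrite addrC -subr_eq -mul_scalar_mx -mulmxBl /x mulKVmx.
  exists l, x; split => //.
  have h1 : w2 * rd x x = rd (A *m x + B *m u) (A *m x + B *m u).
    by rewrite -hx rd_scale2 /= expr0n add0r sqr_sqrtr // ltW.
  have h2 := rd_add_le (A *m x) (B *m u); rewrite -h1 -/b in h2.
  have h3 := hka x.
  rewrite leNgt; apply/negP; move: h2 h3; move: (rd x x) (rd (A *m x) (A *m x)) => p q h2 h3 hlt.
  have h4 : (1 + 2 * b / e) * p <= 2 * b.
    have -> : 1 + 2 * b / e = w2 - 2 * ka by rewrite /w2; ring.
    by lra.
  have : 2 * b / e * e <= 2 * b / e * p by rewrite ler_wpM2l // ltW.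
  rewrite mulfVK ?gt_eqF // => h5.
  by lra.
have [s s0 hs] : exists2 s, 0 < s & s * rd u u <= eps / 2.
  have p : 0 < rd u u + 1 by rewrite ltr_wpDl ?rd_ge0.
  exists (eps / 2 / (rd u u + 1)); first by rewrite !divr_gt0.
  rewrite mulrAC ler_pdivrMr // ler_wpM2l ?divr_ge0 ?ltW //; lra.
pose c := (1 + s^-1) * (kc + 1).
have c0 : 0 < c by rewrite mulr_gt0 ?ltr_wpDl // ?invr_gt0 // ltr_pwDl ?invr_ge0 // ltW.
have [|l [x [l0 hx hxe]]] := small (eps / 2 / c); first by rewrite !divr_gt0.
have h1 := hf l x u l0 hx.
have h2 := hkc x.
set y := Cm *m x + D *m u in h1.
have -> : D *m u = y - Cm *m x by rewrite /y addrC addKr.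
rewrite rd_subsq.
have h3 := rd_young y (- (Cm *m x)) s0.
rewrite !rdNr rdNl opprK in h3.
have h4 : s * rd y y <= eps / 2.
  by apply: le_trans hs; rewrite ler_pM2l.
have h5 : (1 + s^-1) * rd (Cm *m x) (Cm *m x) <= eps / 2.
  have q : 0 < 1 + s^-1 by rewrite ltr_pwDl ?invr_ge0 // ltW.
  apply: (@le_trans _ _ (c * rd x x)).
    rewrite /c -mulrA ler_pM2l //; apply: le_trans h2 _.
    by rewrite mulrDl mul1r lerDl rd_ge0.
  by rewrite mulrC -ler_pdivlMr.
lra.
Qed.

End System.
End KYP.

(** * Continuation in the output gain *)

Section KYP.
Variable R : realType.
Local Notation K := R[i].
Local Notation re := (@complex.Re R).
Local Notation im := (@complex.Im R).

Lemma herm_rd_scale n (X : 'M[K]_n) l x : herm X ->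
  rd (X *m x) (l *: x) = re l * rd (X *m x) x.
Proof.
move=> hX; rewrite /rd -scalemxAr mxE.
have : conjc ((ctr (X *m x) *m x) 0 0) = (ctr (X *m x) *m x) 0 0.
  by rewrite -ctr_mxE ctrM ctrK ctrM hX mulmxA.
by case: (_ 0 0) l => a b [c e] /= [] h; rewrite (_ : b = 0); [ring|lra].
Qed.

Section System.
Variables (d n m : nat) (A : 'M[K]_d) (B : 'M[K]_(d, n)) (Cm : 'M[K]_(m, d)) (D : 'M[K]_(m, n)).
Local Notation diss := (diss A B Cm D).
Local Notation spectral_factor := (spectral_factor A B Cm D).
Hypothesis hA : hurw A.
Hypothesis hF : fdi A B Cm D.

(** Here [ctr W *m W] is 1 minus [g] times [ctr D *m D], and this is positive definite: [D] is a
    contraction by [fdi_feedthrough], and [g < 1]. *)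
Lemma factor_inj g X r (L : 'M[K]_(r, d)) (W : 'M[K]_(r, n)) (u : 'cV_n) :
  0 <= g < 1 -> herm X -> spectral_factor g X L W -> W *m u = 0 -> u = 0.
Proof.
move=> /andP[g0 g1] hX sf hu; have := slack 0 u hX sf.
rewrite hu !mulmx0 !add0r rd0l !mulr0 subr0 rd0l => h.
apply: rd_eq0; apply/eqP; rewrite eq_le rd_ge0 andbT.
have := fdi_feedthrough hA hF u; move: (rd _ _) (rd u u) (rd_ge0 u) h => p q q0 h hpq.
have : g * p <= g * q by rewrite ler_wpM2l.
move=> h2; have : (1 - g) * q <= 0 by lra.
by rewrite pmulr_rle0 // subr_gt0.
Qed.

(** The feedback u = - W^-1 L x leaves no dissipation slack. An eigenvector with Re mu = 0 satisfies
    |u|^2 = g |y|^2 <= g |u|^2; one with Re mu > 0 puts [u] in the kernel of W + L (mu - A)^-1 B,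
    invertible by minimality of the trace. Either way [u = 0], and [A] itself would have the
    eigenvalue [mu]. *)
Lemma closed_loop_hurw g X (L : 'M[K]_(n, d)) (W : 'M[K]_n) :
  0 <= g < 1 -> herm X -> diss g X ->
  (forall Y, herm Y -> diss g Y -> mtr X <= mtr Y) ->
  row_free (row_mx L W) -> spectral_factor g X L W -> W \in unitmx ->
  hurw (A - B *m invmx W *m L).
Proof.
move=> g01 hX dX minX fr sf Wu mu x x0 hx; rewrite ltNge; apply/negP => mu0.
pose u := - (invmx W *m (L *m x)).
have e1 : A *m x + B *m u = mu *: x by rewrite -hx mulmxBl /u mulmxN !mulmxA.
have e2 : L *m x + W *m u = 0 by rewrite /u mulmxN mulKVmx // subrr.
suff u0 : u = 0.
  by have := hA x0 (_ : A *m x = mu *: x); rewrite -e1 u0 mulmx0 addr0 => /(_ erefl); rewrite ltNge mu0.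
move: mu0; rewrite le_eqVlt => /orP[/eqP mu0|mu0].
  have := slack x u hX sf; rewrite e2 rd0l e1 herm_rd_scale // -mu0 mul0r mulr0 subr0 => h.
  have := hF (esym mu0) (esym e1).
  case/andP: g01 => g0 g1.
  move: (rd (_ + _) _) h => p h h2; apply: rd_eq0; apply/eqP; rewrite eq_le rd_ge0 andbT.
  have h3 : g * p <= g * rd u u by rewrite ler_wpM2l.
  have : (1 - g) * rd u u <= 0 by lra.
  by rewrite pmulr_rle0 // subr_gt0.
have := min_factor_free hA hX dX minX fr sf mu0.
rewrite row_free_unit => Zu; apply: (can_inj (mulKmx Zu)).
rewrite mulmx0 mulmxDl -!mulmxA.
suff -> : invmx (mu%:M - A) *m (B *m u) = x by rewrite addrC.
have Mu : mu%:M - A \in unitmx by apply: hurw_unit => //; exact: ltW.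
apply: (can_inj (mulKmx Mu)); rewrite mulKVmx // mulmxBl mul_scalar_mx -e1.
by rewrite addrC addKr.
Qed.

(** In the variables [x] and [v = L x + W u] the slack is |v|^2 and the state matrix is the Hurwitz
    closed loop [Ac]. Adding a small multiple of its Lyapunov form adds decay in |x|^2, and part of
    both is exchanged for e |y|^2. *)
Lemma strict_step g X : 0 <= g < 1 -> herm X -> diss g X ->
  (forall Y, herm Y -> diss g Y -> mtr X <= mtr Y) ->
  exists e Y, [/\ 0 < e, herm Y & diss (g + e) Y].
Proof.
move=> g01 hX dX minX.
have [r [L [W [fr sf]]]] := diss_factor hX dX.
have Winj u := factor_inj g01 hX sf (u := u).
(* Full row rank of an [r] by [n] matrix gives [r <= n], injectivity of [W] gives the converse. *)
have rn : r = n.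
  apply/eqP; rewrite eqn_leq; apply/andP; split.
    have := min_factor_free hA hX dX minX fr sf (_ : 0 < re 1).
    move=> /(_ ltr01); rewrite /row_free => /eqP <-; exact: rank_leq_col.
  have : \rank W^T = n.
    apply/eqP; change (row_free W^T); rewrite -kermx_eq0; apply/rowV0P => v /sub_kermxP hv.
    apply: trmx_inj; rewrite trmx0; apply: Winj.
    by apply: trmx_inj; rewrite trmx_mul trmxK hv trmx0.
  by move=> <-; exact: rank_leq_col.
subst r.
have Wu : W \in unitmx.
  by apply: contraT => /singular_col [v v0 /Winj hv]; rewrite hv eqxx in v0.
have hAc := closed_loop_hurw g01 hX dX minX fr sf Wu.
have [P [c [c0 hP pP lP]]] := lyap_exists hAc.
set Ac := A - _ in hAc lP.
pose B' := B *m invmx W; pose C' := Cm - D *m invmx W *m L; pose D' := D *m invmx W.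
have [k k0 hk] := mulmx_bound (P *m B').
have [k1 k10 hk1] := mulmx_bound C'.
have [k2 k20 hk2] := mulmx_bound D'.
pose dl := c / (4 * (k + 1)).
have dl0 : 0 < dl by rewrite divr_gt0 ?mulr_gt0 // ltr_wpDl.
(* With this [dl] the cross term costs half of dl c |x|^2 and half of |v|^2; [e] is small enough for
   e |y|^2 to fit into the other halves. *)
have [e [e0 ea eb]] : exists e, [/\ 0 < e, e * (4 * (k1 + 1)) <= dl * c & e * (4 * (k2 + 1)) <= 1].
  have q1 : 0 < 4 * (k1 + 1) by rewrite mulr_gt0 // ltr_wpDl.
  have q2 : 0 < 4 * (k2 + 1) by rewrite mulr_gt0 // ltr_wpDl.
  exists (Num.min (dl * c / (4 * (k1 + 1))) (1 / (4 * (k2 + 1)))); split.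
  - by rewrite lt_min !divr_gt0 // mulr_gt0.
  - by rewrite -ler_pdivlMr // ge_min lexx.
  - by rewrite -ler_pdivlMr // ge_min lexx orbT.
exists e, (X + dl%:C%C *: P); split => //.
  by rewrite /herm ctrD ctrZ conjc_real hX hP.
move=> x u; have := slack x u hX sf; set v := L *m x + W *m u.
have eu : u = invmx W *m v - invmx W *m (L *m x).
  by rewrite /v mulmxDr mulKmx // addrC addKr.
have ez : A *m x + B *m u = Ac *m x + B' *m v.
  rewrite {1}eu mulmxBr /Ac mulmxBl /B' !mulmxA addrCA.
  by rewrite addrC.
have ey : Cm *m x + D *m u = C' *m x + D' *m v.
  rewrite {1}eu mulmxBr /C' mulmxBl /D' !mulmxA addrCA.
  by rewrite addrC.
set y := Cm *m x + D *m u in ey *.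
have y1 : rd y y <= 2 * rd (C' *m x) (C' *m x) + 2 * rd (D' *m v) (D' *m v).
  by rewrite ey; exact: rd_add_le.
have y2 := hk1 x; have y3 := hk2 v.
have l1 := lP x.
have l2 := rd_young x (P *m (B' *m v)) (divr_gt0 c0 (ltr0n R 2)).
have l3 := hk v; rewrite -mulmxA in l3.
rewrite (mulmxDl X) (rdDl (X *m x)) -(scalemxAl _ P x) rdZl.
have -> : rd (P *m x) (A *m x + B *m u) = rd (P *m x) (Ac *m x) + rd x (P *m (B' *m v)).
  by rewrite ez rdDr (rd_ctrl P x (B' *m v)) hP.
move: (rd (X *m x) _) (rd u u) (rd (P *m x) (Ac *m x)) (rd x (P *m (B' *m v))) (rd (P *m (B' *m v)) _) l1 l2 l3.
move: (rd y y) (rd (C' *m x) _) (rd (D' *m v) _) y1 y2 y3.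
move: (rd x x) (rd v v) (rd_ge0 x) (rd_ge0 v) => xx vv xx0 vv0 yy c1 d1 y1 y2 y3.
move=> s uu px q w l1 l2 l3 sl.
have h1 : e * yy <= e * (2 * ((k1 + 1) * xx) + 2 * ((k2 + 1) * vv)).
  by rewrite ler_pM2l //; lra.
have h2 : e * (4 * (k1 + 1)) * xx <= dl * c * xx by rewrite ler_wpM2r.
have h3 : e * (4 * (k2 + 1)) * vv <= 1 * vv by rewrite ler_wpM2r.
have h4 : dl * (2 * px) <= dl * (- c * xx) by rewrite ler_pM2l.
have h5 : dl * (2 * q) <= dl * (c / 2 * xx + (c / 2)^-1 * ((k + 1) * vv)).
  rewrite ler_pM2l //; apply: le_trans l2 _; rewrite lerD2l ler_pM2l ?invr_gt0 ?divr_gt0 //.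
  by lra.
have h6 : dl * ((c / 2)^-1 * ((k + 1) * vv)) = vv / 2.
  by rewrite /dl; field; rewrite !gt_eqF //= ltr_wpDl.
lra.
Qed.

(* Continuation in the output gain [g]: controllability bounds the solutions, so
   the feasible gains form a closed set, and at a feasible [g < 1] the solution
   of least trace has a spectral factor that leaves room to increase [g]. *)
Lemma kyp_ctrb : ctrb A B -> exists X, herm X /\ diss 1 X.
Proof.
move=> cAB; have [M hM] := ctrb_bound Cm D hA cAB.
have [L hL] := glim_exists R.
pose G := [set g : R | 0 <= g <= 1 /\ exists X, herm X /\ diss g X].
have G0 : G 0.
  split; first by rewrite lexx ler01.
  by exists 0; split=> [|x u]; rewrite ?/herm ?ctr0 // mul0mx rd0l !mul0r mulr0 subr0 rd_ge0.
have ubG : ubound G 1 by move=> g [/andP[]].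
have hs : has_sup G by split; [exists 0|exists 1].
have s1 : sup G <= 1 by apply: ge_sup => //; exists 0.
have s0 : 0 <= sup G by apply: ub_le_sup => //; exists 1.
have hG k : exists g, G g /\ sup G - k.+1%:R^-1 < g.
  by have [//|g hg hlt] := @sup_adherent _ G (k.+1%:R^-1) _ hs; exists g.
have /choice [g hg] := hG.
have /choice [X hX] k : exists X, herm X /\ diss (g k) X by case: (hg k) => - [].
have g0 k : 0 <= g k by case: (hg k) => - [/andP[]].
have cvg : g @ \oo --> sup G.
  apply: (@squeeze_cvgr _ _ _ _ (fun k => sup G - k.+1%:R^-1) (fun=> sup G)).
  - apply: nearW => k; case: (hg k) => h1 /ltW ->.
    by apply: ub_le_sup => //; exists 1.
  - rewrite -[X in _ --> X]subr0; apply: cvgB; first exact: cvg_cst.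
    exact: cvg_harmonic.
  - exact: cvg_cst.
have [Xs [hXs dXs _]] : exists Xl, [/\ herm Xl, diss (sup G) Xl & mtr Xl = L (fun k => mtr (X k))].
  apply: (diss_closed hA hL g0 cvg (M := M)) => k; case: (hX k) => // h1 h2.
  exact: hM (g0 k) h1 h2.
have := s1; rewrite le_eqVlt => /orP[/eqP e1|lt1]; first by rewrite -e1; exists Xs.
have [Xm [hXm dXm minX]] := diss_min hA s0 (ex_intro _ Xs (conj hXs dXs)).
have s01 : 0 <= sup G < 1 by rewrite s0.
have [e [Y [e0 hY dY]]] := strict_step s01 hXm dXm minX.
pose g' := Num.min 1 (sup G + e).
have dY' : diss g' Y.
  move=> x u; apply: le_trans (dY x u) _; rewrite lerD2l lerN2.
  by rewrite ler_wpM2r ?rd_ge0 // ge_min lexx orbT.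
have : G g'.
  split; last by exists Y.
  by rewrite le_min ler01 ge_min lexx addr_ge0 ?(ltW e0).
have hub : has_ubound G by exists 1.
by move=> /(ub_le_sup hub); rewrite leNgt lt_min lt1 ltrDl e0.
Qed.

End System.
End KYP.

(** * From bounded-real polynomial pairs to the matrix inequality *)

Section PolyMatrix.
Variable F : fieldType.

Definition cP m n (M : 'M[F]_(m, n)) : 'M[{poly F}]_(m, n) := map_mx polyC M.
Definition ev l m n (M : 'M[{poly F}]_(m, n)) : 'M[F]_(m, n) := map_mx (horner_eval l) M.

Lemma cPM m n p (M : 'M[F]_(m, n)) (N : 'M[F]_(n, p)) : cP (M *m N) = cP M *m cP N.
Proof. exact: map_mxM. Qed.
Lemma cPD m n (M N : 'M[F]_(m, n)) : cP (M + N) = cP M + cP N.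
Proof. exact: map_mxD. Qed.
Lemma cPN m n (M : 'M[F]_(m, n)) : cP (- M) = - cP M.
Proof. exact: map_mxN. Qed.
Lemma cP0 m n : cP (0 : 'M[F]_(m, n)) = 0.
Proof. exact: map_mx0. Qed.
Lemma cP1 n : cP (1%:M : 'M[F]_n) = 1%:M.
Proof. exact: map_mx1. Qed.
Lemma evM l m n p (M : 'M[{poly F}]_(m, n)) (N : 'M[{poly F}]_(n, p)) :
  ev l (M *m N) = ev l M *m ev l N.
Proof. exact: map_mxM. Qed.
Lemma evD l m n (M N : 'M[{poly F}]_(m, n)) : ev l (M + N) = ev l M + ev l N.
Proof. exact: map_mxD. Qed.
Lemma evN l m n (M : 'M[{poly F}]_(m, n)) : ev l (- M) = - ev l M.
Proof. exact: map_mxN. Qed.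
Lemma evB l m n (M N : 'M[{poly F}]_(m, n)) : ev l (M - N) = ev l M - ev l N.
Proof. exact: map_mxB. Qed.
Lemma evZ l m n a (M : 'M[{poly F}]_(m, n)) : ev l (a *: M) = a.[l] *: ev l M.
Proof. exact: map_mxZ. Qed.
Lemma ev0 l m n : ev l (0 : 'M[_]_(m, n)) = 0.
Proof. exact: map_mx0. Qed.
Lemma ev_cP l m n (M : 'M[F]_(m, n)) : ev l (cP M) = M.
Proof. by apply/matrixP => i j; rewrite !mxE /= /horner_eval hornerC. Qed.
Lemma ev_det l n (M : 'M[{poly F}]_n) : (\det M).[l] = \det (ev l M).
Proof. by rewrite -[LHS]/(horner_eval l _) -det_map_mx. Qed.
Lemma ev_adj l n (M : 'M[{poly F}]_n) : ev l (\adj M) = \adj (ev l M).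
Proof. exact: map_mx_adj. Qed.
Lemma ev_char l n (A : 'M[F]_n) : ev l (char_poly_mx A) = l%:M - A.
Proof.
rewrite /char_poly_mx evB -/(cP A) ev_cP; congr (_ - _).
by rewrite /ev map_scalar_mx /= /horner_eval hornerX.
Qed.

Lemma char_cancel m n (A : 'M[F]_n) (M N : 'M[{poly F}]_(m, n)) :
  M *m char_poly_mx A = N *m char_poly_mx A -> M = N.
Proof.
move=> /(congr1 (mulmx^~ (\adj (char_poly_mx A)))).
rewrite -!mulmxA mul_mx_adj !mul_mx_scalar => h.
have c0 : \det (char_poly_mx A) != 0 by apply/monic_neq0/char_poly_monic.
apply/matrixP => i j; move/matrixP: h => /(_ i j); rewrite !mxE.
exact: mulfI.
Qed.

Lemma scale_poly_inj m n a (M N : 'M[{poly F}]_(m, n)) : a != 0 -> a *: M = a *: N -> M = N.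
Proof.
move=> a0 /matrixP h; apply/matrixP => i j; have := h i j; rewrite !mxE.
exact: mulfI.
Qed.

Lemma ev_eq0_factor l m n (M : 'M[{poly F}]_(m, n)) : ev l M = 0 ->
  exists N, M = ('X - l%:P) *: N.
Proof.
move=> h; have /(_ _ _) hr i j : exists q, M i j = q * ('X - l%:P).
  by apply/factor_theorem; move/matrixP: h => /(_ i j); rewrite !mxE /root => /eqP.
have hd i j : ('X - l%:P) %| M i j.
  by have [q ->] := hr i j; rewrite dvdp_mull // dvdpp.
exists (\matrix_(i, j) (M i j %/ ('X - l%:P))); apply/matrixP => i j.
by rewrite !mxE mulrC divpK.
Qed.

End PolyMatrix.

(** * Para-Hermitian conjugation *)

Section Tilde.
Variable R : rcfType.
Local Notation K := R[i].
Local Notation re := (@complex.Re R).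

(** The para-conjugate, which takes conjugate values on the imaginary axis. Being polynomial, it
    lets identities on the axis be continued to the plane; on real matrices [ptl] is [pstar]. *)
Definition tld (a : {poly K}) : {poly K} := map_poly conjc a \Po (- 'X).

Lemma tldM a b : tld (a * b) = tld a * tld b.
Proof. by rewrite /tld rmorphM comp_polyM. Qed.
Lemma tldD a b : tld (a + b) = tld a + tld b.
Proof. by rewrite /tld rmorphD comp_polyD. Qed.
Lemma tld0 : tld 0 = 0. Proof. by rewrite /tld rmorph0 comp_poly0. Qed.
Lemma tldC c : tld c%:P = (conjc c)%:P.
Proof. by rewrite /tld map_polyC comp_polyC. Qed.
Lemma tldX : tld 'X = - 'X.
Proof. by rewrite /tld map_polyX comp_polyX. Qed.
Lemma tld_horner a l : (tld a).[l] = conjc a.[- conjc l].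
Proof.
rewrite /tld horner_comp hornerN hornerX -{1}(conjcK (- l)) horner_map.
by rewrite rmorphN.
Qed.

Definition ptl m n (M : 'M[{poly K}]_(m, n)) : 'M[{poly K}]_(n, m) := (map_mx tld M)^T.

Lemma ptlM m n p (M : 'M[{poly K}]_(m, n)) (N : 'M[{poly K}]_(n, p)) :
  ptl (M *m N) = ptl N *m ptl M.
Proof.
apply/matrixP => i j; rewrite !mxE (big_morph tld tldD tld0).
by apply: eq_bigr => k _; rewrite !mxE tldM mulrC.
Qed.
Lemma ptlD m n (M N : 'M[{poly K}]_(m, n)) : ptl (M + N) = ptl M + ptl N.
Proof. by apply/matrixP => i j; rewrite !mxE tldD. Qed.
Lemma ptlZ m n a (M : 'M[{poly K}]_(m, n)) : ptl (a *: M) = tld a *: ptl M.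
Proof. by apply/matrixP => i j; rewrite !mxE tldM. Qed.
Lemma ptl_cP m n (M : 'M[K]_(m, n)) : ptl (cP M) = cP (ctr M).
Proof. by apply/matrixP => i j; rewrite !mxE tldC ctr_mxE. Qed.
Lemma ev_ptl l m n (M : 'M[{poly K}]_(m, n)) : ev l (ptl M) = ctr (ev (- conjc l) M).
Proof. by apply/matrixP => i j; rewrite ctr_mxE !mxE /horner_eval tld_horner. Qed.

End Tilde.

(** * Orthogonality from the coprimeness condition *)

Section Solvability.
Variable R : rcfType.
Local Notation K := R[i].
Local Notation re := (@complex.Re R).
Variables (d n m : nat) (A : 'M[K]_d) (B : 'M[K]_(d, n)) (Cm : 'M[K]_(m, d)) (D : 'M[K]_(m, n)).
Variables (P : 'M[{poly K}]_(m, n)) (Q : 'M[{poly K}]_m).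

(** Condition (c) of a bounded-real pair over the complex numbers and for rows; [br_coprime_tp]
    derives it from the real one. *)
Definition br_coprime := forall (v : 'rV[{poly K}]_m) l,
  v *m (Q *m ptl Q - P *m ptl P) = 0 ->
  ev l v *m ev l Q = 0 -> ev l v *m ev l P = 0 -> ev l v = 0.

(** At a zero [l] of [dl] the row [v] annihilates [Q] and [P], so coprimeness makes [v] vanish at
    [l], and the factor ['X - l] cancels from all the equations. The degree of [dl] drops. *)
Lemma remove_zero (g : 'rV[{poly K}]_m) (h : 'rV[{poly K}]_n) l : br_coprime ->
  forall dl (v : 'rV_m), dl != 0 -> v *m (Q *m ptl Q - P *m ptl P) = 0 ->
  v *m Q = dl *: g -> v *m P = dl *: h ->
  exists dl' (v' : 'rV_m), [/\ dl'.[l] != 0, v' *m Q = dl' *: g & v' *m P = dl' *: h].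
Proof.
move=> hc dl; have [s hs] := ubnP (size dl); elim: s dl hs => // s IH dl hs v d0 hv hQ hP.
have [dl0|dln] := eqVneq dl.[l] 0; last by exists dl, v.
have v0 : ev l v = 0.
  apply: hc => //; rewrite -evM ?hQ ?hP evZ dl0 scale0r //.
have [w ew] := ev_eq0_factor v0.
have /factor_theorem [d1 ed] : root dl l by rewrite /root dl0.
have xl0 : 'X - l%:P != 0 :> {poly K} by rewrite polyXsubC_eq0.
have d10 : d1 != 0 by apply: contra d0 => /eqP e; rewrite ed e mul0r.
apply: (IH d1 _ w) => //.
- by move: hs; rewrite ed size_Mmonic ?monicXsubC // size_XsubC addn2.
- by apply: (scale_poly_inj xl0); rewrite scalemxAl -ew hv scaler0.
- by apply: (scale_poly_inj xl0); rewrite scalemxAl -ew hQ ed scalerA mulrC.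
- by apply: (scale_poly_inj xl0); rewrite scalemxAl -ew hP ed scalerA mulrC.
Qed.

Variables (E : 'M[{poly K}]_(m, d)) (E0 : 'cV[{poly K}]_m) (a : 'cV[K]_d) (c : 'cV[K]_m) (l : K).
Hypothesis eE : E *m char_poly_mx A = Q *m cP Cm.
Hypothesis eP : P = E *m cP B + Q *m cP D.
Hypothesis eE0 : ('X - l%:P) *: E0 - E *m cP a = Q *m cP c.
Hypothesis detQ : \det Q != 0.
Hypothesis hc : br_coprime.

(* [x], [h] is a polynomial trajectory on which the dissipation rate vanishes
   identically; its adjoint gives a row vector annihilated by [Q Q* - P P*]. *)
Lemma lossless_orth r (L : 'M[K]_(r, d)) (W : 'M[K]_(r, n)) (X : 'M[K]_d)
  (x : 'cV[{poly K}]_d) (h : 'cV[{poly K}]_n) : herm X ->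
  - (ctr A *m X) - X *m A - ctr Cm *m Cm = ctr L *m L ->
  - (X *m B) - ctr Cm *m D = ctr L *m W ->
  1%:M - ctr D *m D = ctr W *m W ->
  char_poly_mx A *m x = cP B *m h ->
  cP L *m x + cP W *m h = 0 ->
  ctr (Cm *m ev (- conjc l) x + D *m ev (- conjc l) h) *m c
  + ctr (X *m ev (- conjc l) x) *m a = 0.
Proof.
move=> hX e1 e2 e3 ex ef.
pose y := cP Cm *m x + cP D *m h; pose p := cP X *m x.
have Xx : 'X *: x = cP A *m x + cP B *m h.
  rewrite -ex /char_poly_mx mulmxBl mul_scalar_mx -/(cP A).
  by rewrite addrC subrK.
(* Losslessness turns [p = X x] into a costate, governed by the adjoint state matrix and driven by
   [y]; next, [h] turns out to be the output of this adjoint system. *)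
have ep : 'X *: p + cP (ctr A) *m p + cP (ctr Cm) *m y = 0.
  have : cP (ctr L) *m (cP L *m x + cP W *m h) = 0 by rewrite ef mulmx0.
  rewrite mulmxDr !mulmxA -!cPM -e1 -e2 !cPD !cPN !cPM /y /p scalemxAr Xx !mulmxDr !mulmxA.
  rewrite !(mulmxDl, mulNmx).
  move: (_ *m x) (_ *m x) (_ *m x) (_ *m h) (_ *m h) => a1 a2 a3 b1 b2 /matrixP h0.
  apply/matrixP => i j; have := h0 i j; rewrite !mxE => h1.
  by apply/eqP; rewrite -oppr_eq0 -[X in _ == X]h1; apply/eqP; ring.
have eh : h = cP (ctr B) *m p + cP (ctr D) *m y.
  have e2' : - (ctr B *m X) - ctr D *m Cm = ctr W *m L.
    by rewrite -[LHS]ctrK ctrB ctrN !ctrM !ctrK hX e2 ctrM ctrK.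
  have : cP (ctr W) *m (cP L *m x + cP W *m h) = 0 by rewrite ef mulmx0.
  rewrite mulmxDr !mulmxA -!cPM -e2' -e3 !cPD !cPN cP1 !cPM /y /p !mulmxDr !mulmxA.
  rewrite !(mulmxDl, mulNmx) mul1mx.
  move: (_ *m x) (_ *m x) (_ *m h) => a1 a2 b1 /matrixP h0.
  apply/matrixP => i j; have := h0 i j; rewrite !mxE => h1.
  by apply/eqP; rewrite -subr_eq0 -[X in _ == X]h1; apply/eqP; ring.
have hy : y = cP Cm *m x + cP D *m h by [].
have hp : p = cP X *m x by [].
clearbody y p.
pose g := ptl y; pose pt := ptl p; pose ht := ptl h.
have ept : pt *m char_poly_mx A = g *m cP Cm.
  have := congr1 (@ptl _ _ _) ep; rewrite !ptlD ptlZ !ptlM !ptl_cP !ctrK tldX -/g -/pt.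
  rewrite /char_poly_mx mulmxBr mul_mx_scalar -/(cP A).
  have -> : ptl (0 : 'cV[{poly K}]_d) = 0 by apply/matrixP => i j; rewrite !mxE tld0.
  move: (pt *m _) (g *m _) => u v; move: (pt) => z /matrixP h0.
  apply/matrixP => i j; have := h0 i j; rewrite !mxE => h1.
  apply/eqP; rewrite -subr_eq0 -oppr_eq0 -[X in _ == X]h1; apply/eqP; ring.
have eht : ht = pt *m cP B + g *m cP D.
  by rewrite /ht eh ptlD !ptlM !ptl_cP !ctrK.
have eQy : Q *m y = P *m h.
  by rewrite eP mulmxDl -(mulmxA E) -ex (mulmxA E) eE hy mulmxDr !mulmxA.
have eg : g *m ptl Q = ht *m ptl P by rewrite -!ptlM eQy.
(* The row wanted is g Q^-1. The adjugate clears denominators at the price of [\det Q], whose zeros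
   at [l] are then removed. *)
pose v := g *m \adj Q.
have vQ : v *m Q = \det Q *: g by rewrite -mulmxA mul_adj_mx mul_mx_scalar.
have PE (w : 'rV_m) dl : w *m Q = dl *: g -> w *m E = dl *: pt.
  move=> hw; apply: (@char_cancel _ _ _ A).
  by rewrite -mulmxA eE mulmxA hw -!scalemxAl ept.
have vP : v *m P = \det Q *: ht.
  by rewrite eP mulmxDr !mulmxA (PE _ _ vQ) vQ -!scalemxAl -scalerDr eht.
have v0 : v *m (Q *m ptl Q - P *m ptl P) = 0.
  by rewrite mulmxBr !mulmxA vQ vP -!scalemxAl eg subrr.
have [dl [w [dl0 wQ wP]]] := remove_zero l hc detQ v0 vQ vP.
(* At [l] the term with [E0] drops out, and only values of [g] and [pt] remain. *)
have : ev l (w *m (('X - l%:P) *: E0 - E *m cP a)) = ev l (w *m (Q *m cP c)).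
  by rewrite eE0.
rewrite mulmxBr (mulmxA w E) (PE _ _ wQ) (mulmxA w Q) wQ -(scalemxAr _ w) evB evZ.
rewrite -(scalemxAl dl pt) -(scalemxAl dl g) !evZ !evM !ev_cP.
rewrite hornerXsubC subrr scale0r sub0r => /eqP.
rewrite eq_sym -addr_eq0 -scalerDr scaler_eq0 (negbTE dl0) /= => /eqP.
by rewrite /g /pt !ev_ptl hy hp evD !evM !ev_cP.
Qed.

End Solvability.

Section NullTrajectory.
Variable F : fieldType.

(* [q] is the Cramer-type solution of [N q = 0] that takes the value [q0] (up to
   a unit) at [mu], where [N] is the numerator of the rational matrix
   [W + L (s - A)^-1 B]. *)
Lemma null_trajectory d n r (A : 'M[F]_d) (B : 'M[F]_(d, n)) (L : 'M[F]_(r, d))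
    (W : 'M[F]_(r, n)) mu (q0 : 'cV[F]_n) :
  mu%:M - A \in unitmx ->
  row_free (W + L *m invmx (mu%:M - A) *m B) ->
  (W + L *m invmx (mu%:M - A) *m B) *m q0 = 0 ->
  exists (x : 'cV[{poly F}]_d) (h : 'cV[{poly F}]_n) c,
  [/\ c != 0, char_poly_mx A *m x = cP B *m h, cP L *m x + cP W *m h = 0,
      ev mu x = c *: (invmx (mu%:M - A) *m B *m q0) & ev mu h = c *: q0].
Proof.
move=> Mu; set Z := W + _ => /row_freeP [Y hY] hq0.
pose chi := \det (char_poly_mx A).
have chimu : chi.[mu] = \det (mu%:M - A) by rewrite ev_det ev_char.
have chi0 : chi.[mu] != 0 by rewrite chimu -unitfE -unitmxE.
pose N := chi *: cP W + cP L *m \adj (char_poly_mx A) *m cP B.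
have eadj : ev mu (\adj (char_poly_mx A)) = chi.[mu] *: invmx (mu%:M - A).
  rewrite ev_adj ev_char chimu; apply: (can_inj (mulKmx Mu)).
  by rewrite mul_mx_adj -scalemxAr mulmxV // scalemx1.
have evN : ev mu N = chi.[mu] *: Z.
  by rewrite evD evZ !evM !ev_cP eadj -scalemxAr -scalemxAl scalerDr.
pose J := N *m cP Y.
have evJ : ev mu J = chi.[mu]%:M by rewrite evM evN ev_cP -scalemxAl hY scalemx1.
pose q := \det J *: cP q0 - cP Y *m (\adj J *m (N *m cP q0)).
have Nq : N *m q = 0.
  rewrite mulmxBr (mulmxA N) -/J (mulmxA J) mul_mx_adj mul_scalar_mx.
  by rewrite -scalemxAr subrr.
have detJ : (\det J).[mu] != 0 by rewrite ev_det evJ det_scalar expf_neq0.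
have evq : ev mu q = (\det J).[mu] *: q0.
  rewrite evB evZ !evM evN !ev_cP -(scalemxAl _ Z) hq0 scaler0 !mulmx0 subr0 //.
exists (\adj (char_poly_mx A) *m cP B *m q), (chi *: q), (chi.[mu] * (\det J).[mu]); split.
- by rewrite mulf_neq0.
- by rewrite !mulmxA mul_mx_adj mul_scalar_mx -scalemxAl scalemxAr.
- by rewrite -[RHS]Nq /N mulmxDl -scalemxAl scalemxAr !mulmxA addrC.
- by rewrite !evM eadj evq ev_cP -!scalemxAl -scalemxAr scalerA.
- by rewrite evZ evq scalerA.
Qed.

Lemma solve_of_orth r n (Z : 'M[F]_(r, n)) (v : 'rV[F]_n) :
  (forall q : 'cV_n, Z *m q = 0 -> v *m q = 0) -> exists k, v = k *m Z.
Proof.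
move=> h; apply/submxP; rewrite submxE; apply/eqP/rowP => j.
have hZ : Z *m col j (cokermx Z) = 0 by rewrite colE mulmxA mulmx_coker mul0mx.
have /matrixP /(_ 0 0) := h _ hZ.
by rewrite colE mulmxA -colE !mxE.
Qed.

End NullTrajectory.

(** * Adding one uncontrollable mode *)

Section KYPStep.
Variable R : realType.
Local Notation K := R[i].
Local Notation re := (@complex.Re R).

Lemma rd_col1 n (v w : 'cV[K]_n) (x : 'cV[K]_1) :
  rd (v *m x) (w *m x) = rd x x * rd v w.
Proof.
have e (z : 'cV[K]_n) : z *m x = x 0 0 *: z.
  by rewrite {1}(mx11_scalar x) mul_mx_scalar.
by rewrite !e rd_scale2 [rd x x]rdE big_ord1 -!expr2.
Qed.

(** The new coordinate satisfies x0' = l x0 and drives the rest through [a]. The two equations for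
    [xi] and [k] turn the mixed terms into the inner product of [k x0] and [L x1 + W u]; the square
    is completed by a multiple of |x0|^2, which the corner [t] supplies because [re l < 0]. *)
Lemma diss_extend d n m r (A : 'M[K]_d) (B : 'M[K]_(d, n)) (Cm : 'M[K]_(m, d))
    (D : 'M[K]_(m, n)) (a : 'cV[K]_d) (c : 'cV[K]_m) l (X : 'M[K]_d)
    (L : 'M[K]_(r, d)) (W : 'M[K]_(r, n)) (xi : 'cV[K]_d) (k : 'cV[K]_r) :
  re l < 0 -> herm X -> spectral_factor A B Cm D 1 X L W ->
  - (ctr Cm *m c) - X *m a - ctr A *m xi - l *: xi = ctr L *m k ->
  - (ctr D *m c) - ctr B *m xi = ctr W *m k ->
  exists Y : 'M[K]_(1 + d), herm Y /\
    diss (block_mx l%:M 0 a A) (col_mx 0 B) (row_mx c Cm) D 1 Y.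
Proof.
move=> l0 hX sf e1 e2.
(* What has to be covered per unit of |x0|^2 once the square is completed. *)
pose s := rd k k + rd c c + 2 * rd xi a.
have [t ht] : exists t, - 2 * t * re l = s.
  by exists (- s / (2 * re l)); field; rewrite lt_eqF.
exists (block_mx (t%:C%C)%:M (ctr xi) xi X); split.
  by rewrite /herm ctr_block_mx ctr_scalar conjc_real ctrK hX.
move=> x u; rewrite -[x]vsubmxK; set x0 := usubmx x; set x1 := dsubmx x.
rewrite !mul_block_col mul_row_col mul_col_mx !mul0mx !addr0 !mul_scalar_mx.
rewrite add_col_mx addr0 rd_col_mx.
pose z1 := A *m x1 + B *m u; pose y1 := Cm *m x1 + D *m u; pose f := L *m x1 + W *m u.
have -> : a *m x0 + A *m x1 + B *m u = a *m x0 + z1 by rewrite addrA.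
have -> : c *m x0 + Cm *m x1 + D *m u = c *m x0 + y1 by rewrite addrA.
have sl := slack x1 u hX sf; rewrite -/z1 -/y1 -/f mul1r in sl.
have cross : rd (k *m x0) f = - rd (c *m x0) y1 - rd (X *m x1) (a *m x0)
   - rd (xi *m x0) z1 - rd (ctr xi *m x1) (l *: x0).
  have h1 : rd (k *m x0) (L *m x1) =
      - rd (c *m x0) (Cm *m x1) - rd (X *m x1) (a *m x0) - rd (xi *m x0) (A *m x1)
      - rd (ctr xi *m x1) (l *: x0).
    rewrite (rd_ctr L) mulmxA -e1 mulmxBl mulmxBl mulmxBl mulNmx.
    rewrite rdBl rdBl rdBl rdNl -(mulmxA (ctr Cm)) (rd_ctr Cm) -(mulmxA X).
    rewrite (rd_ctrl X) hX (rdC (a *m x0)) -(mulmxA (ctr A)) (rd_ctr A).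
    congr (_ - _); rewrite (rdC _ x1) -scalemxAl scalemxAr (rd_ctr xi).
    by [].
  have h2 : rd (k *m x0) (W *m u) = - rd (c *m x0) (D *m u) - rd (xi *m x0) (B *m u).
    rewrite (rd_ctr W) mulmxA -e2 mulmxBl mulNmx rdBl rdNl -(mulmxA (ctr D)).
    by rewrite -(mulmxA (ctr B)) (rd_ctr D) (rd_ctr B).
  rewrite /f rdDr h1 h2 /y1 /z1 (rdDr (c *m x0)) (rdDr (xi *m x0)).
  by ring.
have k1 := rd_ge0 (k *m x0 + f).
rewrite rd_addsq rd_col1 cross in k1.
rewrite mul1r rd_addsq rd_col1 rdDl (rdDl (xi *m x0)) (rdDr (xi *m x0)) (rdDr (X *m x1)).
rewrite rd_col1 (rdZl t) rd_scale_self.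
have k2 : - 2 * t * re l * rd x0 x0 = s * rd x0 x0 by rewrite ht.
rewrite /s in k2; move: k1 k2 sl.
move: (rd (c *m x0) _) (rd (X *m x1) (a *m x0)) (rd (xi *m x0) _) (rd (ctr xi *m x1) _) => g1 g2 g3 g4.
move: (rd f f) (rd u u) (rd y1 y1) (rd (X *m x1) _) (rd x0 x0) => f1 u1 v1 w1 z0 k1 k2 sl.
lra.
Qed.

End KYPStep.

Section CharBlock.
Variable F : fieldType.

Lemma char_block d0 d (M : 'M[F]_d0) N S (A : 'M[F]_d) :
  char_poly_mx (block_mx M N S A) =
  block_mx (char_poly_mx M) (- cP N) (- cP S) (char_poly_mx A).
Proof.
rewrite /char_poly_mx map_block_mx scalar_mx_block opp_block_mx add_block_mx !add0r.
by [].
Qed.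

Lemma char_conj d (T A : 'M[F]_d) : T \in unitmx ->
  char_poly_mx (T *m A *m invmx T) = cP T *m char_poly_mx A *m cP (invmx T).
Proof.
move=> Tu; rewrite /char_poly_mx mulmxBr mulmxBl -/(cP _) -/(cP A) !cPM.
by rewrite mul_mx_scalar -scalemxAl -(cPM T (invmx T)) mulmxV // cP1 scalemx1.
Qed.

Lemma cP_row_mx m n1 n2 (M : 'M[F]_(m, n1)) (N : 'M[F]_(m, n2)) :
  cP (row_mx M N) = row_mx (cP M) (cP N).
Proof. exact: map_row_mx. Qed.

Lemma cP_col_mx m1 m2 n (M : 'M[F]_(m1, n)) (N : 'M[F]_(m2, n)) :
  cP (col_mx M N) = col_mx (cP M) (cP N).
Proof. exact: map_col_mx. Qed.

End CharBlock.

(** * Induction on the state dimension *)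

Section KYPPoly.
Variable R : realType.
Local Notation K := R[i].
Local Notation re := (@complex.Re R).

(** Serves both for coordinate changes and for the quotient by an unobservable mode, hence the
    rectangular [T]. *)
Lemma diss_pull d d' n m (A : 'M[K]_d) (B : 'M[K]_(d, n)) (Cm : 'M[K]_(m, d))
    (D : 'M[K]_(m, n)) (A' : 'M[K]_d') B' C' (T : 'M[K]_(d', d)) g X :
  T *m A = A' *m T -> T *m B = B' -> Cm = C' *m T ->
  diss A' B' C' D g X -> diss A B Cm D g (ctr T *m X *m T).
Proof.
move=> eA eB -> dX x u; have := dX (T *m x) u.
rewrite -!mulmxA (rd_ctrl (ctr T)) ctrK mulmxDr (mulmxA T A) (mulmxA T B) eA eB.
by rewrite -(mulmxA A').
Qed.

Lemma herm_pull d d' (T : 'M[K]_(d', d)) (X : 'M[K]_d') : herm X -> herm (ctr T *m X *m T).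
Proof. by move=> hX; rewrite /herm !ctrM ctrK hX mulmxA. Qed.

Lemma psdh_pull d d' (T : 'M[K]_(d', d)) (X : 'M[K]_d') : psdh X -> psdh (ctr T *m X *m T).
Proof. by move=> pX v; rewrite -!mulmxA rd_ctr ctrK. Qed.

Variables (n m : nat) (D : 'M[K]_(m, n)) (P : 'M[{poly K}]_(m, n)) (Q : 'M[{poly K}]_m).
Hypothesis hPQ : forall l, re l = 0 -> forall v : 'cV_m,
  rd (ctr (ev l P) *m v) (ctr (ev l P) *m v) <= rd (ctr (ev l Q) *m v) (ctr (ev l Q) *m v).
Hypothesis hQ : forall l, 0 <= re l -> ev l Q \in unitmx.
Hypothesis hc : br_coprime P Q.

Lemma det_Q_neq0 : \det Q != 0.
Proof.
have := hQ (l := 0) (lexx _); rewrite unitmxE unitfE -ev_det.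
by apply: contra => /eqP ->; rewrite horner0.
Qed.

(** The hypothesis [hPQ] bounds the adjoint of Q^-1 P at [l]; a matrix and its adjoint are
    contractions together. *)
Lemma contraction_of_hPQ l (u : 'cV[K]_n) y : re l = 0 ->
  ev l P *m u = ev l Q *m y -> rd y y <= rd u u.
Proof.
move=> l0 e; have Qu : ctr (ev l Q) \in unitmx by rewrite ctr_unit hQ // l0.
pose v := invmx (ctr (ev l Q)) *m y.
have hv : ctr (ev l Q) *m v = y by rewrite mulKVmx.
have h1 : rd y y = rd (ctr (ev l P) *m v) u.
  by rewrite rd_ctrl ctrK e (rd_ctr (ev l Q)) hv.
have h2 := rd_CS (ctr (ev l P) *m v) u.
have h3 := hPQ l0 v; rewrite hv in h3.
rewrite -h1 in h2; have y0 := rd_ge0 y; have u0 := rd_ge0 u.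
have h4 : rd y y ^+ 2 <= rd y y * rd u u.
  by apply: le_trans h2 _; rewrite ler_wpM2r.
have [->//|yn] := eqVneq (rd y y) 0.
by move: h4; rewrite expr2 ler_pM2l // lt_def yn.
Qed.

(** Eliminating [xi] from the equations of [diss_extend] leaves [ctr Z *m k = - rho], where [Z] is
    the value at [mu] of W + L (s - A)^-1 B. It is solvable if [rho] is orthogonal to the kernel of
    [Z]. Least trace gives [Z] full row rank, so that a kernel vector extends to a null trajectory,
    and [lossless_orth] along it is the orthogonality. *)
Lemma extend_step d (A : 'M[K]_d) (B : 'M[K]_(d, n)) (Cm : 'M[K]_(m, d))
    (E : 'M[{poly K}]_(m, d)) (E0 : 'cV[{poly K}]_m) (a : 'cV[K]_d) (c : 'cV[K]_m) l :
  hurw A -> re l < 0 -> E *m char_poly_mx A = Q *m cP Cm -> P = E *m cP B + Q *m cP D ->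
  ('X - l%:P) *: E0 - E *m cP a = Q *m cP c ->
  (exists X, herm X /\ diss A B Cm D 1 X) ->
  exists Y : 'M[K]_(1 + d), herm Y /\
    diss (block_mx l%:M 0 a A) (col_mx 0 B) (row_mx c Cm) D 1 Y.
Proof.
move=> hA l0 eE eP eE0 exX.
have [X [hX dX minX]] := diss_min hA ler01 exX.
have [r [L [W [fr sf]]]] := diss_factor hX dX.
have [e1 e2 e3] := sf.
have one : (1 : R)%:C%C = 1 :> K by [].
rewrite one !scale1r in e1 e2 e3.
pose mu := - conjc l.
have cmu : conjc mu = - l by rewrite /mu rmorphN /=; congr (- _); exact: conjcK.
have remu : 0 < re mu by rewrite /mu reN re_conj oppr_gt0.
have fz := min_factor_free hA hX dX minX fr sf remu.
have Mu : mu%:M - A \in unitmx by apply: hurw_unit => //; exact: ltW.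
set M := mu%:M - A in fz Mu.
set Z := W + _ in fz.
pose N := ctr M; have Nu : N \in unitmx by rewrite ctr_unit.
have eN : N = - l%:M - ctr A by rewrite /N /M ctrB ctr_scalar cmu raddfN.
have iN : ctr (invmx N) = invmx M.
  by apply: (can_inj (mulmxK Mu)); rewrite mulVmx // -[M]ctrK -ctrM mulmxV // ctr1.
pose b := ctr Cm *m c + X *m a.
pose rho := ctr D *m c + ctr B *m (invmx N *m b).
have orth (q : 'cV_n) : Z *m q = 0 -> ctr rho *m q = 0.
  move=> hq; have [x [h [k [k0 ex ef ex0 eh0]]]] := null_trajectory Mu fz hq.
  have := lossless_orth eE eP eE0 det_Q_neq0 hc hX e1 e2 e3 ex ef.
  rewrite -/mu ex0 eh0 -(scalemxAr k Cm) -(scalemxAr k D) -(scalemxAr k X) -scalerDr.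
  rewrite (ctrZ k) (ctrZ k (X *m _)) -scalemxAl -scalemxAl -scalerDr => /eqP.
  rewrite scaler_eq0 conjc_eq0 (negbTE k0) /= => /eqP /(congr1 (@ctr _ _ _)).
  rewrite ctr0 ctrD ctrM ctrK ctrM ctrK => h0.
  set x0 := invmx M *m B *m q in h0.
  have h1 : ctr (ctr D *m c) *m q = ctr c *m (D *m q) by rewrite ctrM ctrK mulmxA.
  have h2 : ctr (ctr B *m (invmx N *m b)) *m q = ctr b *m x0.
    by rewrite /x0 !ctrM iN ctrK -!mulmxA.
  have h3 : ctr b *m x0 = ctr c *m (Cm *m x0) + ctr a *m (X *m x0).
    by rewrite /b ctrD !ctrM ctrK hX mulmxDl -!mulmxA.
  rewrite /rho ctrD mulmxDl h1 h2 h3 -[RHS]h0 mulmxDr addrA.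
  by rewrite (addrC (ctr c *m (D *m q))).
have [k' ek'] := solve_of_orth orth.
pose k := - ctr k'.
have Zk : ctr Z *m k = - rho by rewrite mulmxN -ctrM -ek' ctrK.
pose xi := invmx N *m (b + ctr L *m k).
have Nxi : N *m xi = b + ctr L *m k by rewrite mulKVmx.
apply: (@diss_extend R d n m r A B Cm D a c l X L W xi k) => //.
  move: Nxi; rewrite eN mulmxBl mulNmx mul_scalar_mx /b => h.
  by rewrite -addrA [- (_ *m xi) - _]addrC h -opprD addKr.
have : ctr Z *m k = ctr W *m k + ctr B *m (invmx N *m (ctr L *m k)).
  rewrite /Z ctrD mulmxDl; congr (_ + _); rewrite !ctrM -iN ctrK.
  by rewrite -!mulmxA.
rewrite Zk /rho opprD => h.
by rewrite /xi mulmxDr mulmxDr opprD addrA h addrK.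
Qed.

Theorem kyp_poly d (A : 'M[K]_d) (B : 'M[K]_(d, n)) (Cm : 'M[K]_(m, d))
    (E : 'M[{poly K}]_(m, d)) :
  E *m char_poly_mx A = Q *m cP Cm -> P = E *m cP B + Q *m cP D ->
  exists X, [/\ herm X, psdh X & diss A B Cm D 1 X].
Proof.
elim: d A B Cm E => [|d IH] A B Cm E eE eP.
  have hA : hurw A by move=> l v; rewrite flatmx0 eqxx.
  have hF : fdi A B Cm D.
    move=> l x u l0 _; apply: (contraction_of_hPQ l0).
    rewrite [x]flatmx0 mulmx0 add0r eP evD !evM !ev_cP [B]flatmx0 mulmx0 add0r.
    by rewrite mulmxA.
  have [|X [hX dX]] := @kyp_ctrb R _ _ _ A B Cm D hA hF.
    by move=> l eta _ _; rewrite [eta]thinmx0.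
  have pX := diss_psd hA ler01 hX dX.
  by exists X; split.
have [[l [v [v0 Av Cv]]]|obs] := pselect (exists l (v : 'cV_d.+1), [/\ v != 0, A *m v = l *: v & Cm *m v = 0]).
  have [T [a [A1 [Tu Tv eA]]]] := split_right v0 Av.
  pose S : 'M[K]_(d, 1 + d) := dsubmx (invmx T).
  have eiT : invmx T = col_mx (usubmx (invmx T)) S by rewrite vsubmxK.
  have SA : S *m A = A1 *m S.
    have : invmx T *m A = block_mx l%:M a 0 A1 *m invmx T by rewrite -eA mulmxK.
    by rewrite eiT mul_col_mx mul_block_col mul0mx add0r => /eq_col_mx [].
  pose C1 := rsubmx (Cm *m T).
  have eCT : Cm *m T = row_mx 0 C1.
    rewrite -[LHS]hsubmxK; congr row_mx.
    move: Cv; rewrite -Tv mulmxA -{1}[Cm *m T]hsubmxK mul_row_col mulmx1 mulmx0 addr0.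
    by [].
  have eC : Cm = C1 *m S.
    by rewrite -[Cm](mulmxK Tu) eCT eiT mul_row_col mul0mx add0r.
  pose E' := E *m cP T.
  have iTT : cP T *m cP (invmx T) = 1%:M by rewrite -cPM mulmxV // cP1.
  have eE' : E' *m char_poly_mx (block_mx l%:M a 0 A1) = Q *m cP (Cm *m T).
    have iTu : invmx T \in unitmx by rewrite unitmx_inv.
    have := char_conj A iTu; rewrite invmxK => cc.
    rewrite -eA cc /E' -!mulmxA (mulmxA (cP T)) iTT mul1mx.
    by rewrite mulmxA eE -mulmxA -cPM.
  rewrite char_block cP0 oppr0 eCT cP_row_mx cP0 -[E']hsubmxK mul_row_block mul_mx_row in eE'.
  have [h1 h2] := eq_row_mx eE'.
  (* The first column of [E'] times ['X - l] is [Q] times the zero column. *)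
  have E0 : lsubmx E' = 0.
    apply: (@char_cancel _ _ _ l%:M); rewrite mul0mx -[LHS]addr0.
    by rewrite -[X in _ + X](mulmx0 _ (rsubmx E')) h1 mulmx0.
  rewrite E0 mul0mx add0r in h2.
  have [|X [hX pX dX]] := IH A1 (S *m B) C1 (rsubmx E') h2.
    rewrite eP; congr (_ + _).
    have -> : E = E' *m cP (invmx T) by rewrite /E' -mulmxA iTT mulmx1.
    rewrite -{1}[E']hsubmxK E0 eiT cP_col_mx mul_row_col mul0mx add0r -mulmxA.
    by rewrite -cPM.
  exists (ctr S *m X *m S); split.
  - exact: herm_pull.
  - exact: psdh_pull.
  - by apply: diss_pull dX.
(* If Re l >= 0, then Q(l) C v = E(l) (l - A) v = 0, and invertibility of Q(l) makes [v] an
   unobservable eigenvector. *)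
have hA : hurw A.
  move=> l v v0 Av; rewrite ltNge; apply/negP => l0; apply: obs; exists l, v; split => //.
  apply: (can_inj (mulKmx (hQ l0))); rewrite mulmx0 mulmxA.
  have := congr1 (fun z => ev l z *m v) eE; rewrite !evM ev_char !ev_cP => <-.
  by rewrite -mulmxA mulmxBl mul_scalar_mx Av subrr mulmx0.
have hF : fdi A B Cm D.
  move=> l x u l0 hx; apply: (contraction_of_hPQ l0).
  have := congr1 (fun z => ev l z *m x) eE; rewrite !evM ev_char !ev_cP -!mulmxA.
  rewrite mulmxBl mul_scalar_mx hx addrC addKr => h.
  by rewrite eP evD !evM !ev_cP mulmxDl mulmxDr -!mulmxA h.
suff [X [hX dX]] : exists X, herm X /\ diss A B Cm D 1 X.
  have pX := diss_psd hA ler01 hX dX.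
  by exists X; split.
have [[l [eta [e0 eA eB]]]|cAB] := pselect (exists l (eta : 'rV_d.+1), [/\ eta != 0, eta *m A = l *: eta & eta *m B = 0]); last first.
  apply: kyp_ctrb => // l eta eA eB; apply/eqP; apply: contraT => e0.
  by exfalso; apply: cAB; exists l, eta.
have l0 := hurw_left hA e0 eA.
have [T [a [A1 [Tu Teta eTA]]]] := split_left e0 eA.
pose iT := invmx T; have iTu : iT \in unitmx by rewrite unitmx_inv.
pose B1 := dsubmx (T *m B).
have eTB : T *m B = col_mx 0 B1.
  rewrite -[LHS]vsubmxK; congr col_mx.
  move: eB; rewrite -Teta -mulmxA -{1}[T *m B]vsubmxK mul_row_col mul1mx mul0mx addr0.
  by [].
pose c := lsubmx (Cm *m iT); pose C1 := rsubmx (Cm *m iT).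
have eC : Cm *m iT = row_mx c C1 by rewrite hsubmxK.
have hA1 : hurw A1.
  move=> k w w0 hw; apply: (hA k (iT *m col_mx 0 w)).
    apply: contra w0 => /eqP /(congr1 (mulmx T)).
    by rewrite mulKVmx // mulmx0 -col_mx0 => /eq_col_mx [_ ->].
  have -> : A *m (iT *m col_mx 0 w) = iT *m (block_mx l%:M 0 a A1 *m col_mx 0 w).
    by rewrite -eTA !mulmxA mulVmx // mul1mx.
  by rewrite mul_block_col !mulmx0 mul0mx !add0r hw scalemxAr scale_col_mx scaler0.
pose E' := E *m cP iT.
have iTT : cP iT *m cP T = 1%:M by rewrite -cPM mulVmx // cP1.
have eE' : E' *m char_poly_mx (block_mx l%:M 0 a A1) = Q *m cP (Cm *m iT).
  rewrite -eTA char_conj // /E' -!mulmxA (mulmxA (cP iT)) iTT mul1mx.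
  by rewrite mulmxA eE -mulmxA -cPM.
rewrite char_block cP0 oppr0 eC cP_row_mx -[E']hsubmxK mul_row_block mul_mx_row in eE'.
have [h1 h2] := eq_row_mx eE'; rewrite mulmx0 add0r in h2.
have eP1 : P = rsubmx E' *m cP B1 + Q *m cP D.
  rewrite {1}eP; congr (_ + _).
  have -> : cP B = cP iT *m cP (T *m B) by rewrite -cPM mulKmx.
  by rewrite mulmxA -/E' -{1}[E']hsubmxK eTB cP_col_mx cP0 mul_row_col mulmx0 add0r.
have [X1 [hX1 _ dX1]] := IH A1 B1 C1 _ h2 eP1.
(* The column of [eE'] at the split mode is the relation that [extend_step] asks of [E0]. *)
have h1' : ('X - l%:P) *: lsubmx E' - rsubmx E' *m cP a = Q *m cP c.
  rewrite -h1 mulmxN; congr (_ - _).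
  have -> : char_poly_mx l%:M = ('X - l%:P)%:M :> 'M[{poly K}]_1.
    by rewrite /char_poly_mx map_scalar_mx -raddfB.
  by rewrite mul_mx_scalar.
have [|Y [hY dY]] := extend_step hA1 l0 h2 eP1 h1'; first by exists X1.
exists (ctr T *m Y *m T); split; first exact: herm_pull.
apply: diss_pull dY => //; first by rewrite -eTA mulmxKV.
by rewrite -eC mulmxKV.
Qed.

End KYPPoly.

(** * Passage between real and complex data *)

Section RealParts.
Variable R : realType.
Local Notation K := R[i].
Local Notation re := (@complex.Re R).
Local Notation im := (@complex.Im R).
Local Notation toC := (real_complex R).

Definition tc m n (M : 'M[R]_(m, n)) : 'M[K]_(m, n) := map_mx toC M.
Definition tp m n (M : 'M[{poly R}]_(m, n)) : 'M[{poly K}]_(m, n) := map_mx (map_poly toC) M.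

Lemma tcM m n p (M : 'M[R]_(m, n)) (N : 'M[R]_(n, p)) : tc (M *m N) = tc M *m tc N.
Proof. exact: map_mxM. Qed.
Lemma tpM m n p (M : 'M[{poly R}]_(m, n)) (N : 'M[{poly R}]_(n, p)) : tp (M *m N) = tp M *m tp N.
Proof. exact: map_mxM. Qed.
Lemma tcD m n (M N : 'M[R]_(m, n)) : tc (M + N) = tc M + tc N.
Proof. exact: map_mxD. Qed.
Lemma tpD m n (M N : 'M[{poly R}]_(m, n)) : tp (M + N) = tp M + tp N.
Proof. exact: map_mxD. Qed.
Lemma tpB m n (M N : 'M[{poly R}]_(m, n)) : tp (M - N) = tp M - tp N.
Proof. exact: map_mxB. Qed.
Lemma tp0 m n : tp (0 : 'M[_]_(m, n)) = 0.
Proof. exact: map_mx0. Qed.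
Lemma tp_cP m n (M : 'M[R]_(m, n)) : tp (cP M) = cP (tc M).
Proof. by apply/matrixP => i j; rewrite !mxE map_polyC. Qed.
Lemma tp_char n (A : 'M[R]_n) : tp (char_poly_mx A) = char_poly_mx (tc A).
Proof. exact: map_char_poly_mx. Qed.
Lemma ctr_tc m n (M : 'M[R]_(m, n)) : ctr (tc M) = tc M^T.
Proof. by apply/matrixP => i j; rewrite ctr_mxE !mxE conjc_real. Qed.
Lemma evalCE m n (M : 'M[{poly R}]_(m, n)) l : evalC M l = ev l (tp M).
Proof. by apply/matrixP => i j; rewrite !mxE. Qed.
Lemma evalC_conj m n (M : 'M[{poly R}]_(m, n)) l : (evalC M (conjc l))^T = ctr (ev l (tp M)).
Proof.
apply/matrixP => i j; rewrite ctr_mxE !mxE /horner_eval -[RHS]horner_map /=.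
congr (_ .[ _ ]); rewrite -map_poly_comp; apply: eq_map_poly => x /=.
by rewrite oppr0.
Qed.
Lemma ptl_tp m n (M : 'M[{poly R}]_(m, n)) : ptl (tp M) = tp (pstar M).
Proof.
apply/matrixP => i j; rewrite !mxE /tld map_comp_poly rmorphN /= map_polyX.
congr (_ \Po _); rewrite -map_poly_comp; apply: eq_map_poly => x /=.
by rewrite oppr0.
Qed.

Section Part.
Variable f : K -> R.
Hypothesis fD : {morph f : x y / x + y}.
Hypothesis fM : forall x (r : R), f (x * toC r) = f x * r.

Lemma part0 : f 0 = 0.
Proof. by apply: (addrI (f 0)); rewrite -fD !addr0. Qed.

Definition ppart (a : {poly K}) : {poly R} := \poly_(i < size a) f a`_i.

Lemma coef_ppart a i : (ppart a)`_i = f a`_i.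
Proof. by rewrite coef_poly; case: ltnP => // h; rewrite nth_default // part0. Qed.

Lemma ppartD : {morph ppart : a b / a + b}.
Proof. by move=> a b; apply/polyP => i; rewrite coefD !coef_ppart coefD fD. Qed.
Lemma ppart0 : ppart 0 = 0.
Proof. by apply/polyP => i; rewrite coef_ppart !coef0 part0. Qed.
Lemma ppartM a (b : {poly R}) : ppart (a * map_poly toC b) = ppart a * b.
Proof.
apply/polyP => i; rewrite coef_ppart !coefM (big_morph f fD part0).
by apply: eq_bigr => j _; rewrite coef_map fM coef_ppart.
Qed.

Definition mpart m n (M : 'M[{poly K}]_(m, n)) := map_mx ppart M.

Lemma mpartM m n p (M : 'M[{poly K}]_(m, n)) (N : 'M[{poly R}]_(n, p)) :
  mpart (M *m tp N) = mpart M *m N.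
Proof.
apply/matrixP => i j; rewrite !mxE (big_morph ppart ppartD ppart0).
by apply: eq_bigr => k _; rewrite !mxE ppartM.
Qed.
Lemma mpart0 m n : mpart (0 : 'M[_]_(m, n)) = 0.
Proof. by apply/matrixP => i j; rewrite !mxE ppart0. Qed.
End Part.

Lemma reM_real x (r : R) : re (x * toC r) = re x * r.
Proof. by case: x => a b /=; rewrite mulr0 subr0. Qed.
Lemma imM_real x (r : R) : im (x * toC r) = im x * r.
Proof. by case: x => a b /=; rewrite mulr0 add0r. Qed.
Lemma imD : {morph im : x y / x + y}. Proof. by case=> ? ? [? ?]. Qed.

Lemma mx_re_im m n (M : 'M[{poly K}]_(m, n)) :
  M = tp (mpart re M) + ('i%C : K)%:P *: tp (mpart im M).
Proof.
apply/matrixP => i j; apply/polyP => k; rewrite !mxE coefD coefCM !coef_map.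
exact: complexE.
Qed.

Section Bridge.
Variables (m n : nat) (P : 'M[{poly R}]_(m, n)) (Q : 'M[{poly R}]_m).
Hypothesis hbr : bounded_real_pair P Q.

Lemma br_contraction l : 0 <= re l -> forall v : 'cV_m,
  rd (ctr (ev l (tp P)) *m v) (ctr (ev l (tp P)) *m v)
  <= rd (ctr (ev l (tp Q)) *m v) (ctr (ev l (tp Q)) *m v).
Proof.
move=> l0 v; case: hbr => /(_ l l0 v) h _ _; move: h.
rewrite !evalC_conj !evalCE lecE => /andP[_ /=].
rewrite -ctrE mulmxBr mulmxBl mxE [X in _ <= re (_ + X)]mxE reD reN subr_ge0.
by rewrite /rd !ctrM !ctrK !mulmxA.
Qed.

Lemma br_left_null l (w : 'rV_m) : 0 <= re l ->
  w *m ev l (tp Q) = 0 -> w *m ev l (tp P) = 0 -> w = 0.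
Proof.
move=> l0 hQ hP; case: hbr => _ /(_ l l0) h _.
have fr : row_free (row_mx (evalC P l) (- evalC Q l)) by rewrite /row_free h.
apply: (row_free_inj fr); rewrite mul0mx mul_mx_row mulmxN !evalCE hQ hP oppr0.
exact: row_mx0.
Qed.

(** By (a) a row that annihilates Q(l) annihilates P(l) too, and then (b) makes it zero. *)
Lemma br_unit l : 0 <= re l -> ev l (tp Q) \in unitmx.
Proof.
move=> l0; rewrite -row_free_unit -kermx_eq0; apply/rowV0P => w /sub_kermxP hw.
apply: (br_left_null l0 hw).
have := br_contraction l0 (ctr w); rewrite -!ctrM hw ctr0 rd0r => h.
by apply: ctr_eq0; apply: rd_eq0; apply/eqP; rewrite eq_le h rd_ge0.
Qed.

Lemma br_real_null (v : 'rV[{poly R}]_m) l :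
  v *m (Q *m pstar Q - P *m pstar P) = 0 ->
  ev l (tp v) *m ev l (tp Q) = 0 -> ev l (tp v) *m ev l (tp P) = 0 -> ev l (tp v) = 0.
Proof.
move=> h hQ hP; case: hbr => _ _ /(_ v^T l); rewrite trmxK => hc.
have e : (evalC v^T l)^T = ev l (tp v) by apply/matrixP => i j; rewrite !mxE.
rewrite -e; apply/eqP; rewrite trmx_eq0; apply/eqP; apply: hc => //.
by rewrite e mul_mx_row mulmxN !evalCE hQ hP oppr0 row_mx0.
Qed.

(** Condition (c) speaks of real rows only. Write [v] as a + i b with real [a] and [b]. If [l] is
    not real, some real polynomial [j] has the value i at [l], and the real row a + j b has the same
    value as [v] there. If [l] is real, [a] and [b] satisfy the hypotheses separately. *)
Lemma br_coprime_tp : br_coprime (tp P) (tp Q).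
Proof.
move=> v l; rewrite !ptl_tp -!tpM -tpB => hv hQ hP.
have h1 := congr1 (@mpart re _ _) hv; have h2 := congr1 (@mpart im _ _) hv.
rewrite (mpartM (@reD R) reM_real) (mpart0 (@reD R)) in h1.
rewrite (mpartM imD imM_real) (mpart0 imD) in h2.
have ev_v : ev l v = ev l (tp (mpart re v)) + 'i%C *: ev l (tp (mpart im v)).
  by rewrite {1}[v]mx_re_im evD evZ hornerC.
move: h1 h2 ev_v; move: (mpart re v) (mpart im v) => a b h1 h2 ev_v.
have [l0|l0] := eqVneq (im l) 0; last first.
  pose j : {poly R} := (im l)^-1 *: ('X - (re l)%:P).
  have jl : (map_poly toC j).[l] = 'i%C.
    rewrite /j map_polyZ rmorphB /= map_polyX map_polyC hornerZ hornerXsubC.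
    have -> : l - toC (re l) = 'i%C * toC (im l).
      by apply/eqP; rewrite subr_eq addrC; apply/eqP; exact: complexE.
    by rewrite mulrCA -rmorphM mulVf // rmorph1 mulr1.
  have e : ev l v = ev l (tp (a + j *: b)).
    rewrite ev_v tpD evD; congr (_ + _); rewrite -jl -evZ; congr (ev l _).
    by apply/matrixP => s t; rewrite !mxE rmorphM.
  rewrite e in hQ hP *; apply: br_real_null => //.
  by rewrite mulmxDl -scalemxAl h1 h2 scaler0 addr0.
have el : l = toC (re l) by apply/eqP; rewrite eq_complex /= l0 !eqxx.
have evr s t (M : 'M[{poly R}]_(s, t)) : ev l (tp M) = tc (ev (re l) M).
  apply/matrixP => i k; rewrite !mxE /horner_eval {1}el horner_map.
  by [].
have sep p (M : 'M[{poly R}]_(m, p)) : ev l v *m ev l (tp M) = 0 ->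
    ev l (tp a) *m ev l (tp M) = 0 /\ ev l (tp b) *m ev l (tp M) = 0.
  rewrite ev_v !evr mulmxDl -scalemxAl -!tcM.
  move: (_ *m _) (_ *m _) => x y /matrixP h.
  split; apply/matrixP => i k; have := h i k; rewrite !mxE => /eqP.
    by rewrite eq_complex /= => /andP[/eqP h3 _]; congr toC; lra.
  rewrite eq_complex /= => /andP[_ /eqP h3]; congr toC; lra.
have [aQ bQ] := sep _ _ hQ; have [aP bP] := sep _ _ hP.
by rewrite ev_v (br_real_null h1 aQ aP) (br_real_null h2 bQ bP) scaler0 addr0.
Qed.

End Bridge.

Lemma quad_Lambda d n m (A : 'M[R]_d) (B : 'M[R]_(d, n)) (Cm : 'M[R]_(m, d)) (D : 'M[R]_(m, n))
  (X : 'M[R]_d) (x : 'cV[R]_d) (u : 'cV[R]_n) : symmx X ->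
  ((col_mx x u)^T *m Lambda A B Cm D X *m col_mx x u) 0 0 =
  (u^T *m u) 0 0 - ((Cm *m x + D *m u)^T *m (Cm *m x + D *m u)) 0 0
  - 2 * ((X *m x)^T *m (A *m x + B *m u)) 0 0.
Proof.
move=> hX.
have sw (p q : 'cV[R]_d) : (p^T *m q) 0 0 = (q^T *m p) 0 0.
  by rewrite -[p^T *m q]trmxK trmx_mul trmxK mxE.
have sw' (p q : 'cV[R]_m) : (p^T *m q) 0 0 = (q^T *m p) 0 0.
  by rewrite -[p^T *m q]trmxK trmx_mul trmxK mxE.
rewrite /Lambda tr_col_mx -mulmxA mul_block_col mul_row_col.
rewrite !(mulmxBl, mulmxBr, mulNmx, mulmxN, mulmxDl, mulmxDr, mul1mx).
rewrite !linearD /= !(mulmxBl, mulmxBr, mulNmx, mulmxN, mulmxDl, mulmxDr, mul1mx).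
have e (p q : 'M[R]_1) : (p + q) 0 0 = p 0 0 + q 0 0 by rewrite mxE.
have eN (p : 'M[R]_1) : (- p) 0 0 = - p 0 0 by rewrite mxE.
rewrite !(e, eN) !trmx_mul !mulmxA hX.
have tr11 (p : 'M[R]_1) : p 0 0 = p^T 0 0 by rewrite mxE.
have t1 : (x^T *m A^T *m X *m x) 0 0 = (x^T *m X *m A *m x) 0 0.
  by rewrite [LHS]tr11 !trmx_mul !trmxK hX !mulmxA.
have t2 : (u^T *m B^T *m X *m x) 0 0 = (x^T *m X *m B *m u) 0 0.
  by rewrite [LHS]tr11 !trmx_mul !trmxK hX !mulmxA.
have t3 : (u^T *m D^T *m Cm *m x) 0 0 = (x^T *m Cm^T *m D *m u) 0 0.
  by rewrite [LHS]tr11 !trmx_mul !trmxK !mulmxA.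
rewrite t1 t2 t3; ring.
Qed.

Lemma re_quad d (X : 'M[K]_d) (x y : 'cV[R]_d) :
  rd (tc x) (X *m tc y) = (x^T *m map_mx re X *m y) 0 0.
Proof.
rewrite rd_entries -mulmxA mxE; apply: eq_bigr => i _; rewrite !mxE mulr_sumr.
apply: eq_bigr => j _; rewrite !mxE; case: (X i j) => a b /=.
by ring.
Qed.

Lemma rd_tc n (x y : 'cV[R]_n) : rd (tc x) (tc y) = (x^T *m y) 0 0.
Proof.
rewrite rdE mxE; apply: eq_bigr => i _; rewrite !mxE /=.
by rewrite mulr0 addr0.
Qed.

(** On real vectors a Hermitian form sees only the real part of its matrix, so [map_mx re X] is a
    solution. *)
Theorem kyp_real d n m (A : 'M[R]_d) (B : 'M[R]_(d, n)) (Cm : 'M[R]_(m, d)) (D : 'M[R]_(m, n))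
    (P : 'M[{poly R}]_(m, n)) (Q : 'M[{poly R}]_m) (E : 'M[{poly R}]_(m, d)) :
  bounded_real_pair P Q ->
  E *m char_poly_mx A = Q *m cP Cm -> P = E *m cP B + Q *m cP D ->
  exists X, [/\ symmx X, psd X & psd (Lambda A B Cm D X)].
Proof.
move=> hbr eE eP.
have eE' : tp E *m char_poly_mx (tc A) = tp Q *m cP (tc Cm).
  by rewrite -tp_char -tp_cP -!tpM eE.
have eP' : tp P = tp E *m cP (tc B) + tp Q *m cP (tc D).
  by rewrite {1}eP tpD !tpM !tp_cP.
have h1 l : re l = 0 -> forall v : 'cV_m,
  rd (ctr (ev l (tp P)) *m v) (ctr (ev l (tp P)) *m v)
  <= rd (ctr (ev l (tp Q)) *m v) (ctr (ev l (tp Q)) *m v).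
  by move=> l0; apply: br_contraction => //; rewrite l0.
have [X [hX pX dX]] := kyp_poly h1 (br_unit hbr) (br_coprime_tp hbr) eE' eP'.
have sX : symmx (map_mx re X).
  by apply/matrixP => i j; rewrite !mxE -{1}hX ctr_mxE re_conj.
exists (map_mx re X); split => //.
  by move=> v; rewrite -re_quad; exact: pX.
move=> v; rewrite -[v]vsubmxK quad_Lambda //.
set x := usubmx v; set u := dsubmx v.
have -> : ((map_mx re X *m x)^T *m (A *m x + B *m u)) 0 0 =
    rd (tc x) (X *m tc (A *m x + B *m u)) by rewrite re_quad trmx_mul sX.
have := dX (tc x) (tc u); rewrite mul1r (rd_ctrl X) hX -!tcM -!tcD (rd_tc u) rd_tc.
lra.
Qed.

End RealParts.

(** * Kernel representations *)

Section SubmoduleBasis.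
Variable F : fieldType.

(** Containing [chi] times the free module replaces a rank condition; [chi] will be the
    characteristic polynomial of [A], by Cramer's rule. *)
Definition full_submodule m (chi : {poly F}) (N : 'rV[{poly F}]_m -> Prop) :=
  [/\ forall p q, N p -> N q -> N (p + q), forall a q, N q -> N (a *: q) &
      forall i, N (chi *: delta_mx 0 i)].

Definition submodule_gens m (N : 'rV[{poly F}]_m -> Prop) (Q : 'M[{poly F}]_m) :=
  [/\ \det Q != 0, forall i, N (row i Q) & forall q, N q -> exists a, q = a *m Q].

(** Division by a nonzero first coordinate of least degree, that of [qs], kills the first coordinate
    of any element of [N]; what remains lives on the last [m] coordinates, where the induction
    hypothesis applies. *)
Lemma submodule_basis_step m (chi : {poly F}) (N : 'rV[{poly F}]_(1 + m) -> Prop) :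
  (forall N', full_submodule chi N' -> exists Q : 'M[{poly F}]_m, submodule_gens N' Q) ->
  chi != 0 -> full_submodule chi N -> exists Q, submodule_gens N Q.
Proof.
move=> IH chi0 [ND NZ Nchi].
pose o : 'I_(1 + m) := lshift m 0.
pose Sz k := `[< exists q, [/\ N q, q 0 o != 0 & size (q 0 o) = k] >].
have exS : exists k, Sz k.
  exists (size chi); apply/asboolP; exists (chi *: delta_mx 0 o).
  by rewrite !mxE !eqxx mulr1; split.
have [k /asboolP [qs [Nqs qs0 szqs]] hmin] := ex_minnP exS.
pose N' (q : 'rV[{poly F}]_m) := N (row_mx 0 q).
have [|Q' [dQ' rQ' gQ']] := IH N'.
  split=> [p q hp hq|a q hq|i].
  - by rewrite /N' -[0]addr0 -add_row_mx; exact: ND.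
  - by rewrite /N' -(scaler0 _ a) -scale_row_mx; exact: NZ.
  have -> : N' (chi *: delta_mx 0 i) = N (chi *: delta_mx 0 (rshift 1 i)).
    rewrite /N'; congr N; apply/rowP => j.
    have [l ->|l ->] := split_ordP j.
      by rewrite row_mxEl !mxE eqxx /= eq_lrshift mulr0.
    by rewrite row_mxEr !mxE eqxx /= eq_rshift.
  exact: Nchi.
exists (block_mx (lsubmx qs) (rsubmx qs) 0 Q'); split.
- by rewrite det_ublock mulf_neq0 // det_mx11 mxE.
- rewrite /block_mx => i; have [j ->|j ->] := split_ordP i.
    by rewrite rowKu ord1 hsubmxK row_id.
  by rewrite rowKd rowE mul_mx_row mulmx0 -rowE; exact: rQ'.
move=> q Nq; pose a := q 0 o %/ qs 0 o.
pose r := q - a *: qs.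
have Nr : N r by apply: ND => //; rewrite -scaleNr; exact: NZ.
have er : r 0 o = q 0 o %% qs 0 o.
  by rewrite !mxE {1}(divp_eq (q 0 o) (qs 0 o)) addrAC subrr add0r.
have r0 : r 0 o = 0.
  apply/eqP; apply: contraT => rn0.
  have /hmin : Sz (size (r 0 o)) by apply/asboolP; exists r.
  by rewrite -szqs er leqNgt ltn_modp qs0.
have rE : r = row_mx 0 (rsubmx r).
  rewrite -[LHS]hsubmxK; congr row_mx; apply/rowP => j.
  by rewrite mxE ord1 r0 mxE.
have [a' ea'] : exists a', rsubmx r = a' *m Q' by apply: gQ'; rewrite /N' -rE.
exists (row_mx a%:M a'); rewrite mul_row_block mulmx0 addr0 !mul_scalar_mx -ea'.
have e1 : a *: qs = row_mx (a *: lsubmx qs) (a *: rsubmx qs).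
  by rewrite -scale_row_mx hsubmxK.
have e2 : q = a *: qs + r by rewrite addrC subrK.
by rewrite [LHS]e2 [X in _ + X]rE e1 add_row_mx addr0.
Qed.

(* Triangular (Hermite) basis of a full-rank submodule of [F[s]^m]. *)
Lemma submodule_basis m (chi : {poly F}) (N : 'rV[{poly F}]_m -> Prop) :
  chi != 0 -> full_submodule chi N -> exists Q, submodule_gens N Q.
Proof.
move=> chi0; elim: m N => [|m IH] N hN.
  exists 1%:M; split; [by rewrite det1 oner_eq0 | by case | move=> q _].
  by exists 0; rewrite [q]thinmx0 mul0mx.
exact: (@submodule_basis_step m chi N IH chi0 hN).
Qed.

End SubmoduleBasis.

(** * Powers of the state matrix and unobservable vectors *)

Section Observability.
Variable F : fieldType.
Variables (d m : nat) (A : 'M[F]_d) (Cm : 'M[F]_(m, d)).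

(** The polynomial form of the fact that the k-th derivative of a free motion is A^k applied to
    it. *)
Lemma delta_pow k : exists Dl : 'M[{poly F}]_d,
  Dl *m char_poly_mx A = ('X^k)%:M - cP (A ^+ k).
Proof.
elim: k => [|k [Dl eD]].
  by exists 0; rewrite mul0mx !expr0 -[cP 1]/(cP 1%:M) cP1 subrr.
exists (('X^k)%:M + Dl *m cP A).
have comm : cP A *m char_poly_mx A = char_poly_mx A *m cP A.
  by rewrite /char_poly_mx mulmxBr mulmxBl mul_mx_scalar mul_scalar_mx.
rewrite mulmxDl -mulmxA comm mulmxA eD mulmxBl -cPM.
have -> : A ^+ k *m A = A ^+ k.+1 by rewrite exprSr mulmxE.
rewrite {1}/char_poly_mx mulmxBr -scalar_mxM -exprSr addrA; congr (_ - _).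
by rewrite subrK.
Qed.

Lemma cayley_hamilton_step : exists a : 'I_d -> F, A ^+ d = \sum_i a i *: A ^+ i.
Proof.
exists (fun i => - (char_poly A)`_i).
case: d A => [|d'] A'; first by rewrite big_ord0 [LHS]flatmx0.
have := Cayley_Hamilton A'.
have hlc : (char_poly A')`_d'.+1 = 1.
  by have := char_poly_monic A'; rewrite monicE lead_coefE size_char_poly => /eqP.
rewrite -{1}[char_poly A']coefK poly_def size_char_poly raddf_sum /= big_ord_recr /= hlc.
have hX c k : horner_mx A' (c *: 'X^k) = c *: A' ^+ k.
  by rewrite horner_mxZ rmorphXn /= horner_mx_X.
rewrite hX scale1r => /eqP; rewrite addrC addr_eq0 => /eqP ->.
rewrite -sumrN; apply: eq_bigr => i _.
by rewrite hX scaleNr.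
Qed.

Lemma obs_all n (z : 'M[F]_(d, n)) :
  (forall k, (k < d)%N -> Cm *m A ^+ k *m z = 0) -> forall k, Cm *m A ^+ k *m z = 0.
Proof.
move=> h k; elim/ltn_ind: k => k IH; have [/h//|dk] := ltnP k d.
have [a ea] := cayley_hamilton_step.
rewrite -(subnKC dk) exprD -mulmxE ea mulmx_suml mulmx_sumr mulmx_suml big1 // => i _.
rewrite -scalemxAl -scalemxAr -scalemxAl.
have -> : A ^+ i *m A ^+ (k - d) = A ^+ (i + (k - d)) by rewrite exprD mulmxE.
rewrite IH ?scaler0 //.
by rewrite -[X in (_ < X)%N](subnKC dk) ltn_add2r.
Qed.

End Observability.

(** * Polynomial observers and kernel representations *)

Section KernelRep.
Variable F : fieldType.
Variables (d m : nat) (A : 'M[F]_d) (Cm : 'M[F]_(m, d)).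

Lemma submxrow_mul p (q_ : 'I_p -> nat) n1 n2 (P : 'M[F]_(n1, n2))
    (N : 'M[F]_(n2, \sum_i q_ i)) k :
  submxrow (P *m N) k = P *m submxrow N k.
Proof. by apply/matrixP => i j; rewrite !mxE; apply: eq_bigr => l _; rewrite !mxE. Qed.

Local Notation cpm := (char_poly_mx A).

(* [Pi] projects along the unobservable subspace; [Hs] and [M] recover the
   projected state from the output and the input. *)
Record observer (Pi : 'M[F]_d) (Hs : 'M[{poly F}]_(d, m)) (M : 'M[{poly F}]_d) : Prop := Observer {
  obs_null : forall n (z : 'M[F]_(d, n)), (forall k, Cm *m A ^+ k *m z = 0) -> Pi *m z = 0;
  obs_CA : forall k, Cm *m A ^+ k *m Pi = Cm *m A ^+ k;
  obs_PiA : Pi *m A *m Pi = Pi *m A;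
  obs_PiPi : Pi *m Pi = Pi;
  obs_HsC : Hs *m cP Cm = cP Pi + M *m cpm;
  obs_PiH : cP Pi *m Hs = Hs;
  obs_PiM : cP Pi *m M = M }.

(** [Pi] is a pseudo-inverse [H0] of the observability matrix times that matrix. The k-th block of
    [H] multiplies the k-th derivative of the output, whence [Hs]; [delta_pow] replaces s^k by A^k,
    and [M] collects the quotients. The factor [Pi] in [H] is there for [obs_PiH] and [obs_PiM]. *)
Lemma observer_exists : exists Pi Hs M, observer Pi Hs M.
Proof.
pose O := \mxcol_(k < d) (Cm *m A ^+ k).
pose H0 := pinvmx O; pose Pi := H0 *m O; pose H := Pi *m H0.
have OPi : O *m Pi = O by rewrite mulmxA; apply: mulmxKpV.
have Onull n (z : 'M[F]_(d, n)) : O *m z = 0 <-> forall k, Cm *m A ^+ k *m z = 0.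
  split=> [h|h].
    apply: obs_all => k kd; have := congr1 (fun N => submxcol N (Ordinal kd)) h.
    by rewrite mxcol_mul mxcolK submxcol0.
  by rewrite mxcol_mul -[RHS]mxcol0; apply: eq_mxcol => k; rewrite h.
have CA k : Cm *m A ^+ k *m Pi = Cm *m A ^+ k.
  have h : O *m (1%:M - Pi) = 0 by rewrite mulmxBr mulmx1 OPi subrr.
  have := (Onull _ _).1 h k; rewrite mulmxBr mulmx1 => /eqP.
  by rewrite subr_eq0 => /eqP.
have PiA : Pi *m A *m Pi = Pi *m A.
  have h : O *m (A *m (1%:M - Pi)) = 0.
    apply/Onull => k; rewrite mulmxA -(mulmxA Cm).
    have -> : A ^+ k *m A = A ^+ k.+1 by rewrite exprSr mulmxE.
    by rewrite mulmxBr mulmx1 CA subrr.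
  have : Pi *m (A *m (1%:M - Pi)) = 0 by rewrite -mulmxA h mulmx0.
  by rewrite mulmxBr mulmxBr mulmx1 mulmxA => /eqP; rewrite subr_eq0 => /eqP.
have PP : Pi *m Pi = Pi by rewrite {1}/Pi -mulmxA OPi.
pose Hk (k : 'I_d) : 'M[F]_(d, m) := submxrow H k.
have HO : \sum_k (Hk k *m (Cm *m A ^+ k)) = Pi.
  by rewrite -mul_mxrow_mxcol submxrowK -/O -mulmxA -/Pi PP.
have PiHk k : Pi *m Hk k = Hk k.
  by rewrite -submxrow_mul /H mulmxA PP.
have [Dl eD] := choice (delta_pow A).
exists Pi, (\sum_(k < d) ('X^k *: cP (Hk k))), (\sum_(k < d) (cP (Hk k *m Cm) *m Dl k)).
split => //.
- by move=> n z /Onull h; rewrite -mulmxA h mulmx0.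
- rewrite !mulmx_suml -HO /cP (raddf_sum (map_mx polyC)) -big_split /=.
  apply: eq_bigr => k _; rewrite -mulmxA eD mulmxBr mul_mx_scalar -!/(cP _).
  by rewrite -cPM mulmxA addrC subrK -scalemxAl cPM.
- rewrite mulmx_sumr; apply: eq_bigr => k _.
  by rewrite -scalemxAr -cPM PiHk.
- rewrite mulmx_sumr; apply: eq_bigr => k _.
  by rewrite mulmxA -cPM mulmxA PiHk.
Qed.

(** [Q] and [E] come from a basis of the pairs with e (s - A) = q C. [S1] and [S2] express in that
    basis two families of such pairs made from the observer; they serve to reconstruct the state and
    give the Bezout identity behind (b) and (c). *)
Record kernel_rep (Pi : 'M[F]_d) Hs M (Q : 'M[{poly F}]_m) (E : 'M[{poly F}]_(m, d)) S1 S2 : Prop := KernelRep {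
  kr_det : \det Q != 0;
  kr_syz : E *m cpm = Q *m cP Cm;
  kr_EPi : E *m cP Pi = E;
  kr_S1Q : S1 *m Q = cP Pi *m cpm *m Hs;
  kr_S1E : S1 *m E = cP Pi *m cpm *m M + cP Pi;
  kr_S2Q : S2 *m Q = cP Cm *m Hs - 1%:M;
  kr_S2E : S2 *m E = cP Cm *m M;
  kr_bezout : E *m S1 - Q *m S2 = 1%:M }.

Lemma kernel_rep_exists Pi Hs M : observer Pi Hs M ->
  exists Q E S1 S2, kernel_rep Pi Hs M Q E S1 S2.
Proof.
move=> ob.
pose N (q : 'rV[{poly F}]_m) := exists e, e *m cpm = q *m cP Cm.
have chi0 : char_poly A != 0 by apply/monic_neq0/char_poly_monic.
have hN : full_submodule (char_poly A) N.
  split.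
  - by move=> p q [e1 h1] [e2 h2]; exists (e1 + e2); rewrite !mulmxDl h1 h2.
  - by move=> a q [e h]; exists (a *: e); rewrite -!scalemxAl h.
  - move=> i; exists (delta_mx 0 i *m cP Cm *m \adj cpm).
    by rewrite -(mulmxA _ (\adj _)) mul_adj_mx mul_mx_scalar -!scalemxAl.
have [Q [dQ rQ gQ]] := submodule_basis chi0 hN.
have [e he] := choice rQ.
pose E := \matrix_i e i.
have eE : E *m cpm = Q *m cP Cm.
  by apply/row_matrixP => i; rewrite !row_mul rowK he.
have gen k (q : 'M[{poly F}]_(k, m)) (f : 'M[{poly F}]_(k, d)) : f *m cpm = q *m cP Cm ->
    exists S, S *m Q = q /\ S *m E = f.
  move=> hf; have h i : exists a, row i q = a *m Q.
    by apply: gQ; exists (row i f); rewrite -!row_mul hf.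
  have [a ha] := choice h; exists (\matrix_i a i).
  have e1 : (\matrix_i a i) *m Q = q by apply/row_matrixP => i; rewrite row_mul rowK -ha.
  split => //; apply: (@char_cancel _ _ _ A).
  by rewrite -mulmxA eE mulmxA e1 hf.
have PiC : cP Cm *m cP Pi = cP Cm.
  by rewrite -cPM; have := obs_CA ob 0; rewrite expr0 -[Cm *m 1]/(Cm *m 1%:M) mulmx1 => ->.
(* The output does not see the unobservable part: the difference [G] times a characteristic matrix
   is 0, and that matrix cancels. *)
have EPi : E *m cP Pi = E.
  pose G := E *m (1%:M - cP Pi).
  have h : A *m (1%:M - Pi) = (1%:M - Pi) *m (A *m (1%:M - Pi)).
    have h0 : Pi *m (A *m (1%:M - Pi)) = 0.
      by rewrite mulmxA mulmxBr mulmx1 (obs_PiA ob) subrr.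
    by rewrite mulmxBl mul1mx h0 subr0.
  have : G *m char_poly_mx (A *m (1%:M - Pi)) = 0.
    rewrite /char_poly_mx -/(cP _) mulmxBr /G -(mulmxA E _ (cP _)).
    have -> : (1%:M - cP Pi) *m cP (A *m (1%:M - Pi)) = cP (A *m (1%:M - Pi)).
      by rewrite [in RHS]h (cPM (1%:M - Pi)) cPD cPN cP1.
    have -> : E *m (1%:M - cP Pi) *m 'X%:M = E *m 'X%:M *m (1%:M - cP Pi).
      by rewrite -!mulmxA mul_mx_scalar mul_scalar_mx.
    rewrite cPM cPD cPN cP1 (mulmxA E (cP A)) -mulmxBl -mulmxBr -/(char_poly_mx A).
    by rewrite eE mulmxBr mulmx1 -mulmxA PiC subrr.
  rewrite -(mul0mx _ (char_poly_mx (A *m (1%:M - Pi)))) => /char_cancel.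
  by rewrite /G mulmxBr mulmx1 => /eqP; rewrite subr_eq0 => /eqP.
have [S1 [S1Q S1E]] : exists S, S *m Q = cP Pi *m cpm *m Hs /\ S *m E = cP Pi *m cpm *m M + cP Pi.
  have k1 : cP Pi *m cpm *m cP Pi = cP Pi *m cpm.
    rewrite /char_poly_mx -/(cP A) mulmxBr mulmxBl -!cPM (obs_PiA ob).
    by rewrite mul_mx_scalar -scalemxAl -cPM (obs_PiPi ob).
  apply: gen; rewrite -(mulmxA _ Hs) (obs_HsC ob) mulmxDl.
  by rewrite [RHS](mulmxDr (cP Pi *m cpm)) k1 addrC mulmxA.
have [S2 [S2Q S2E]] : exists S, S *m Q = cP Cm *m Hs - 1%:M /\ S *m E = cP Cm *m M.
  apply: gen; rewrite mulmxBl mul1mx -(mulmxA _ Hs) (obs_HsC ob) (mulmxDr (cP Cm) (cP Pi)) PiC.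
  by rewrite addrC addKr mulmxA.
exists Q, E, S1, S2; split => //.
(* It is enough to check the identity after multiplication by the nonsingular [Q]. *)
apply: (scale_poly_inj dQ).
have h : (E *m S1 - Q *m S2) *m Q = Q.
  rewrite mulmxBl -!mulmxA S1Q S2Q !mulmxA EPi eE mulmxBr mulmx1.
  by rewrite opprB addrCA mulmxA subrr addr0.
by rewrite -mul_mx_scalar -mul_mx_adj mulmxA h mul_mx_adj scalemx1.
Qed.

End KernelRep.

(** * The kernel representation is a bounded-real pair *)

Section BoundedRealComplex.
Variable R : realType.
Local Notation K := R[i].
Local Notation re := (@complex.Re R).
Variables (d n m : nat) (A : 'M[K]_d) (B : 'M[K]_(d, n)) (Cm : 'M[K]_(m, d)) (D : 'M[K]_(m, n)).
Variables (X G : 'M[K]_d) (Q S2 : 'M[{poly K}]_m) (E : 'M[{poly K}]_(m, d)) (S1 : 'M[{poly K}]_(d, m)).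
Hypotheses (hX : herm X) (pX : psdh X) (dX : diss A B Cm D 1 X).
Hypothesis kX : forall z : 'cV_d, (forall k, Cm *m A ^+ k *m z = 0) -> X *m z = 0.
Hypothesis kX' : forall z : 'cV_d, X *m z = 0 -> forall k, Cm *m A ^+ k *m z = 0.
Hypothesis eE : E *m char_poly_mx A = Q *m cP Cm.
Hypothesis eEX : E = E *m cP (G *m X).
Hypothesis bez : E *m S1 - Q *m S2 = 1%:M.
Let P := E *m cP B + Q *m cP D.

(** Modulo the kernel of [X], which is the unobservable subspace, [x] is an eigenvector of [A]
    without output, so every C A^k x vanishes. *)
Lemma unobs_mode (x : 'cV[K]_d) l : X *m (A *m x - l *: x) = 0 -> Cm *m x = 0 -> X *m x = 0.
Proof.
move=> hz hC; apply: kX => k; elim: k => [|k IH].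
  by rewrite expr0 -[Cm *m 1]/(Cm *m 1%:M) mulmx1.
have -> : A ^+ k.+1 = A ^+ k *m A by rewrite exprSr mulmxE.
have -> : Cm *m (A ^+ k *m A) *m x = Cm *m A ^+ k *m (A *m x) by rewrite !mulmxA.
have -> : A *m x = l *: x + (A *m x - l *: x) by rewrite addrC subrK.
by rewrite mulmxDr (kX' hz) addr0 -scalemxAr IH scaler0.
Qed.

(** A state whose costate [X *m wit e] is [ctr e]. It is one for [e = v *m ev l E] because [E]
    factors through [X]. *)
Let wit (e : 'rV[K]_d) := ctr (e *m G).

Let ev_syz (v : 'rV[K]_m) l : let e := v *m ev l E in let q := v *m ev l Q in
  [/\ X *m wit e = ctr e, e *m (l%:M - A) = q *m Cm & v *m ev l P = e *m B + q *m D].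
Proof.
move=> e q; split.
- have {2}-> : e = e *m (G *m X) by rewrite /e -mulmxA -{1}(ev_cP l (G *m X)) -evM -eEX.
  by rewrite /wit mulmxA [RHS]ctrM hX.
- by rewrite /e /q -!mulmxA -(ev_cP l Cm) -evM -eE evM ev_char.
- by rewrite /P evD !evM !ev_cP mulmxDr !mulmxA.
Qed.

Lemma rowcol_rd k (q : 'rV[K]_k) y : re ((q *m y) 0 0) = rd (ctr q) y.
Proof. by rewrite /rd ctrK. Qed.

(** An energy balance at the frequency [l], for the state [x] and the input [ctr p]: the last
    bracket is the dissipation slack, the other terms are a square and 2 Re l times the storage.
    Their signs give (a) of a bounded-real pair, their vanishing on the axis gives (c). *)
Lemma rep_contraction (v : 'rV[K]_m) l : let x := wit (v *m ev l E) in
  let q := v *m ev l Q in let p := v *m ev l P in let u := ctr p in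
  let y := Cm *m x + D *m u in
  rd (ctr q) (ctr q) - rd u u = 2 * re l * rd (X *m x) x + rd (ctr q - y) (ctr q - y)
   + (rd u u - rd y y - 2 * rd (X *m x) (A *m x + B *m u)).
Proof.
move=> x q p u y; have [e1 e2 e3] := ev_syz v l.
set e := v *m ev l E in e1 e2 e3; rewrite -/x -/q -/p in e1 e2 e3.
have h : rd (ctr q) y = rd u u + re l * rd (X *m x) x - rd (X *m x) (A *m x + B *m u).
  have -> : rd (ctr q) y = rd (ctr e) (l *: x - A *m x) + rd (ctr q) (D *m u).
    rewrite /y rdDr; congr (_ + _); rewrite -!rowcol_rd mulmxA -e2 -mulmxA mulmxBl.
    by rewrite mul_scalar_mx.
  have -> : rd u u = rd (ctr e) (B *m u) + rd (ctr q) (D *m u).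
    by rewrite {1}/u -rowcol_rd e3 mulmxDl mxE reD -(mulmxA e) -(mulmxA q) !rowcol_rd.
  by rewrite -e1 rdBr rdDr herm_rd_scale //; ring.
rewrite rd_subsq h; ring.
Qed.

Lemma rep_psd (v : 'rV[K]_m) l : 0 <= re l ->
  rd (ctr (v *m ev l P)) (ctr (v *m ev l P)) <= rd (ctr (v *m ev l Q)) (ctr (v *m ev l Q)).
Proof.
move=> l0; rewrite -subr_ge0 rep_contraction.
set x := wit _.
have := dX x (ctr (v *m ev l P)); rewrite mul1r => h.
have hx : 0 <= 2 * re l * rd (X *m x) x by rewrite mulr_ge0 ?mulr_ge0 // rdC; exact: pX.
by rewrite addr_ge0 //; [rewrite addr_ge0 // rd_ge0 | lra].
Qed.

(** Here [e = v E(l)] satisfies [e A = l e], and the inequality at its state [x] forces [C x = 0]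
    and makes Re l times the storage of [x] vanish. For Re l > 0 this gives [X x = 0]; on the axis
    the kernel of the dissipation form shows [x] to be an eigenvector modulo the kernel of [X], and
    [unobs_mode] applies. The Bezout identity then gives [v = 0]. *)
Lemma rep_left_null (v : 'rV[K]_m) l : 0 <= re l ->
  v *m ev l Q = 0 -> v *m ev l P = 0 -> v = 0.
Proof.
move=> l0 hQ hP; have [e1 e2 e3] := ev_syz v l.
rewrite hQ hP !mul0mx addr0 in e2 e3.
set e := v *m ev l E in e1 e2 e3; set x := wit e in e1.
suff e0 : e = 0.
  have := congr1 (fun N => v *m ev l N) bez; rewrite evB !evM -(cP1 _ m) ev_cP mulmx1 mulmxBr !mulmxA hQ -/e e0.
  by rewrite !mul0mx subrr => <-.
apply: ctr_eq0; rewrite -e1.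
have eA : e *m A = l *: e.
  by apply/eqP; rewrite eq_sym -subr_eq0 -mul_mx_scalar -mulmxBr e2.
have h1 : rd (X *m x) (A *m x) = re l * rd (X *m x) x.
  rewrite -herm_rd_scale // e1 -!rowcol_rd mulmxA eA.
  by rewrite -scalemxAl -scalemxAr.
have h2 := dX x 0; rewrite !mulmx0 !addr0 rd0r mul1r sub0r h1 in h2.
have h3 : 0 <= rd (X *m x) x by rewrite rdC; exact: pX.
have h4 := rd_ge0 (Cm *m x).
have h5 : 0 <= re l * rd (X *m x) x by rewrite mulr_ge0.
have Cx : Cm *m x = 0 by apply: rd_eq0; lra.
have [l00|ln0] := eqVneq (re l) 0; last first.
  apply: psdh_ker => //; rewrite rdC; apply/eqP.
  have : re l * rd (X *m x) x = 0 by lra.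
  by move=> /eqP; rewrite mulf_eq0 (negbTE ln0).
apply: (unobs_mode (l := l)) => //.
pose S := - (ctr A *m X + X *m A) - ctr Cm *m Cm.
have qS w : rd w (S *m w) = - (2 * rd (X *m w) (A *m w)) - rd (Cm *m w) (Cm *m w).
  rewrite /S mulmxBl rdBr mulNmx rdNr mulmxDl rdDr -!mulmxA.
  rewrite [rd w (ctr A *m _)]rd_ctr ctrK [rd w (X *m _)]rd_ctr hX (rdC (A *m w)).
  by rewrite [rd w (ctr Cm *m _)]rd_ctr ctrK; ring.
have hS : herm S.
  by rewrite /herm /S ctrB ctrN ctrD !ctrM !ctrK hX [X *m A + _]addrC.
have pS : psdh S.
  move=> w; rewrite qS; have := dX w 0.
  by rewrite !mulmx0 !addr0 rd0r mul1r; lra.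
have Sx : S *m x = 0.
  by apply: psdh_ker => //; rewrite qS h1 l00 Cx rd0r; lra.
have ll : conjc l = - l by move: l00; case: (l) => a b /= ->; apply/eqP; rewrite eq_complex /= oppr0 !eqxx.
move: Sx; rewrite /S mulmxBl -(mulmxA _ Cm) Cx mulmx0 subr0 mulNmx mulmxDl -!mulmxA e1.
rewrite -ctrM eA ctrZ -e1 ll scaleNr => /eqP.
rewrite oppr_eq0 addrC => /eqP h6.
by rewrite mulmxBr -scalemxAr.
Qed.

(* On the imaginary axis a row annihilating [Q Q* - P P*] makes every term of
   [rep_contraction] vanish; the resulting identities are polynomial. *)
Lemma rep_coprime : br_coprime P Q.
Proof.
move=> v l hv hQ hP.
pose e := v *m E; pose q := v *m Q; pose p := v *m P.
pose w := cP (ctr G) *m ptl e.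
have [r [L [W [_ sf]]]] := diss_factor hX dX.
have qp : q *m ptl q = p *m ptl p.
  apply/eqP; rewrite -subr_eq0 /q /p !ptlM !mulmxA -mulmxBl.
  by rewrite -!(mulmxA v) -mulmxBr hv mul0mx.
have ev_w s : ev s w = wit (ev (- conjc s) v *m ev (- conjc s) E).
  by rewrite /w evM ev_cP ev_ptl /e evM /wit [RHS]ctrM.
clearbody w.
(* A nonzero polynomial cannot have as many roots on the axis as it has coefficients. *)
have zero_of_axis k (f : 'cV[{poly K}]_k) : (forall s, re s = 0 -> ev s f = 0) -> f = 0.
  move=> hf; apply/colP => i; rewrite mxE; apply/eqP; apply: contraT => f0.
  pose rs := [seq Complex 0 (j%:R : R) | j <- iota 0 (size (f i 0))].
  have := max_poly_roots (rs := rs) f0; rewrite size_map size_iota ltnn.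
  apply; last by rewrite map_inj_uniq ?iota_uniq // => a b [] /eqP; rewrite eqr_nat => /eqP.
  apply/allP => z /mapP [j _ ->]; rewrite /root.
  by have /colP /(_ i) := hf (Complex 0 j%:R) erefl; rewrite !mxE => /eqP.
have axis s : re s = 0 -> - conjc s = s.
  by case: s => a b /= ->; apply/eqP; rewrite eq_complex /= opprK oppr0 !eqxx.
have eqs s : re s = 0 ->
   ev s (ptl q - (cP Cm *m w + cP D *m ptl p)) = 0 /\ ev s (cP L *m w + cP W *m ptl p) = 0.
  move=> s0; have h1 := rep_contraction (ev s v) s; cbv zeta in h1; move: h1.
  rewrite s0 mulr0 mul0r add0r.
  have h0 : rd (ctr (ev s v *m ev s Q)) (ctr (ev s v *m ev s Q)) =
            rd (ctr (ev s v *m ev s P)) (ctr (ev s v *m ev s P)).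
    have := congr1 (fun N => re (ev s N 0 0)) qp.
    by rewrite !evM !ev_ptl (axis _ s0) !rowcol_rd /q /p !evM.
  rewrite h0 subrr -[X in _ + (X - _ - _)]mul1r.
  have sl := slack (wit (ev s v *m ev s E)) (ctr (ev s v *m ev s P)) hX sf.
  rewrite mul1r in sl; rewrite mul1r sl.
  move: (rd_ge0 (ctr (ev s v *m ev s Q) -
      (Cm *m wit (ev s v *m ev s E) + D *m ctr (ev s v *m ev s P)))).
  move: (rd_ge0 (L *m wit (ev s v *m ev s E) + W *m ctr (ev s v *m ev s P))).
  move=> g1 g2 g3; rewrite evB !evD !evM !ev_cP !ev_ptl ev_w /q /p !evM (axis _ s0).
  by split; apply: rd_eq0; lra.
have e1 : ptl q = cP Cm *m w + cP D *m ptl p.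
  apply/eqP; rewrite -subr_eq0; apply/eqP; apply: zero_of_axis => s s0.
  by have [] := eqs s s0.
have e2 : cP L *m w + cP W *m ptl p = 0.
  by apply: zero_of_axis => s s0; have [] := eqs s s0.
(* The para-conjugates of [p] and [q] vanish at the mirror image of [l]. *)
pose mu := - conjc l; have mul : - conjc mu = l.
  by rewrite /mu; case: (l) => a b; apply/eqP; rewrite eq_complex /= !opprK !eqxx.
have pmu : ev mu (ptl p) = 0 by rewrite ev_ptl mul /p evM hP ctr0.
have qmu : ev mu (ptl q) = 0 by rewrite ev_ptl mul /q evM hQ ctr0.
pose x := wit (ev l v *m ev l E).
have xmu : ev mu w = x by rewrite ev_w mul.
have Cx : Cm *m x = 0.
  by have := congr1 (@ev _ mu _ _) e1; rewrite qmu evD !evM !ev_cP pmu xmu mulmx0 addr0.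
have Lx : L *m x = 0.
  by have := congr1 (@ev _ mu _ _) e2; rewrite ev0 evD !evM !ev_cP pmu xmu mulmx0 addr0.
have [d1 d2 d3] := ev_syz (ev l v) l.
set ee := ev l v *m ev l E in d1 d2; rewrite -/x in d1.
rewrite hQ mul0mx in d2.
suff e0 : ee = 0.
  have := congr1 (fun N => ev l v *m ev l N) bez.
  rewrite evB !evM -(cP1 _ m) ev_cP mulmx1 mulmxBr !mulmxA hQ -/ee e0.
  by rewrite !mul0mx subrr => <-.
apply: ctr_eq0; rewrite -d1; apply: (unobs_mode (l := mu)) => //.
have eA : ee *m A = l *: ee.
  by apply/eqP; rewrite eq_sym -subr_eq0 -mul_mx_scalar -mulmxBr d2.
case: sf => f1 _ _.
have : ctr L *m (L *m x) = 0 by rewrite Lx mulmx0.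
rewrite mulmxA -f1 mulmxBl mulmxBl mulNmx -(scalemxAl _ (ctr Cm *m Cm)) -(mulmxA (ctr Cm)) Cx mulmx0 scaler0 subr0.
rewrite -(mulmxA (ctr A)) d1 -ctrM eA ctrZ -d1 -(mulmxA X) => h.
by rewrite mulmxBr -scalemxAr -[RHS]oppr0 -h opprB opprK /mu scaleNr opprK addrC.
Qed.

End BoundedRealComplex.

Section BoundedRealReal.
Variable R : realType.
Local Notation K := R[i].
Local Notation re := (@complex.Re R).
Local Notation im := (@complex.Im R).

Lemma re_tcM m n p (M : 'M[R]_(m, n)) (z : 'M[K]_(n, p)) :
  map_mx re (tc M *m z) = M *m map_mx re z.
Proof.
apply/matrixP => i j; rewrite !mxE re_sum; apply: eq_bigr => k _; rewrite !mxE mulrC.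
by rewrite reM_real mulrC.
Qed.

Lemma im_sum (I : Type) (r : seq I) (P : pred I) (F : I -> K) :
  im (\sum_(i <- r | P i) F i) = \sum_(i <- r | P i) im (F i).
Proof. by apply: (big_morph _ (@imD R)). Qed.

Lemma im_tcM m n p (M : 'M[R]_(m, n)) (z : 'M[K]_(n, p)) :
  map_mx im (tc M *m z) = M *m map_mx im z.
Proof.
apply/matrixP => i j; rewrite !mxE im_sum; apply: eq_bigr => k _; rewrite !mxE mulrC.
by rewrite imM_real mulrC.
Qed.

Lemma mx_re_im_eq0 m n (z : 'M[K]_(m, n)) : map_mx re z = 0 -> map_mx im z = 0 -> z = 0.
Proof.
move=> /matrixP h1 /matrixP h2; apply/matrixP => i j; have := h1 i j; have := h2 i j.
by rewrite !mxE => e1 e2; apply/eqP; rewrite eq_complex e1 e2 !eqxx.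
Qed.

Lemma rd_re_im n (x y : 'cV[K]_n) :
  rd x y = ((map_mx re x)^T *m map_mx re y) 0 0 + ((map_mx im x)^T *m map_mx im y) 0 0.
Proof. by rewrite rdE !mxE -big_split; apply: eq_bigr => i _; rewrite !mxE. Qed.

Variables (d n m : nat) (A : 'M[R]_d) (B : 'M[R]_(d, n)) (Cm : 'M[R]_(m, d)) (D : 'M[R]_(m, n)).
Variable X : 'M[R]_d.
Hypotheses (sX : symmx X) (pX : psd X) (lX : psd (Lambda A B Cm D X)).

Lemma tc_herm : herm (tc X).
Proof. by rewrite /herm ctr_tc sX. Qed.

Lemma tc_psdh : psdh (tc X).
Proof.
move=> z; rewrite rd_re_im re_tcM im_tcM !mulmxA addr_ge0 //; exact: pX.
Qed.

Lemma tc_diss : diss (tc A) (tc B) (tc Cm) (tc D) 1 (tc X).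
Proof.
move=> x u; rewrite mul1r !rd_re_im.
have rD k (p q : 'cV[K]_k) : map_mx re (p + q) = map_mx re p + map_mx re q.
  by apply/matrixP => i j; rewrite !mxE reD.
have iD k (p q : 'cV[K]_k) : map_mx im (p + q) = map_mx im p + map_mx im q.
  by apply/matrixP => i j; rewrite !mxE imD.
rewrite !rD !iD !re_tcM !im_tcM.
have h1 := lX (col_mx (map_mx re x) (map_mx re u)).
have h2 := lX (col_mx (map_mx im x) (map_mx im u)).
rewrite quad_Lambda // in h1; rewrite quad_Lambda // in h2.
lra.
Qed.

Variables (Pi : 'M[R]_d) (Hs : 'M[{poly R}]_(d, m)) (M : 'M[{poly R}]_d).
Variables (Q : 'M[{poly R}]_m) (E : 'M[{poly R}]_(m, d)) (S1 : 'M[{poly R}]_(d, m)) (S2 : 'M[{poly R}]_m).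
Hypothesis ob : observer A Cm Pi Hs M.
Hypothesis kr : kernel_rep A Cm Pi Hs M Q E S1 S2.
Hypothesis kX : forall z : 'cV_d, (forall k, Cm *m A ^+ k *m z = 0) <-> X *m z = 0.

Lemma tc_pow k : tc (A ^+ k) = tc A ^+ k.
Proof.
elim: k => [|k IH]; first by rewrite !expr0; apply/matrixP => i j; rewrite !mxE rmorph_nat.
by rewrite !exprS -IH -!mulmxE tcM.
Qed.

Lemma tc_mul_eq0 p q (N : 'M[R]_(p, q)) (z : 'cV[K]_q) :
  tc N *m z = 0 <-> N *m map_mx re z = 0 /\ N *m map_mx im z = 0.
Proof.
split=> [h|[h1 h2]].
  rewrite -re_tcM -im_tcM h; split; apply/matrixP => i j; by rewrite !mxE.
by apply: mx_re_im_eq0; rewrite ?re_tcM ?im_tcM.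
Qed.

Lemma tc_kX (z : 'cV[K]_d) :
  (forall k, tc Cm *m tc A ^+ k *m z = 0) <-> tc X *m z = 0.
Proof.
split=> [h|/tc_mul_eq0 [/kX h1 /kX h2] k]; last first.
  by rewrite -tc_pow -tcM; apply/tc_mul_eq0; split.
have h' k := (tc_mul_eq0 (Cm *m A ^+ k) z).1.
by apply/tc_mul_eq0; split; apply/kX => k;
  have := h k; rewrite -tc_pow -tcM => /(h' k) [].
Qed.

Lemma br_of_rep : bounded_real_pair (E *m cP B + Q *m cP D) Q.
Proof.
(* The kernel of [X] is unobservable, and [Pi] annihilates unobservable vectors. *)
have [G eG] : exists G, Pi = G *m X.
  apply/submxP; rewrite submxE; apply/eqP; apply: (obs_null ob) => k.
  apply/matrixP => i j; have := mulmx_coker X.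
  move=> /(congr1 (fun N => col j N)); rewrite col0 colE -mulmxA => /kX /(_ k).
  by rewrite mulmxA -colE => /colP /(_ i); rewrite !mxE.
have hX := tc_herm; have pXc := tc_psdh; have dX := tc_diss.
have eE : tp E *m char_poly_mx (tc A) = tp Q *m cP (tc Cm).
  by rewrite -tp_char -tp_cP -!tpM (kr_syz kr).
have eEX : tp E = tp E *m cP (tc G *m tc X).
  by rewrite -tcM -eG -tp_cP -tpM (kr_EPi kr).
have bez : tp E *m tp S1 - tp Q *m tp S2 = 1%:M.
  by rewrite -!tpM -tpB (kr_bezout kr) -(cP1 R) tp_cP /tc map_mx1 cP1.
have eP : tp (E *m cP B + Q *m cP D) = tp E *m cP (tc B) + tp Q *m cP (tc D).
  by rewrite tpD !tpM !tp_cP.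
set P := E *m cP B + _ in eP *.
have kX1 z := (tc_kX z).1; have kX2 z := (tc_kX z).2.
split.
- move=> l l0 v.
  rewrite !evalC_conj !evalCE -ctrE.
  have := rep_psd hX pXc dX eE eEX (ctr v) l0.
  rewrite -eP => h.
  rewrite lecE; apply/andP; split.
    set N := _ - _.
    have hN : ctr N = N by rewrite /N ctrB !ctrM !ctrK.
    have : conjc ((ctr v *m N *m v) 0 0) = (ctr v *m N *m v) 0 0.
      by rewrite -ctr_mxE !ctrM ctrK hN mulmxA.
    by case: (_ 0 0) => a b [] /= hb; apply/eqP; lra.
  rewrite mulmxBr mulmxBl mxE [X in _ <= re (_ + X)]mxE reD reN subr_ge0.
  by move: h; rewrite /rd !ctrM !ctrK !mulmxA.
- move=> l l0; apply/eqP; change (row_free (row_mx (evalC P l) (- evalC Q l))).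
  rewrite -kermx_eq0; apply/rowV0P => w /sub_kermxP.
  rewrite mul_mx_row -row_mx0 mulmxN !evalCE => /eq_row_mx [h1 /eqP].
  rewrite oppr_eq0 => /eqP h2.
  apply: (rep_left_null hX pXc dX kX1 kX2 eE eEX bez l0 h2).
  by rewrite -eP.
move=> pv l hv.
have e : (evalC pv l)^T = ev l (tp pv^T) by apply/matrixP => i j; rewrite !mxE.
rewrite e mul_mx_row -[0 in RHS]row_mx0 mulmxN !evalCE => /eq_row_mx [h1 /eqP].
rewrite oppr_eq0 => /eqP h2.
have := rep_coprime hX dX kX1 kX2 eE eEX bez (v := tp pv^T) (l := l).
rewrite -eP => /(_ _ h2 h1).
rewrite -e => h3; rewrite -evalCE -[evalC pv l]trmxK h3 ?trmx0 //.
by rewrite !ptl_tp -!tpM -tpB -tpM hv tp0.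
Qed.

End BoundedRealReal.

Lemma cvg_sum (R : realType) (I : finType) (f : I -> nat -> R) (l : I -> R) :
  (forall i, f i @ \oo --> l i) -> (fun k => \sum_i f i k) @ \oo --> \sum_i l i.
Proof.
move=> h.
have -> : (fun k => \sum_i f i k) = \sum_i f i by apply/funext => k; rewrite fct_sumE.
apply: (big_ind2 (fun (u : nat -> R) (a : R) => u @ \oo --> a)) => [|u a v b ua vb|i _].
- exact: cvg_cst.
- exact: cvgD.
- exact: h.
Qed.

(** * Matrix exponentials, primitives and test functions *)

Section MatrixExp.
Variables (R : realType) (d : nat) (H : 'M[R]_d).

Lemma mxpow_bound p (L : 'M[R]_(p, d)) : exists r, 0 <= r /\ exists2 K, 0 <= K &
  forall k i j, `|(L *m H ^+ k) i j| <= K * r ^+ k.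
Proof.
pose r := \sum_i \sum_j `|H i j|; pose K := \sum_i \sum_j `|L i j|.
have r0 : 0 <= r by apply: sumr_ge0 => i _; apply: sumr_ge0.
exists r; split=> //; exists K; first by apply: sumr_ge0 => i _; apply: sumr_ge0.
elim=> [|k IH] i j.
  rewrite !expr0 -[L *m 1]/(L *m 1%:M) mulmx1 mulr1 /K (bigD1 i) //= (bigD1 j) //=.
  rewrite -addrA lerDl addr_ge0 //; first by apply: sumr_ge0.
  by apply: sumr_ge0 => a _; apply: sumr_ge0.
have -> : H ^+ k.+1 = H ^+ k *m H by rewrite exprSr mulmxE.
rewrite mulmxA mxE (le_trans (ler_norm_sum _ _ _)) // exprSr mulrA.
have K0 : 0 <= K * r ^+ k.
  by rewrite mulr_ge0 ?exprn_ge0 //; apply: sumr_ge0 => a _; apply: sumr_ge0.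
rewrite /r mulr_sumr; apply: ler_sum => a _; rewrite normrM.
rewrite (le_trans (ler_wpM2r (normr_ge0 _) (IH _ _))) //.
rewrite ler_wpM2l // (bigD1 j) //= lerDl; exact: sumr_ge0.
Qed.

(** Power series of an entry of L exp(tH) N. Keeping [L] and [N] inside makes termwise derivation
    the substitution of [L H] for [L]. *)
Definition ecoef p q (L : 'M[R]_(p, d)) (N : 'M[R]_(d, q)) i j (k : nat) : R :=
  (L *m H ^+ k *m N) i j / k`!%:R.

Lemma ecoef_cvg p q (L : 'M[R]_(p, d)) (N : 'M[R]_(d, q)) i j t :
  cvgn (pseries (ecoef L N i j) t).
Proof.
have [r [r0 [K K0 HK]]] := mxpow_bound L.
pose K' := K * \sum_l `|N l j|.
have K'0 : 0 <= K' by rewrite mulr_ge0 // sumr_ge0.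
apply: normed_cvg.
apply: (@series_le_cvg _ _ (K' *: exp_coeff (r * `|t|))) => [k|k|k|] /=.
- exact: normr_ge0.
- by rewrite /exp_coeff /= mulr_ge0 // divr_ge0 // exprn_ge0 // mulr_ge0.
- rewrite /ecoef !normrM normrX normfV normr_nat.
  have -> : (K' *: exp_coeff (r * `|t|)) k = K' * ((r * `|t|) ^+ k / k`!%:R) by [].
  rewrite exprMn.
  have h : `|(L *m H ^+ k *m N) i j| <= K' * r ^+ k.
    rewrite mxE (le_trans (ler_norm_sum _ _ _)) //.
    rewrite /K' mulrAC mulr_sumr; apply: ler_sum => a _.
    by rewrite normrM ler_wpM2r.
  rewrite mulrAC !mulrA ler_wpM2r ?invr_ge0 ?ler0n//.
  by rewrite ler_wpM2r ?exprn_ge0.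
- by apply: is_cvg_seriesZ; apply: is_cvg_series_exp_coeff.
Qed.

Definition mexp (t : R) : 'M[R]_d :=
  \matrix_(i, j) limn (pseries (ecoef 1%:M 1%:M i j) t).

Lemma mexpE p q (L : 'M[R]_(p, d)) (N : 'M[R]_(d, q)) i j t :
  (L *m mexp t *m N) i j = limn (pseries (ecoef L N i j) t).
Proof.
apply/esym/cvg_lim => //.
have -> : pseries (ecoef L N i j) t = fun n =>
   \sum_l \sum_k L i k * N l j * pseries (ecoef 1%:M 1%:M k l) t n.
  apply/funext => n; rewrite /pseries /series /=.
  under [RHS]eq_bigr => l _ do under eq_bigr => k _ do rewrite mulr_sumr.
  under [RHS]eq_bigr => l _ do rewrite exchange_big /=.
  rewrite exchange_big /=; apply: eq_bigr => s _.
  rewrite /ecoef mxE !mulr_suml; apply: eq_bigr => l _.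
  rewrite mxE !mulr_suml; apply: eq_bigr => k _.
  by rewrite mul1mx mulmx1; ring.
rewrite mxE; apply: cvg_sum => l; rewrite mxE mulr_suml; apply: cvg_sum => k.
rewrite mulrAC; apply: cvgMr; rewrite mxE; exact: ecoef_cvg.
Qed.

Lemma mexp_is_derive p q (L : 'M[R]_(p, d)) (N : 'M[R]_(d, q)) i j (t : R) :
  is_derive t 1 (fun s => (L *m mexp s *m N) i j) ((L *m H *m mexp t *m N) i j).
Proof.
have df (L' : 'M[R]_(p, d)) : pseries_diffs (ecoef L' N i j) = ecoef (L' *m H) N i j.
  apply/funext => k; rewrite /pseries_diffs /ecoef.
  have -> : H ^+ k.+1 = H *m H ^+ k by rewrite exprS mulmxE.
  rewrite factS natrM invfM !mulmxA; field.
  by rewrite !pnatr_eq0 -!lt0n fact_gt0 /= nat1r pnatr_eq0.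
have -> : (fun s => (L *m mexp s *m N) i j) = fun s => limn (pseries (ecoef L N i j) s).
  by apply/funext => s; rewrite mexpE.
rewrite mexpE -df; apply: (@pseries_snd_diffs _ _ (`|t| + 1)).
- exact: ecoef_cvg.
- by rewrite df; exact: ecoef_cvg.
- by rewrite !df; exact: ecoef_cvg.
- by rewrite [ltRHS]ger0_norm ?ltrDl ?addr_ge0.
Qed.

Lemma mexp0 : mexp 0 = 1%:M.
Proof.
apply/matrixP => i j; rewrite mxE; apply/cvg_lim => //.
rewrite -(cvg_shiftS (pseries _ _)) /=.
rewrite (_ : (fun n => _) = fun=> (1%:M : 'M[R]_d) i j); first exact: cvg_cst.
apply/funext => k; rewrite /pseries /series /= big_nat_recl //= big1 ?addr0.
  by rewrite /ecoef expr0 mulr1 fact0 divr1 mul1mx mulmx1.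
by move=> l _; rewrite expr0n mulr0.
Qed.

Lemma mexp_comm t : mexp t *m H = H *m mexp t.
Proof.
apply/matrixP => i j.
have := mexpE 1%:M H i j t; rewrite mul1mx => ->.
have := mexpE H 1%:M i j t; rewrite mulmx1 => ->.
congr (limn (pseries _ _)); apply/funext => k; rewrite /ecoef mul1mx mulmx1.
by rewrite mulmxE -exprSr -exprS.
Qed.

Lemma mexp_null p q (L : 'M[R]_(p, d)) (N : 'M[R]_(d, q)) t :
  (forall k, L *m H ^+ k *m N = 0) -> L *m mexp t *m N = 0.
Proof.
move=> h; apply/matrixP => i j; rewrite mexpE mxE; apply/cvg_lim => //.
rewrite (_ : pseries _ _ = fun=> 0); first exact: cvg_cst.
apply/funext => n; rewrite /pseries /series /= big1 // => k _.
by rewrite /ecoef h mxE !mul0r.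
Qed.

Lemma mexpNK t : mexp (- t) *m mexp t = 1%:M.
Proof.
apply/matrixP => i j; rewrite mxE.
pose f (s : R) := \sum_k mexp (- s) i k * mexp s k j.
have df (s : R) : is_derive s 1 f 0.
  have -> : f = \sum_k (fun s => mexp (- s) i k * mexp s k j).
    by apply/funext => x; rewrite fct_sumE.
  have Hs : \sum_k (mexp (- s) i k * (H *m mexp s) k j
       - (H *m mexp (- s)) i k * mexp s k j) = 0.
    rewrite sumrB.
    have := congr1 (fun M : 'M[R]_d => M i j)
     (mulmxA (mexp (- s)) H (mexp s)).
    rewrite mexp_comm !mxE => ->; exact: subrr.
  rewrite -Hs; apply: is_derive_sum => k.
  have h1 : is_derive s 1 (fun s => mexp s k j) ((H *m mexp s) k j).
    have := mexp_is_derive 1%:M 1%:M k j s; rewrite mul1mx mulmx1.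
    by under eq_fun => x do rewrite mul1mx mulmx1.
  have h2 : is_derive s 1 (fun s => mexp (- s) i k) (- (H *m mexp (- s)) i k).
    have h : is_derive (- s) 1 (fun s => mexp s i k) ((H *m mexp (- s)) i k).
      have := mexp_is_derive 1%:M 1%:M i k (- s); rewrite mul1mx mulmx1.
      by under eq_fun => x do rewrite mul1mx mulmx1.
    have hN : is_derive s 1 (fun s : R => - s) (-1) by apply: is_deriveN.
    apply: (@is_derive_eq _ _ _ _ _ _ _ _ (is_derive1_comp h hN)).
    by rewrite mulrN1.
  apply: (@is_derive_eq _ _ _ _ _ _ _ _ (is_deriveM h2 h1)).
  by rewrite /GRing.scale /=; ring.
have := is_derive_0_is_cst t 0 df; rewrite /f => ->.
under eq_bigr do rewrite oppr0 mexp0.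
have := congr1 (fun M : 'M[R]_d => M i j) (mul1mx (1%:M : 'M[R]_d)).
by rewrite mxE.
Qed.

Lemma mexpKN t : mexp t *m mexp (- t) = 1%:M.
Proof. by rewrite -{1}(opprK t) mexpNK. Qed.

End MatrixExp.

Lemma mexp_eq (R : realType) p d (L : 'M[R]_(p, d)) (H H' : 'M[R]_d) t :
  (forall k, L *m H ^+ k = L *m H' ^+ k) -> L *m mexp H t = L *m mexp H' t.
Proof.
move=> h; apply/matrixP => i j.
have E1 : (L *m mexp H t) i j = limn (pseries (ecoef H L 1%:M i j) t).
  by rewrite -(mexpE H) mulmx1.
have E2 : (L *m mexp H' t) i j = limn (pseries (ecoef H' L 1%:M i j) t).
  by rewrite -(mexpE H') mulmx1.
have e : ecoef H L 1%:M i j = ecoef H' L 1%:M i j.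
  by apply/funext => k; rewrite /ecoef h.
exact: etrans E1 (etrans (congr1 (fun c => limn (pseries c t)) e) (esym E2)).
Qed.

(** * Locally integrable functions and their primitives *)

Section LocInt.
Variable R : realType.
Local Notation mu := (@lebesgue_measure R).
Implicit Types f g F G : R -> R.

Definition Lone f := measurable_fun setT f /\
  forall a b : R, mu.-integrable `[a, b] (EFin \o f).

Definition iv f (a b : R) : R := Rintegral mu `[a, b] f.

Lemma Lone_intD f (D : set R) (a b : R) : measurable D -> D `<=` `[a, b] ->
  Lone f -> mu.-integrable D (EFin \o f).
Proof. by move=> mD Dab [_ /(_ a b)]; apply: integrableS. Qed.

Lemma Lone_dom f g : measurable_fun setT g -> Lone f ->
  (forall t, `|g t| <= f t) -> Lone g.
Proof.
move=> mg [mf fi] gf; split=> // a b; apply: le_integrable (fi a b) => //.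
  by apply/measurable_EFinP; apply: measurable_funS mg.
by move=> x _ /=; rewrite lee_fin (le_trans (gf x)) // ler_norm.
Qed.

Lemma LoneD f g : Lone f -> Lone g -> Lone (fun t => f t + g t).
Proof.
move=> [mf fi] [mg gi]; split; first exact: measurable_funD.
by move=> a b; apply: (integrableD _ (fi a b) (gi a b)).
Qed.

Lemma LoneZ (c : R) f : Lone f -> Lone (fun t => c * f t).
Proof.
move=> [mf fi]; split; first exact: measurable_funM.
by move=> a b; apply: (integrableZl _ c (fi a b)).
Qed.

Lemma Lone_sum (I : finType) (f : I -> R -> R) :
  (forall i, Lone (f i)) -> Lone (fun t => \sum_i f i t).
Proof.
move=> h; have -> : (fun t => \sum_i f i t) = \sum_i f i by apply/funext => k; rewrite fct_sumE.
apply: (big_ind Lone) => [|u v|i _]; [|exact: LoneD|exact: h].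
split; first exact: measurable_cst.
by move=> a b; apply: eq_integrable (integrable0 _ _).
Qed.

Lemma continuous_meas f : continuous f -> measurable_fun setT f.
Proof. by move=> cf; apply: open_continuous_measurable_fun; [exact: openT|move=> x _; exact: cf]. Qed.

Lemma Lone_cont f : continuous f -> Lone f.
Proof.
move=> cf; split; first exact: continuous_meas.
move=> a b; apply: continuous_compact_integrable; first exact: segment_compact.
exact: continuous_subspaceT.
Qed.

Definition Ltwo f := measurable_fun setT f /\ Lone (fun t => f t ^+ 2).

Lemma LtwoM f g : Ltwo f -> Ltwo g -> Lone (fun t => f t * g t).
Proof.
move=> [mf fi] [mg gi]; apply: Lone_dom (LoneD fi gi) _; first exact: measurable_funM.
move=> t; rewrite normrM -(real_normK (num_real (f t))) -(real_normK (num_real (g t))).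
nra.
Qed.

Lemma Ltwo_cont f : continuous f -> Ltwo f.
Proof.
move=> cf; split; first exact: continuous_meas.
by apply: Lone_cont => t; apply: cvgM; exact: cf.
Qed.

Lemma Ltwo_Lone f : Ltwo f -> Lone f.
Proof.
move=> hf; have := LtwoM hf (Ltwo_cont (@cst_continuous _ _ (1 : R))).
by under eq_fun => t do rewrite /cst mulr1.
Qed.

Lemma LtwoD f g : Ltwo f -> Ltwo g -> Ltwo (fun t => f t + g t).
Proof.
move=> hf hg; split; first exact: measurable_funD hf.1 hg.1.
have := LoneD (LoneD hf.2 (LoneZ 2 (LtwoM hf hg))) hg.2.
by congr Lone; apply/funext => t; ring.
Qed.

Lemma LtwoZ (c : R) f : Ltwo f -> Ltwo (fun t => c * f t).
Proof.
move=> hf; split; first exact: measurable_funM hf.1.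
by have := LoneZ (c ^+ 2) hf.2; congr Lone; apply/funext => t; ring.
Qed.

Lemma Ltwo_sum (I : finType) (f : I -> R -> R) :
  (forall i, Ltwo (f i)) -> Ltwo (fun t => \sum_i f i t).
Proof.
move=> h; have -> : (fun t => \sum_i f i t) = \sum_i f i by apply/funext => k; rewrite fct_sumE.
apply: (big_ind Ltwo) => [|u v|i _]; [|exact: LtwoD|exact: h].
exact: (Ltwo_cont (@cst_continuous _ _ (0 : R))).
Qed.

Lemma ivD f g a b : Lone f -> Lone g -> iv (fun t => f t + g t) a b = iv f a b + iv g a b.
Proof. by move=> [_ fi] [_ gi]; apply: RintegralD. Qed.

Lemma ivZ c f a b : Lone f -> iv (fun t => c * f t) a b = c * iv f a b.
Proof. by move=> [_ fi]; apply: RintegralZl. Qed.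

Lemma iv_sum (I : finType) (f : I -> R -> R) a b : (forall i, Lone (f i)) ->
  iv (fun t => \sum_i f i t) a b = \sum_i iv (f i) a b.
Proof.
move=> h; have -> : (fun t => \sum_i f i t) = \sum_i f i by apply/funext => k; rewrite fct_sumE.
suff [] : Lone (\sum_i f i) /\ iv (\sum_i f i) a b = \sum_i iv (f i) a b by [].
apply: (big_ind2 (fun u x => Lone u /\ iv u a b = x)) => [|u x v y [hu <-] [hv <-]|i _].
- split; first exact: (Lone_cont (@cst_continuous _ _ (0 : R))).
  by rewrite /iv Rintegral_cst // mul0r.
- by split; [exact: LoneD|exact: ivD].
- by split.
Qed.

Lemma iv_split f a b c : Lone f -> a <= b -> b <= c -> iv f a c = iv f a b + iv f b c.
Proof.
move=> lf ab bc; have [mf fi] := lf.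
have := @Rintegral_itvB _ f (BLeft a) (BRight c) b (fi a c) _ _.
rewrite !bnd_simp => /(_ ab bc); rewrite /iv Rintegral_itv_obnd_cbnd.
  by move=> <-; rewrite addrC subrK.
by apply: Lone_intD lf => //; apply: subset_itv_oc_cc.
Qed.

Lemma iv_le f g a b : Lone f -> Lone g -> (forall t, a <= t <= b -> f t <= g t) ->
  iv f a b <= iv g a b.
Proof. by move=> [_ fi] [_ gi] h; apply: le_Rintegral => // t; rewrite /= in_itv; apply: h. Qed.

Lemma iv_ge0 f a b : (forall t, a <= t <= b -> 0 <= f t) -> 0 <= iv f a b.
Proof. by move=> h; apply: Rintegral_ge0 => t; rewrite /= in_itv; apply: h. Qed.

Lemma iv_norm f a b : Lone f -> `|iv f a b| <= iv (fun t => `|f t|) a b.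
Proof. by move=> [_ fi]; apply: le_normr_Rintegral. Qed.

Lemma Lone_norm f : Lone f -> Lone (fun t => `|f t|).
Proof.
move=> [mf fi]; split; first exact: measurableT_comp.
by move=> a b; apply: (integrable_norm (fi a b)).
Qed.

Lemma iv_eq f g a b : (forall t, a <= t <= b -> f t = g t) -> iv f a b = iv g a b.
Proof. by move=> h; apply: eq_Rintegral => t; rewrite inE /= in_itv /=; apply: h. Qed.

Lemma iv_pt f a : iv f a a = 0.
Proof. by rewrite /iv set_itv1 Rintegral_set1. Qed.

Lemma iv_empty f a b : b < a -> iv f a b = 0.
Proof. by move=> ba; rewrite /iv set_itv_ge ?Rintegral_set0 // bnd_simp -ltNge. Qed.

(** For locally integrable [f] this is absolute continuity of [F] with derivative [f], in the
    integral form in which the state equation is given. *)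
Definition is_prim f F := forall a b, a <= b -> F b - F a = iv f a b.

(* At most one of the two intervals is non-degenerate. *)
Definition prim f (t : R) := iv f 0 t - iv f t 0.

Lemma prim_is_prim f : Lone f -> is_prim f (prim f).
Proof.
move=> lf a b ab; rewrite /prim.
have e0 x : 0 <= x -> iv f x 0 = 0.
  by rewrite le_eqVlt => /orP[/eqP <-|/iv_empty ->//]; rewrite iv_pt.
have e1 x : x <= 0 -> iv f 0 x = 0.
  by rewrite le_eqVlt => /orP[/eqP ->|/iv_empty ->//]; rewrite iv_pt.
have [a0|a0] := leP 0 a.
  have b0 := le_trans a0 ab.
  by rewrite (e0 b) // (e0 a) // (iv_split lf a0 ab); ring.
have [b0|b0] := leP b 0.
  by rewrite (e1 b) // (e1 a) ?ltW // (iv_split lf ab b0); ring.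
by rewrite (e0 b) ?ltW // (e1 a) ?ltW // (iv_split lf (ltW a0) (ltW b0)); ring.
Qed.

Lemma prim_cont f F : Lone f -> is_prim f F -> continuous F.
Proof.
move=> lf hF x; pose a := x - 1; pose b := x + 1.
have ab : a < b by rewrite /a /b; lra.
have := parameterized_integral_continuous (ltW ab) (lf.2 a b).
move=> /(continuous_within_itvP _ ab)[+ _ _] => /(_ x).
have xab : x \in `]a, b[ by rewrite in_itv /= /a /b; lra.
move=> /(_ xab) h.
have : (fun t => F a + parameterized_integral mu a t f) @ x --> F x.
  have ax : a <= x by rewrite /a; lra.
  have -> : F x = F a + parameterized_integral mu a x f.
    by have := hF a x ax; rewrite /iv /parameterized_integral => <-; ring.
  by apply: cvgD; [exact: cvg_cst|exact: h].
apply: cvg_trans; apply: near_eq_cvg.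
near=> t; have : a <= t by near: t; apply: lt_le_nbhsr; rewrite /a; lra.
by move=> /hF; rewrite /iv /parameterized_integral => <-; ring.
Unshelve. all: by end_near. Qed.

Lemma prim_derive f F t : Lone f -> {for t, continuous f} -> is_prim f F -> is_derive t 1 F (f t).
Proof.
move=> lf cf hF; pose a := t - 1; pose b := t + 1.
have [ab at'] : t < b /\ a < t by rewrite /a /b; lra.
have [dF F't] := continuous_FTC1_closed ab (lf.2 a b) at' cf.
have hd : is_derive t 1 (fun x => F a + iv f a x) (0 + f t).
  by apply: is_deriveD; apply: DeriveDef; [exact: dF|rewrite -derive1E].
rewrite add0r in hd; apply: near_eq_is_derive hd.
near=> x; have : a <= x by near: x; exact: lt_le_nbhsr.
by move=> /hF <-; ring.
Unshelve. all: by end_near. Qed.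

Lemma derive_prim f F : continuous f -> (forall t : R, is_derive t 1 F (f t)) -> is_prim f F.
Proof.
move=> cf dF a b ab.
have pG := prim_is_prim (Lone_cont cf).
rewrite -pG //; pose h := fun t => F t - prim f t.
suff : h a = h b by rewrite /h; lra.
apply: is_derive_0_is_cst => t; rewrite -(subrr (f t)).
by apply: is_deriveB; apply: prim_derive pG; [exact: Lone_cont|exact: cf].
Qed.

(* Supremum of the points up to which monotonicity propagates. *)
Lemma loc_mono (h : R -> R) :
  (forall t, exists2 e, 0 < e & forall a b, t - e < a -> a <= t -> t <= b -> b < t + e -> h a <= h b) ->
  forall a b, a <= b -> h a <= h b.
Proof.
move=> loc a b ab; pose S := [set s | a <= s <= b /\ h a <= h s].
have Sa : S a by rewrite /S /= lexx ab.
have sS : has_sup S by split; [exists a|exists b => s [/andP[]]].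
have ac : a <= sup S by apply: sup_upper_bound.
have cb : sup S <= b by apply: ge_sup; [exists a|move=> s [/andP[]]].
have [e e0 he] := loc (sup S).
have [s Ss hs] := sup_adherent e0 sS.
have sc : s <= sup S by apply: sup_upper_bound.
have Sc : h a <= h (sup S).
  by apply: le_trans Ss.2 _; apply: he => //; rewrite ltrDl.
have [<-//|cb'] := eqVneq (sup S) b.
have clt : sup S < b by rewrite lt_neqAle cb' cb.
pose s' := Num.min b (sup S + e / 2).
have : S s'.
  rewrite /S /= /s' /Num.min; case: ifPn => [lt1|]; [|rewrite -leNgt => le1];
    (split; [lra|apply: le_trans Sc _; apply: he; lra]).
move=> /(sup_upper_bound sS); rewrite /s' /Num.min; case: ifPn => _ h1; lra.
Qed.

(** For every [e] both [h + e H] and [e H - h] are locally monotone, hence monotone; then [e] tends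
    to 0. *)
Lemma loc_const (h H : R -> R) :
  (forall t e, 0 < e -> exists2 d, 0 < d &
     forall a b, t - d < a -> a <= t -> t <= b -> b < t + d -> `|h b - h a| <= e * (H b - H a)) ->
  forall a b, h a = h b.
Proof.
move=> loc.
have key a b : a <= b -> h a = h b.
  move=> ab; apply/eqP; rewrite -subr_eq0 -normr_le0.
  have main e : 0 < e -> `|h b - h a| <= e * (H b - H a).
    move=> e0; rewrite ler_norml.
    have h1 : h a + e * H a <= h b + e * H b.
      apply: (@loc_mono (fun t => h t + e * H t)) => // t.
      have [d d0 hd] := loc t e e0; exists d => // s s' h1 h2 h3 h4.
      by have := hd s s' h1 h2 h3 h4; rewrite ler_norml => /andP[]; lra.
    have h2 : e * H a - h a <= e * H b - h b.
      apply: (@loc_mono (fun t => e * H t - h t)) => // t.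
      have [d d0 hd] := loc t e e0; exists d => // s s' h1' h2 h3 h4.
      by have := hd s s' h1' h2 h3 h4; rewrite ler_norml => /andP[]; lra.
    lra.
  rewrite distrC; apply/ler_addgt0Pl => e e0; rewrite addr0.
  have k0 : 0 < `|H b - H a| + 1 by rewrite ltr_wpDl.
  apply: le_trans (main (e / (`|H b - H a| + 1)) _) _; first exact: divr_gt0.
  rewrite mulrAC ler_pdivrMr // ler_pM2l //.
  by rewrite (le_trans (ler_norm _)) // lerDl.
by move=> a b; have [/key//|/ltW/key->] := leP a b.
Qed.

Lemma LoneMc f G : Lone f -> continuous G -> Lone (fun t => f t * G t).
Proof.
move=> [mf fi] cG; split; first by apply: measurable_funM => //; exact: continuous_meas.
move=> a b; have [ab|ba] := leP a b; last first.
  rewrite set_itv_ge; first exact: integrable_set0.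
  by rewrite bnd_simp -ltNge.
have cN : {within `[a, b], continuous (fun t => `|G t|)}.
  by apply: continuous_subspaceT => t; apply: cvg_norm; exact: cG.
have [c _ hc] := EVT_max ab cN.
apply: (@le_integrable _ _ _ mu _ _ _ (fun t => (`|G c|%:E * (f t)%:E)%E)) => //.
- apply/measurable_EFinP; apply: measurable_funS (@measurableT _ _) (@subsetT _ _) _.
  by apply: measurable_funM => //; exact: continuous_meas.
- move=> t tab /=; rewrite lee_fin !normrM normr_id mulrC ler_wpM2r //.
  exact: hc.
- exact: (integrableZl _ `|G c| (fi a b)).
Qed.

(* On a short interval both sides differ by at most [e] times the integral of
   [|f| + |g|], hence their difference is constant by [loc_const]. *)
Lemma is_primM f g F G : Lone f -> Lone g -> is_prim f F -> is_prim g G ->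
  is_prim (fun t => f t * G t + F t * g t) (fun t => F t * G t).
Proof.
move=> lf lg pF pG; set k := fun t => _ + _.
have cF := prim_cont lf pF; have cG := prim_cont lg pG.
have l1 := LoneMc lf cG.
have l2 : Lone (fun t => F t * g t).
  by have := LoneMc lg cF; congr Lone; apply/funext => t; rewrite mulrC.
have lk : Lone k by apply: LoneD.
have pk := prim_is_prim lk.
have lH : Lone (fun t => `|f t| + `|g t|) by apply: LoneD; exact: Lone_norm.
have pH := prim_is_prim lH.
move=> a0 b0 ab0; rewrite -pk //.
suff : forall a b, F a * G a - prim k a = F b * G b - prim k b.
  by move=> /(_ a0 b0); lra.
apply: (@loc_const (fun t => F t * G t - prim k t) (prim (fun t => `|f t| + `|g t|))).
move=> t e e0; have e20 : 0 < e / 2 by lra.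
have /cvgrPdist_lt/(_ _ e20)[d1 /= d10 h1] := cF t.
have /cvgrPdist_lt/(_ _ e20)[d2 /= d20 h2] := cG t.
exists (Num.min d1 d2); first by rewrite lt_min d10.
move=> a b; rewrite ltrBlDr -ltrBlDl lt_min => /andP[a1 a2] at' tb.
rewrite -ltrBlDl lt_min => /andP[b1 b2].
have hF x : a <= x <= b -> `|F t - F x| < e / 2.
  by move=> hx; apply: h1 => /=; rewrite ltr_norml; lra.
have hG x : a <= x <= b -> `|G t - G x| < e / 2.
  by move=> hx; apply: h2 => /=; rewrite ltr_norml; lra.
have ab := le_trans at' tb.
have la : Lone (fun t => f t * (G a - G t)).
  by apply: LoneMc => // s; apply: cvgB; [exact: cvg_cst|exact: cG].
have lb : Lone (fun t => (F b - F t) * g t).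
  have : Lone (fun t => g t * (F b - F t)).
    by apply: LoneMc => // s; apply: cvgB; [exact: cvg_cst|exact: cF].
  by congr Lone; apply/funext => s; rewrite mulrC.
(* From F(b) G(b) - F(a) G(a) = (F(b) - F(a)) G(a) + F(b) (G(b) - G(a)), the error integrand
   contains only increments of [F] and [G], which are small near [t]. *)
have -> : F b * G b - prim k b - (F a * G a - prim k a) =
    iv (fun s => f s * (G a - G s) + (F b - F s) * g s) a b.
  have -> : iv (fun s => f s * (G a - G s) + (F b - F s) * g s) a b =
     iv (fun s => (G a * f s + F b * g s) + (- 1) * k s) a b.
    by apply: iv_eq => s _; rewrite /k; ring.
  rewrite ivD ?ivD ?ivZ //; try (by [exact: LoneZ | apply: LoneD; exact: LoneZ]).
  by rewrite -pF // -pG // -pk //; ring.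
rewrite pH // -ivZ //; apply: le_trans (iv_norm _ _ (LoneD la lb)) _.
apply: iv_le => [||s hs]; [exact/Lone_norm/LoneD|exact: LoneZ|].
rewrite (le_trans (ler_normD _ _)) // !normrM mulrDr [`|f s| * _]mulrC lerD // ler_wpM2r //.
  have := hG s hs; have := hG a; rewrite lexx ab => /(_ isT).
  by rewrite !ltr_norml ler_norml; lra.
have := hF s hs; have := hF b; rewrite lexx ab => /(_ isT).
by rewrite !ltr_norml ler_norml; lra.
Qed.

End LocInt.

(** * Smooth functions and bumps *)

Section Smooth.
Variable R : realType.
Implicit Types f g : R -> R.

Fixpoint Ck k f : Prop :=
  if k is k'.+1 then (forall t : R, derivable f t 1) /\ Ck k' ((derive1 f)) else True.

Definition smooth f := forall k, Ck k f.

Lemma smoothP f : smooth f <-> forall k (t : R), derivable (derive1n k f) t 1.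
Proof.
have h k : Ck k.+1 f <-> forall l, (l <= k)%N -> forall t : R, derivable (derive1n l f) t 1.
  elim: k f => [|k IH] f.
    split=> [[h _] l|h]; first by rewrite leqn0 => /eqP ->.
    by split=> // t; exact: (h 0%N isT).
  split=> [[h /IH h'] [|l] lk t|h]; first exact: h.
    by rewrite derive1Sn; exact: h'.
  split; first exact: (h 0%N isT).
  apply/IH => l lk t; rewrite -derive1Sn; exact: (h l.+1).
split=> [sf k t|sf [|k]//]; first by have /h/(_ k (leqnn k)) := sf k.+1.
by apply/h => l _; exact: sf.
Qed.

Lemma Ck_S k f : Ck k.+1 f -> Ck k f.
Proof. by elim: k f => [|k IH] f //= [df h]; split=> //; apply: IH. Qed.

Lemma Ck_intro k f g : (forall t : R, is_derive t 1 f (g t)) -> Ck k g -> Ck k.+1 f.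
Proof.
move=> h cg; split; first by move=> t; exact: ex_derive.
by rewrite (_ : (derive1 f) = g) //; apply/funext => t; rewrite derive1E; apply: derive_val.
Qed.

Lemma Ck_is_derive k f : Ck k.+1 f -> forall t : R, is_derive t 1 f ((derive1 f) t).
Proof. by move=> [df _] t; apply: DeriveDef => //; rewrite derive1E. Qed.

Lemma Ck_cst k (c : R) : Ck k (fun=> c).
Proof. by elim: k c => [//|k IH] c; apply: (@Ck_intro _ _ (fun=> 0)) => // t; apply: is_derive_cst. Qed.

Lemma CkD k f g : Ck k f -> Ck k g -> Ck k (fun t => f t + g t).
Proof.
elim: k f g => [//|k IH] f g cf cg.
apply: (@Ck_intro _ _ (fun t => (derive1 f) t + (derive1 g) t)); last exact: IH cf.2 cg.2.
by move=> t; apply: is_deriveD; [exact: Ck_is_derive cf t|exact: Ck_is_derive cg t].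
Qed.

Lemma CkM k f g : Ck k f -> Ck k g -> Ck k (fun t => f t * g t).
Proof.
elim: k f g => [//|k IH] f g cf cg.
apply: (@Ck_intro _ _ (fun t => f t * (derive1 g) t + g t * (derive1 f) t)).
  by move=> t; apply: is_deriveM; [exact: Ck_is_derive cf t|exact: Ck_is_derive cg t].
by apply: CkD; apply: IH; by [exact: Ck_S|exact: cf.2|exact: cg.2].
Qed.

Lemma Ck_aff k f (a b : R) : Ck k f -> Ck k (fun t => f (a * t + b)).
Proof.
elim: k f => [//|k IH] f cf.
apply: (@Ck_intro _ _ (fun t => (derive1 f) (a * t + b) * a)); last first.
  by apply: CkM; [exact: IH cf.2|exact: Ck_cst].
move=> t; apply: (@is_derive1_comp _ f (fun t => a * t + b)).
  exact: Ck_is_derive cf _.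
have h : is_derive t 1 (fun s : R => a * s + b) (a *: 1 + 0).
  by apply: is_deriveD.
by rewrite addr0 in h; rewrite -[X in is_derive _ _ _ X](mulr1 a).
Qed.

Lemma smooth_derive1 f : smooth f -> smooth (derive1 f).
Proof. by move=> sf k; have [] := sf k.+1. Qed.
Lemma smooth_is_derive f : smooth f -> forall t : R, is_derive t 1 f ((derive1 f) t).
Proof. by move=> sf; exact: Ck_is_derive (sf 1%N). Qed.
Lemma smooth_intro f g : (forall t : R, is_derive t 1 f (g t)) -> smooth g -> smooth f.
Proof. by move=> h sg [|k] //; apply: Ck_intro h (sg k). Qed.
Lemma smooth_cst (c : R) : smooth (fun=> c).
Proof. move=> k; exact: Ck_cst. Qed.
Lemma smoothD f g : smooth f -> smooth g -> smooth (fun t => f t + g t).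
Proof. by move=> sf sg k; apply: CkD. Qed.
Lemma smoothM f g : smooth f -> smooth g -> smooth (fun t => f t * g t).
Proof. by move=> sf sg k; apply: CkM. Qed.
Lemma smooth_aff f (a b : R) : smooth f -> smooth (fun t => f (a * t + b)).
Proof. by move=> sf k; exact: Ck_aff. Qed.
Lemma smooth_sum (I : finType) (f : I -> R -> R) :
  (forall i, smooth (f i)) -> smooth (fun t => \sum_i f i t).
Proof.
move=> h; have -> : (fun t => \sum_i f i t) = \sum_i f i by apply/funext => k; rewrite fct_sumE.
apply: (big_ind smooth) => [|u v|i _]; [exact: smooth_cst|exact: smoothD|exact: h].
Qed.
Lemma smooth_cont f : smooth f -> continuous f.
Proof.
by move=> /(_ 1%N)[df _] t; apply: differentiable_continuous; apply/derivable1_diffP.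
Qed.

Lemma smooth_mexp d (H : 'M[R]_d) p q (L : 'M[R]_(p, d)) (N : 'M[R]_(d, q)) i j :
  smooth (fun t => (L *m mexp H t *m N) i j).
Proof.
move=> k; elim: k L => [//|k IH] L; apply: Ck_intro (IH (L *m H)) => t.
exact: mexp_is_derive.
Qed.

(* [t^-n exp(-1/t)] extended by 0; its derivative is a combination of functions
   of the same family. *)
Definition flat n (t : R) : R := if t <= 0 then 0 else t^-1 ^+ n * expR (- t^-1).

(** From exp(1/t) >= (1/t)^(n+2) / (n+2)!; the quadratic order makes the difference quotient at 0
    tend to 0. *)
Lemma flat_le n t : `|flat n t| <= n.+2`!%:R * t ^+ 2.
Proof.
rewrite /flat; case: ifPn => [_|]; first by rewrite normr0 mulr_ge0 ?sqr_ge0.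
rewrite -ltNge => t0.
have i0 : 0 < t^-1 by rewrite invr_gt0.
rewrite ger0_norm; last by rewrite mulr_ge0 ?exprn_ge0 ?expR_ge0 // ltW.
have := @expR_ge1Dxn _ t^-1 n.+1 (ltW i0) => h.
have : t^-1 ^+ n.+2 / n.+2`!%:R <= expR t^-1 by apply: le_trans h; lra.
rewrite expRN ler_pdivrMr ?ltr0n ?fact_gt0 // => h2.
rewrite ler_pdivrMr ?expR_gt0 // mulrAC.
have -> : t^-1 ^+ n = t^-1 ^+ n.+2 * t ^+ 2.
  by rewrite -addn2 exprD -mulrA -exprMn mulVf ?expr1n ?mulr1 // gt_eqF.
by rewrite ler_wpM2r ?sqr_ge0 // mulrC.
Qed.

Lemma flat_is_derive n (t : R) :
  is_derive t 1 (flat n) (- n%:R * flat n.+1 t + flat n.+2 t).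
Proof.
have [t0|t0|->] := ltgtP t 0.
- rewrite /flat (ltW t0) mulr0 addr0.
  apply: (@near_eq_is_derive _ _ _ (cst 0)).
  by near=> s; rewrite /= ifT //; apply: ltW; near: s; exact: lt_nbhsl.
- have h1 : is_derive t 1 (fun s : R => s^-1) (- t^-1 ^+ 2).
    have := @is_deriveV _ id t 1 1 (lt0r_neq0 t0) (is_derive_id _ _).
    by rewrite -exprVn [_ *: _]mulr1.
  have hE : is_derive t 1 (fun s : R => expR (- s^-1)) (expR (- t^-1) * t^-1 ^+ 2).
    apply: (@is_derive1_comp _ expR (fun s => - s^-1)).
    by rewrite -[_ ^+ 2]opprK; apply: is_deriveN.
  have hX : is_derive t 1 (fun s : R => s^-1 ^+ n) (n%:R * t^-1 ^+ n.-1 * - t^-1 ^+ 2).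
    have := @is_deriveX _ _ _ n _ _ _ h1; rewrite exprfctE.
    by congr is_derive.
  have := @is_deriveM _ _ _ _ _ _ _ _ hX hE.
  set D := (X in is_derive _ _ _ X); move=> h.
  have -> : - n%:R * flat n.+1 t + flat n.+2 t = D.
    rewrite /D /flat leNgt t0 /GRing.scale /= !exprS.
    case: (n) => [|k] /=; first by rewrite expr0; ring.
    by rewrite !exprS; ring.
  apply: near_eq_is_derive h.
  near=> s; have s0 : 0 < s by near: s; exact: lt_nbhsr.
  by rewrite /flat leNgt s0.
have f0 k : flat k 0 = 0 by rewrite /flat lexx.
rewrite !f0 mulr0 addr0.
have h : h^-1 *: ((flat n \o shift 0) (h *: (1:R)) - flat n 0) @[h --> (0:R)^'] --> (0:R).
  apply/cvgrPdist_le => /= e e0; near=> h.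
  have h0 : h != 0 by near: h; exact: nbhs_dnbhs_neq.
  rewrite [h *: 1]mulr1 sub0r normrN addr0 f0 subr0 normrM normfV ler_pdivrMl ?normr_gt0 //.
  apply: le_trans (flat_le _ _) _; rewrite -(real_normK (num_real h)) expr2 mulrA.
  rewrite mulrC ler_wpM2l // -ler_pdivlMl ?ltr0n ?fact_gt0 //.
  near: h; apply: dnbhs0_le; by rewrite mulr_gt0 // invr_gt0 ltr0n fact_gt0.
by apply: DeriveDef; [apply/cvg_ex; exists 0; exact: h|apply/cvg_lim => //; exact: h].
Unshelve. all: by end_near. Qed.

Lemma smooth_flat n : smooth (flat n).
Proof.
move=> k; elim: k n => [//|k IH] n; apply: Ck_intro (flat_is_derive n) _.
by apply: CkD => //; apply: CkM => //; exact: Ck_cst.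
Qed.

Definition bump (a b t : R) := flat 0 (t - a) * flat 0 (b - t).

Lemma bump_gt0 a b t : a < t < b -> 0 < bump a b t.
Proof.
move=> /andP[at' tb]; rewrite /bump /flat !leNgt !subr_gt0 at' tb /= !expr0 !mul1r.
by rewrite mulr_gt0 ?expR_gt0.
Qed.
Lemma bump_ge0 a b t : 0 <= bump a b t.
Proof. by rewrite /bump /flat !expr0 !mul1r; do 2! case: ifP => _; rewrite ?mul0r ?mulr0 ?mulr_ge0 ?expR_ge0. Qed.
Lemma bump0 a b t : ~~ (a < t < b) -> bump a b t = 0.
Proof.
rewrite negb_and -!leNgt /bump /flat !subr_le0 => /orP[->|->]; first by rewrite mul0r.
by rewrite mulr0.
Qed.
Lemma smooth_bump a b : smooth (bump a b).
Proof.
apply: smoothM.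
  have := smooth_aff 1 (- a) (@smooth_flat 0); congr smooth.
  by apply/funext => t; rewrite mul1r.
have := smooth_aff (-1) b (@smooth_flat 0); congr smooth.
by apply/funext => t; rewrite mulN1r addrC.
Qed.

End Smooth.

(** * Test functions and lemmas of du Bois-Reymond type *)

Section Test.
Variable R : realType.
Local Notation mu := (@lebesgue_measure R).
Implicit Types f g w phi psi : R -> R.

Definition csupp phi := exists M : R, forall t : R, M < `|t| -> phi t = 0.

Lemma testP phi : test_fun phi <-> smooth phi /\ csupp phi.
Proof. by split=> [[/smoothP sf cf]|[/smoothP sf cf]]. Qed.

Lemma test_cont phi : test_fun phi -> continuous phi.
Proof. by move=> /testP[/smooth_cont]. Qed.

Lemma testD phi psi : test_fun phi -> test_fun psi -> test_fun (fun t => phi t + psi t).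
Proof.
move=> /testP[s1 [M1 h1]] /testP[s2 [M2 h2]]; apply/testP; split; first exact: smoothD.
by exists (Num.max M1 M2) => t; rewrite gt_max => /andP[/h1 -> /h2 ->]; rewrite addr0.
Qed.

Lemma testMs f phi : smooth f -> test_fun phi -> test_fun (fun t => f t * phi t).
Proof.
move=> sf /testP[s1 [M1 h1]]; apply/testP; split; first exact: smoothM.
by exists M1 => t /h1 ->; rewrite mulr0.
Qed.

Lemma testZ (c : R) phi : test_fun phi -> test_fun (fun t => c * phi t).
Proof. by move=> h; apply: testMs => //; exact: smooth_cst. Qed.

Lemma test0 : test_fun (fun=> 0 : R).
Proof. by apply/testP; split; [exact: smooth_cst|exists 0]. Qed.

Lemma test_sum (I : finType) (f : I -> R -> R) :
  (forall i, test_fun (f i)) -> test_fun (fun t => \sum_i f i t).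
Proof.
move=> h; have -> : (fun t => \sum_i f i t) = \sum_i f i by apply/funext => k; rewrite fct_sumE.
apply: (big_ind (@test_fun R)) => [|u v|i _]; [exact: test0|exact: testD|exact: h].
Qed.

Lemma test_derive1 phi : test_fun phi -> test_fun (derive1 phi).
Proof.
move=> /testP[s1 [M1 h1]]; apply/testP; split; first exact: smooth_derive1.
exists M1 => t ht; have : is_derive t 1 phi 0.
  apply: (@near_eq_is_derive _ _ _ (cst 0)).
  have ct : (fun s : R => `|s|) @ t --> `|t| by apply: cvg_norm; exact: cvg_id.
  have ns : \forall s \near t, M1 < `|s| by exact: (cvgr_gt _ ct _ ht).
  by apply: filterS ns => s /h1 ->.
by rewrite derive1E => h; apply: derive_val.
Qed.

Lemma test_bump a b : test_fun (@bump R a b).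
Proof.
apply/testP; split; first exact: smooth_bump.
exists (Num.max `|a| `|b|) => t; rewrite gt_max => /andP[ta tb]; apply: bump0.
apply/negP => /andP[h1 h2]; have [t0|t0] := leP 0 t.
  have b0 : 0 <= b by lra.
  by move: tb; rewrite !ger0_norm //; lra.
have a0 : a <= 0 by lra.
by move: ta; rewrite !ler0_norm ?ltW //; lra.
Qed.

Definition ti w phi : R := Rintegral mu setT (fun t => phi t * w t).

Lemma ti_iv w phi M : (forall t, M < `|t| -> phi t = 0) ->
  ti w phi = iv (fun t => phi t * w t) (- M) M.
Proof.
move=> h; rewrite /ti /iv [RHS]Rintegral_mkcond; congr (Rintegral _ _ _).
apply/funext => t; rewrite patchE; case: ifPn => //.
rewrite notin_setE /= in_itv /= -ler_norml => /negP; rewrite -ltNge => /h ->.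
by rewrite mul0r.
Qed.

Lemma ti_Lone w phi : Lone w -> test_fun phi -> Lone (fun t => phi t * w t).
Proof.
move=> lw /test_cont cp; have := LoneMc lw cp.
by congr Lone; apply/funext => t; rewrite mulrC.
Qed.

Lemma tiD w phi psi : Lone w -> test_fun phi -> test_fun psi ->
  ti w (fun t => phi t + psi t) = ti w phi + ti w psi.
Proof.
move=> lw h1 h2; have /testP[_ [M1 H1]] := h1; have /testP[_ [M2 H2]] := h2.
pose M := Num.max M1 M2.
have H1' t : M < `|t| -> phi t = 0 by rewrite gt_max => /andP[/H1].
have H2' t : M < `|t| -> psi t = 0 by rewrite gt_max => /andP[_ /H2].
rewrite (ti_iv _ H1') (ti_iv _ H2') -ivD; [|exact: ti_Lone..].
rewrite (@ti_iv _ _ M); last by move=> t ht; rewrite H1' // H2' // addr0.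
by apply: iv_eq => t _; rewrite mulrDl.
Qed.

Lemma tiZ c w phi : Lone w -> test_fun phi ->
  ti w (fun t => c * phi t) = c * ti w phi.
Proof.
move=> lw h1; have /testP[_ [M H]] := h1.
rewrite (ti_iv _ H) -ivZ; last exact: ti_Lone.
rewrite (@ti_iv _ _ M); last by move=> t ht; rewrite H // mulr0.
by apply: iv_eq => t _; rewrite mulrA.
Qed.

Lemma tiDw v w phi : Lone v -> Lone w -> test_fun phi ->
  ti (fun t => v t + w t) phi = ti v phi + ti w phi.
Proof.
move=> lv lw h1; have /testP[_ [M H]] := h1.
rewrite !(ti_iv _ H) -ivD; [|exact: ti_Lone..].
by apply: iv_eq => t _; rewrite mulrDr.
Qed.

Lemma tiZw c w phi : Lone w -> test_fun phi -> ti (fun t => c * w t) phi = c * ti w phi.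
Proof.
move=> lw h1; have /testP[_ [M H]] := h1.
rewrite !(ti_iv _ H) -ivZ; last exact: ti_Lone.
by apply: iv_eq => t _; rewrite mulrCA.
Qed.

Lemma ti_ae v w phi : Lone v -> Lone w -> test_fun phi ->
  {ae mu, forall t, v t = w t} -> ti v phi = ti w phi.
Proof.
move=> lv lw tp vw; congr fine; apply: ae_eq_integral => //.
- by apply/measurable_EFinP; have [] := ti_Lone lv tp.
- by apply/measurable_EFinP; have [] := ti_Lone lw tp.
- by move: vw; apply: filterS; [exact: (ae_filter_ringOfSetsType mu)|move=> t /= -> _].
Qed.

Lemma ti_ibp f F phi : Lone f -> is_prim f F -> test_fun phi ->
  ti F (derive1 phi) = - ti f phi.
Proof.
move=> lf pF tp; have /testP[sp [M H]] := tp; have /testP[sp' [M' H']] := test_derive1 tp.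
pose N := Num.max 1 (Num.max M M') + 1.
have N0 : 0 < N by rewrite /N ltr_wpDl // le_max ler01.
have HN t : N <= `|t| -> phi t = 0.
  by move=> h; apply: H; apply: lt_le_trans h; rewrite /N ltr_pwDr // !le_max lexx orbT.
have cF := prim_cont lf pF.
rewrite (@ti_iv F _ N); last first.
  by move=> t h; apply: H'; apply: le_lt_trans h; rewrite /N ler_wpDr // !le_max lexx !orbT.
rewrite (@ti_iv f phi N); last by move=> t /ltW /HN.
have cp' : continuous (derive1 phi) by exact: smooth_cont.
have pp : is_prim (derive1 phi) phi by apply: derive_prim cp' (smooth_is_derive sp).
have NN : - N <= N by lra.
have := is_primM (Lone_cont cp') lf pp pF NN.
rewrite (HN N) ?(HN (- N)) ?normrN ?gtr0_norm // !mul0r subr0 => /esym /eqP.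
rewrite ivD; first by rewrite addr_eq0 => /eqP.
- by apply: LoneMc cF; exact: Lone_cont.
- exact: ti_Lone.
Qed.

Lemma test_antideriv psi : test_fun psi -> ti (fun=> 1) psi = 0 ->
  exists2 phi, test_fun phi & derive1 phi = psi.
Proof.
move=> tp; have /testP[sp [M H]] := tp; have cp := test_cont tp.
pose N := Num.max 0 M + 1; have N0 : 0 <= N by rewrite addr_ge0 // le_max lexx.
have HN t : N <= `|t| -> psi t = 0.
  by move=> h; apply: H; apply: lt_le_trans h; rewrite /N ltr_pwDr // le_max lexx orbT.
rewrite (@ti_iv _ _ N) => [h0|t /ltW/HN //]; have pp := prim_is_prim (Lone_cont cp).
pose phi t := prim psi t - prim psi (- N).
have dp (t : R) : is_derive t 1 phi (psi t).
  rewrite -[psi t]subr0; apply: is_deriveB.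
  by apply: prim_derive pp; [exact: Lone_cont|exact: cp].
exists phi; last by apply/funext => t; rewrite derive1E; apply: derive_val.
apply/testP; split; first exact: smooth_intro dp sp.
have z0 a b : (forall t, a <= t <= b -> N <= `|t|) -> a <= b -> prim psi b - prim psi a = 0.
  move=> hz ab; rewrite pp // (@iv_eq _ _ (fun=> 0)).
    by rewrite /iv Rintegral_cst // mul0r.
  by move=> t /hz /HN.
exists N => t; have [t0|t0] := leP 0 t; rewrite ?(ger0_norm t0) ?(ltr0_norm t0) => tN.
  have e1 : prim psi t - prim psi N = 0.
    apply: z0; last exact: ltW.
    by move=> s /andP[h1 h2]; rewrite ger0_norm // (le_trans N0).
  have e2 : prim psi N - prim psi (- N) = 0.
    rewrite pp; last by lra.
    by rewrite -h0; apply: iv_eq => s _; rewrite mulr1.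
  by rewrite /phi -(subrKA (prim psi N)) e1 e2 addr0.
have e1 : prim psi (- N) - prim psi t = 0.
  apply: z0; last by lra.
  by move=> s hs; rewrite ler0_norm; lra.
by rewrite /phi -opprB e1 oppr0.
Qed.

(** Subtracting a multiple of a fixed bump gives mean zero, and a test function of mean zero is the
    derivative of a test function. [T] is an abstract linear functional because [ode_functional]
    applies this to distributions for which no representing function is given. *)
Lemma test_dubois (T : (R -> R) -> R) :
  (forall phi psi, test_fun phi -> test_fun psi ->
     T (fun t => phi t + psi t) = T phi + T psi) ->
  (forall c phi, test_fun phi -> T (fun t => c * phi t) = c * T phi) ->
  (forall phi, test_fun phi -> T (derive1 phi) = 0) ->
  exists c, forall phi, test_fun phi -> T phi = c * ti (fun=> 1) phi.
Proof.
move=> TD TZ Td; have L1 : Lone (fun=> 1 : R) by apply: Lone_cont; exact: cst_continuous.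
pose b := bump (- 1) (1 : R); have tb : test_fun b := test_bump _ _.
have cb := test_cont tb; have pb := prim_is_prim (Lone_cont cb).
pose I := ti (fun=> 1) b.
(* A vanishing integral would make the primitive of the nonnegative [b] constant on [-1, 1], against
   b(0) > 0. *)
have I0 : I != 0.
  have b0 t : 1 <= `|t| -> b t = 0.
    by move=> h; apply: bump0; rewrite -ltr_norml -leNgt.
  rewrite /I (@ti_iv _ _ 1) => [|t /ltW/b0 //].
  have -> : iv (fun t => b t * 1) (-1) 1 = iv b (-1) 1 by apply: iv_eq => t _; rewrite mulr1.
  apply/eqP => h.
  have hc t : -1 <= t <= 1 -> prim b t = prim b (-1).
    move=> /andP[t1 t2]; apply/eqP; rewrite -subr_eq0 pb //.
    have := h; rewrite (iv_split (Lone_cont cb) t1 t2).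
    have := @iv_ge0 _ b (-1) t (fun s _ => bump_ge0 _ _ _).
    have := @iv_ge0 _ b t 1 (fun s _ => bump_ge0 _ _ _).
    by move=> *; apply/eqP; lra.
  have d1 : is_derive (0:R) 1 (prim b) (b 0).
    by apply: prim_derive pb; [exact: Lone_cont|exact: cb].
  have d2 : is_derive (0:R) 1 (prim b) 0.
    apply: (@near_eq_is_derive _ _ _ (cst (prim b (-1)))).
    near=> s; rewrite /= hc //; apply/andP; split; near: s.
      by apply: lt_le_nbhsr; rewrite oppr_lt0.
    by near=> s; apply: ltW; near: s; exact: lt_nbhsl.
  have := @derive_val _ _ _ _ _ _ _ d1; rewrite (@derive_val _ _ _ _ _ _ _ d2).
  by have := @bump_gt0 R (-1) 1 0; rewrite oppr_lt0 ltr01 => /(_ isT); rewrite -/b; lra.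
exists (T b / I) => phi tp.
pose c := ti (fun=> 1) phi / I.
have tcb : test_fun (fun t => - c * b t) by exact: testZ.
have t1 := testD tp tcb.
have [|psi tpsi dpsi] := test_antideriv t1.
  by rewrite tiD // tiZ // mulNr /c mulfVK // subrr.
have := Td _ tpsi; rewrite dpsi TD // TZ //; rewrite /c => h.
have -> : T phi = ti (fun=> 1) phi / I * T b by lra.
by rewrite mulrC mulrA [T b / I]mulrC mulrC mulrA.
Unshelve. all: by end_near. Qed.

Lemma cont_fundamental F : continuous F -> (forall phi, test_fun phi -> ti F phi = 0) ->
  forall t, F t = 0.
Proof.
have main G t : continuous G -> (forall phi, test_fun phi -> ti G phi = 0) -> ~ 0 < G t.
  move=> cG hG Gt.
  have := cG t => /cvgrPdist_lt/(_ _ Gt)[e /= e0 he].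
  pose b := bump (t - e) (t + e); have tb : test_fun b := test_bump _ _.
  have pos s : 0 <= b s * G s.
    have [hs|hs] := boolP (t - e < s < t + e); last by rewrite /b bump0 // mul0r.
    apply: mulr_ge0; first exact: bump_ge0.
    have /he : `|t - s| < e by rewrite ltr_norml; lra.
    by rewrite ltr_norml; lra.
  have cbG : continuous (fun s => b s * G s).
    by move=> s; apply: cvgM; [exact: test_cont tb s|exact: cG].
  have pb := prim_is_prim (Lone_cont cbG).
  have /testP[_ [M HM]] := tb.
  pose N := Num.max M (`|t| + 1).
  have h0 : iv (fun s => b s * G s) (- N) N = 0.
    by rewrite -(hG b tb) (@ti_iv _ _ N) // => s; rewrite gt_max => /andP[/HM].
  have tN : - N < t < N.
    by rewrite -ltr_norml /N lt_max ltrDl ltr01 orbT.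
  have hc s : - N <= s <= N -> prim (fun s => b s * G s) s = prim (fun s => b s * G s) (-N).
    move=> /andP[t1 t2]; apply/eqP; rewrite -subr_eq0 pb //.
    have := h0; rewrite (iv_split (Lone_cont cbG) t1 t2).
    have := @iv_ge0 _ _ (-N) s (fun s _ => pos s).
    have := @iv_ge0 _ _ s N (fun s _ => pos s).
    by move=> *; apply/eqP; lra.
  have d1 : is_derive t 1 (prim (fun s => b s * G s)) (b t * G t).
    by apply: prim_derive pb; [exact: Lone_cont|exact: cbG].
  have d2 : is_derive t 1 (prim (fun s => b s * G s)) 0.
    apply: (@near_eq_is_derive _ _ _ (cst (prim (fun s => b s * G s) (-N)))).
    near=> s; rewrite /= hc //; apply/andP; split; near: s.
      by apply: lt_le_nbhsr; case/andP: tN.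
    by near=> s; apply: ltW; near: s; apply: lt_nbhsl; case/andP: tN.
  have := @derive_val _ _ _ _ _ _ _ d1; rewrite (@derive_val _ _ _ _ _ _ _ d2).
  have b0 : 0 < b t by apply: bump_gt0; rewrite ltrBlDr ltrDl e0.
  by have := mulr_gt0 b0 Gt; lra.
move=> cF hF t; have /negP := main F t cF hF.
have /negP : ~ 0 < - F t.
  apply: (main (fun s => - F s)) => [s|phi tp]; first by apply: cvgN; exact: cF.
  have := tiZw (- 1) (Lone_cont cF) tp; rewrite hF // mulr0 => <-.
  by congr ti; apply/funext => s; rewrite mulN1r.
by rewrite -!leNgt; lra.
Unshelve. all: by end_near. Qed.

Lemma ti_dubois w : Lone w -> (forall phi, test_fun phi -> ti w (derive1 phi) = 0) ->
  continuous w -> forall t, w t = w 0.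
Proof.
move=> lw hw cw.
have [c hc] := test_dubois (fun _ _ => tiD lw) (fun c _ => tiZ c lw) hw.
have h : forall t, w t - c = 0.
  apply: cont_fundamental => [t|phi tp]; first by apply: cvgB; [exact: cw|exact: cvg_cst].
  have L1 : Lone (fun=> 1 : R) by apply: Lone_cont; exact: cst_continuous.
  have e := tiDw lw (LoneZ (- c) L1) tp.
  have -> : 0 = ti w phi + ti (fun=> - c * 1) phi by rewrite hc // (tiZw (- c) L1 tp); ring.
  by rewrite -e; congr ti; apply/funext => t; rewrite mulr1.
by move=> t; have := h t; have := h 0; lra.
Qed.

Lemma iv0_ae w : Lone w -> (forall a b, iv w a b = 0) -> {ae mu, forall t, w t = 0}.
Proof.
move=> [mw wi] hw.
have lw : locally_integrable setT w.
  split=> [||K _ cK]; [exact: mw|exact: openT|].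
  have [M [Mr HM]] := compact_bounded cK.
  have KM : K `<=` `[- (M + 1), M + 1].
    move=> x Kx; rewrite /= in_itv /= -ler_norml; apply: HM Kx.
    by rewrite ltrDl.
  have /integrableP[_] := wi (- (M + 1)) (M + 1).
  apply: le_lt_trans; apply: ge0_subset_integral => //.
  - exact: compact_measurable.
  - apply/measurable_EFinP; apply: measurableT_comp => //.
    exact: measurable_funS mw.
have := lebesgue_differentiation lw; apply: filterS.
  exact: (ae_filter_ringOfSetsType mu).
move=> t lt.
have := @FTC1_lebesgue_pt _ w (BLeft (t - 1)) t (t + 1) _ (wi _ _) _ lt.
rewrite ltrDl ltr01 lte_fin => /(_ isT) [|_ <-]; first by rewrite ltrBlDl ltrDr.
have -> : (fun y => Rintegral mu [set` Interval (BLeft (t - 1)) (BRight y)] w) = cst 0.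
  by apply/funext => y; exact: hw.
by rewrite derive1_cst.
Qed.

(** Integration by parts passes the hypothesis to the primitive, which is continuous and hence
    constant; so all integrals of [w] over intervals vanish. *)
Lemma ti0_ae w : Lone w -> (forall phi, test_fun phi -> ti w phi = 0) ->
  {ae mu, forall t, w t = 0}.
Proof.
move=> lw hw; apply: iv0_ae => // a b; have [ab|/iv_empty//] := leP a b.
have pw := prim_is_prim lw; have cw := prim_cont lw pw.
have h t : prim w t = prim w 0.
  apply: ti_dubois => //; first exact: Lone_cont.
  by move=> phi tp; rewrite (ti_ibp lw pw tp) hw ?oppr0.
by rewrite -pw // (h a) (h b) subrr.
Qed.

End Test.

(** * Behaviors as kernels of differential operators *)

Section Distr.
Variable R : realType.
Local Notation mu := (@lebesgue_measure R).
Implicit Types (phi psi : R -> R) (a b : {poly R}).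

Lemma L2locP k (f : R -> 'cV[R]_k) : L2loc f <-> forall i, Ltwo (fun t => f t i 0).
Proof.
split=> h i.
  have [mf fi] := h i; split => //; split; first exact: (measurable_funX 2 mf).
  move=> a b; apply/integrableP; split.
    apply/measurable_EFinP; apply: measurable_funS (measurable_funX 2 mf) => //.
  apply: le_lt_trans (fi a b); rewrite le_eqVlt; apply/orP; left; apply/eqP.
  by apply: eq_integral => t _; rewrite /= ger0_norm // sqr_ge0.
have [mf [_ fi]] := h i; split=> // a b.
have /integrableP[_] := fi a b; apply: le_lt_trans; rewrite le_eqVlt; apply/orP; left; apply/eqP.
by apply: eq_integral => t _; rewrite /= ger0_norm // sqr_ge0.
Qed.

(* The formal adjoint of [d/dt]. *)
Definition nder phi : R -> R := fun t => - derive1 phi t.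

Lemma test_nder phi : test_fun phi -> test_fun (nder phi).
Proof.
move=> /test_derive1 h; have := testZ (-1) h; congr test_fun.
by apply/funext => t; rewrite mulN1r.
Qed.

Lemma test_itern k phi : test_fun phi -> test_fun (iter k nder phi).
Proof. by move=> h; elim: k => //= k; apply: test_nder. Qed.

Lemma iter_nderE k phi : test_fun phi ->
  iter k nder phi = fun t => (-1) ^+ k * derive1n k phi t.
Proof.
move=> tp; elim: k => [|k IH] /=; first by apply/funext => t; rewrite mul1r.
rewrite IH; apply/funext => t; rewrite /nder derive1E.
have /testP[/smoothP sp _] := tp.
have h : is_derive t 1 (derive1n k phi) (derive1n k.+1 phi t).
  by apply: DeriveDef; [exact: sp|rewrite derive1nS derive1E].
have h2 : is_derive t 1 (fun t => (-1) ^+ k * derive1n k phi t) ((-1) ^+ k *: derive1n k.+1 phi t).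
  exact: is_deriveZ.
by rewrite (@derive_val _ _ _ _ _ _ _ h2) exprS mulN1r mulNr.
Qed.

Lemma nderD phi psi : test_fun phi -> test_fun psi ->
  nder (fun t => phi t + psi t) = fun t => nder phi t + nder psi t.
Proof.
move=> /testP[s1 _] /testP[s2 _]; apply/funext => t; rewrite /nder -opprD; congr (- _).
by rewrite derive1E; apply: derive_val; apply: is_deriveD; apply: smooth_is_derive.
Qed.

Lemma nderZ c phi : test_fun phi -> nder (fun t => c * phi t) = fun t => c * nder phi t.
Proof.
move=> /testP[s1 _]; apply/funext => t; rewrite /nder mulrN; congr (- _).
by rewrite derive1E; apply: derive_val; apply: is_deriveZ; apply: smooth_is_derive.
Qed.

Lemma iter_nderD k phi psi : test_fun phi -> test_fun psi ->
  iter k nder (fun t => phi t + psi t) = fun t => iter k nder phi t + iter k nder psi t.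
Proof. by move=> h1 h2; elim: k => //= k ->; apply: nderD; exact: test_itern. Qed.

Lemma iter_nderZ k c phi : test_fun phi ->
  iter k nder (fun t => c * phi t) = fun t => c * iter k nder phi t.
Proof. by move=> h1; elim: k => //= k ->; apply: nderZ; exact: test_itern. Qed.

(** The linear functional on polynomials with moments [s], sending ['X^k] to [s k]. Multiplication
    by ['X] shifts the moments, which for distributions means passing from [phi] to [nder phi]. *)
Definition lam1 (s : nat -> R) (a : {poly R}) := \sum_(k < size a) a`_k * s k.

Lemma lam1_bound s a N : (size a <= N)%N -> lam1 s a = \sum_(k < N) a`_k * s k.
Proof.
move=> h; rewrite /lam1 (big_ord_widen _ (fun k => a`_k * s k) h) big_mkcond /=.
by apply: eq_bigr => k _; case: ltnP => // h'; rewrite nth_default // mul0r.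
Qed.

Lemma lam1D s a b : lam1 s (a + b) = lam1 s a + lam1 s b.
Proof.
pose N := maxn (size a) (size b).
rewrite (@lam1_bound _ (a + b) N) ?size_polyD // (@lam1_bound _ a N) ?leq_maxl //.
rewrite (@lam1_bound _ b N) ?leq_maxr // -big_split /=.
by apply: eq_bigr => k _; rewrite coefD mulrDl.
Qed.

Lemma lam1C s c : lam1 s c%:P = c * s 0%N.
Proof. by rewrite (@lam1_bound _ _ 1) ?size_polyC ?leq_b1 // big_ord1 coefC. Qed.

Lemma lam1MC s c a : lam1 s (c%:P * a) = c * lam1 s a.
Proof.
rewrite (@lam1_bound _ _ (size a)); last first.
  by rewrite mul_polyC; exact: size_scale_leq.
by rewrite mulr_sumr; apply: eq_bigr => k _; rewrite coefCM mulrA.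
Qed.

Lemma lam1MX s a : lam1 s (a * 'X) = lam1 (fun k => s k.+1) a.
Proof.
rewrite (@lam1_bound _ _ (size a).+1) ?size_polyMleq ?(leq_trans (size_polyMleq _ _)) //.
  by rewrite big_ord_recl coefMX mul0r add0r; apply: eq_bigr => k _; rewrite coefMX.
by rewrite size_polyX addnC.
Qed.

Definition lam q (s : nat -> 'I_q -> R) (p : 'rV[{poly R}]_q) := \sum_j lam1 (s^~ j) (p 0 j).

Lemma lamD q (s : nat -> 'I_q -> R) p p' : lam s (p + p') = lam s p + lam s p'.
Proof. by rewrite /lam -big_split; apply: eq_bigr => j _; rewrite mxE lam1D. Qed.
Lemma lam0 q (s : nat -> 'I_q -> R) : lam s 0 = 0.
Proof. by rewrite /lam big1 // => j _; rewrite mxE -polyC0 lam1C mul0r. Qed.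
Lemma lam_sum q (s : nat -> 'I_q -> R) (I : finType) (p : I -> 'rV_q) :
  lam s (\sum_i p i) = \sum_i lam s (p i).
Proof. by apply: (big_morph (lam s)) => [x y|]; [exact: lamD|exact: lam0]. Qed.
Lemma lamC q (s : nat -> 'I_q -> R) c p : lam s (c%:P *: p) = c * lam s p.
Proof. by rewrite /lam mulr_sumr; apply: eq_bigr => j _; rewrite mxE lam1MC. Qed.
Lemma lamN q (s : nat -> 'I_q -> R) p : lam s (- p) = - lam s p.
Proof. by rewrite -scaleN1r -polyC1 -polyCN lamC mulN1r. Qed.
Lemma lamB q (s : nat -> 'I_q -> R) p p' : lam s (p - p') = lam s p - lam s p'.
Proof. by rewrite lamD lamN. Qed.
Lemma lamX q (s : nat -> 'I_q -> R) p : lam s ('X *: p) = lam (fun k => s k.+1) p.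
Proof. by rewrite /lam; apply: eq_bigr => j _; rewrite mxE mulrC lam1MX. Qed.

(** Multiplying a row by ['X] replaces the index [i] by [S i]; hence the hypothesis ranges over all
    indices, and [i] varies in the induction on the polynomial coefficients. *)
Lemma lam_rows (I : Type) (S : I -> I) q r m (s : I -> nat -> 'I_q -> R) (s' : I -> nat -> 'I_r -> R)
    (P : 'M[{poly R}]_(m, q)) (Q : 'M[{poly R}]_(m, r)) :
  (forall i k, s i k.+1 = s (S i) k) -> (forall i k, s' i k.+1 = s' (S i) k) ->
  (forall i j, lam (s i) (row j P) = lam (s' i) (row j Q)) ->
  forall i (p : 'rV_m), lam (s i) (p *m P) = lam (s' i) (p *m Q).
Proof.
move=> hs hs' h i p; rewrite !mulmx_sum_row !lam_sum; apply: eq_bigr => j _.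
elim/poly_ind: (p 0 j) i => [|a c IH] i; first by rewrite !scale0r !lam0.
rewrite !scalerDl !lamD !lamC h; congr (_ + _).
rewrite mulrC -!scalerA !lamX.
have -> : (fun k => s i k.+1) = s (S i) by apply/funext => k; exact: hs.
have -> : (fun k => s' i k.+1) = s' (S i) by apply/funext => k; exact: hs'.
exact: IH.
Qed.

(* [Lam w phi p] pairs the distribution [p(d/dt) w] with [phi]. *)
Definition Lam q (w : R -> 'cV[R]_q) phi (p : 'rV[{poly R}]_q) : R :=
  lam (fun k j => ti (fun t => w t j 0) (iter k nder phi)) p.

Lemma Lam_cP q (w : R -> 'cV[R]_q) phi (p : 'rV[R]_q) :
  Lam w phi (cP p) = \sum_j p 0 j * ti (fun t => w t j 0) phi.
Proof. by apply: eq_bigr => j _; rewrite mxE lam1C. Qed.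

Lemma Lam_shift q (w : R -> 'cV[R]_q) phi p : Lam w phi ('X *: p) = Lam w (nder phi) p.
Proof.
rewrite /Lam lamX; congr lam; apply/funext => k; apply/funext => j.
by rewrite iterSr.
Qed.

Lemma LamDphi q (w : R -> 'cV[R]_q) phi psi p : L2loc w -> test_fun phi -> test_fun psi ->
  Lam w (fun t => phi t + psi t) p = Lam w phi p + Lam w psi p.
Proof.
move=> /L2locP lw h1 h2; rewrite /Lam /lam -big_split; apply: eq_bigr => j _.
rewrite /lam1 -big_split; apply: eq_bigr => k _ /=.
rewrite iter_nderD // (tiD (Ltwo_Lone (lw j)) (test_itern k h1) (test_itern k h2)); ring.
Qed.

Lemma LamZphi q (w : R -> 'cV[R]_q) c phi p : L2loc w -> test_fun phi ->
  Lam w (fun t => c * phi t) p = c * Lam w phi p.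
Proof.
move=> /L2locP lw h1; rewrite /Lam /lam mulr_sumr; apply: eq_bigr => j _.
rewrite /lam1 mulr_sumr; apply: eq_bigr => k _ /=.
rewrite iter_nderZ // (tiZ c (Ltwo_Lone (lw j)) (test_itern k h1)); ring.
Qed.

Lemma Lone_mulmx p q (M : 'M[R]_(p, q)) (w : R -> 'cV[R]_q) i :
  (forall j, Lone (fun t => w t j 0)) -> Lone (fun t => (M *m w t) i 0).
Proof.
move=> lw; have := Lone_sum (fun j => LoneZ (M i j) (lw j)).
by congr Lone; apply/funext => t; rewrite mxE.
Qed.

Lemma ti_mulmx p q (M : 'M[R]_(p, q)) (w : R -> 'cV[R]_q) i phi :
  (forall j, Lone (fun t => w t j 0)) -> test_fun phi ->
  ti (fun t => (M *m w t) i 0) phi = \sum_j M i j * ti (fun t => w t j 0) phi.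
Proof.
move=> lw tp; have /testP[_ [T HT]] := tp.
rewrite (ti_iv _ HT).
rewrite (@iv_eq _ _ (fun t => \sum_j phi t * (M i j * w t j 0))); last first.
  by move=> t _; rewrite mxE mulr_sumr.
rewrite iv_sum; last by move=> j; apply: ti_Lone => //; exact: LoneZ.
by apply: eq_bigr => j _; rewrite -(ti_iv _ HT) tiZw.
Qed.

Lemma dpairE p q (P : 'M[{poly R}]_(p, q)) (w : R -> 'cV[R]_q) i phi :
  L2loc w -> test_fun phi -> Defs.dpair P w i phi = Lam w phi (row i P).
Proof.
move=> /L2locP lw tp; rewrite /Defs.dpair /Lam /lam.
have bound j : (size (row i P 0%R j) <= degbound P)%N.
  rewrite mxE /degbound.
  apply: (@leq_trans (\max_(j < q) size (P i j))%N).
    exact: (@leq_bigmax _ (fun j => size (P i j)) j).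
  exact: (@leq_bigmax _ (fun i => \max_(j < q) size (P i j))%N i).
under [RHS]eq_bigr => j _ do rewrite (lam1_bound _ (bound j)).
rewrite exchange_big; apply: eq_bigr => k _ /=.
have tk := test_itern k tp; have l1 j := Ltwo_Lone (lw j).
rewrite -[Rintegral _ _ _]/(ti (fun t => (coefmx P k *m w t) i 0) (derive1n k phi)).
have lP : Lone (fun t => (coefmx P k *m w t) i 0) by apply: Lone_mulmx.
have -> : (-1) ^+ k * ti (fun t => (coefmx P k *m w t) i 0) (derive1n k phi) =
   ti (fun t => (coefmx P k *m w t) i 0) (iter k nder phi).
  rewrite -tiZ ?iter_nderE //.
  have := testZ ((-1) ^+ k) tk; congr test_fun; apply/funext => t.
  by rewrite iter_nderE // mulrA -expr2 sqrr_sign mul1r.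
by rewrite ti_mulmx //; apply: eq_bigr => j _; rewrite !mxE.
Qed.

Lemma Lam_rows n m p (P : 'M[{poly R}]_(p, n)) (Q : 'M[{poly R}]_(p, m)) u y :
  (forall phi j, test_fun phi -> Lam u phi (row j P) = Lam y phi (row j Q)) ->
  forall phi v, test_fun phi -> Lam u phi (v *m P) = Lam y phi (v *m Q).
Proof.
move=> h phi v tp.
pose s q (w : R -> 'cV[R]_q) (f : {f : R -> R | test_fun f}) k j :=
  ti (fun t => w t j 0) (iter k nder (sval f)).
pose S (f : {f : R -> R | test_fun f}) : {f : R -> R | test_fun f} :=
  exist _ _ (test_nder (svalP f)).
apply: (@lam_rows _ S _ _ _ (s _ u) (s _ y) _ _ _ _ _ (exist _ phi tp)).
- by move=> f k; apply/funext => j; rewrite /s iterSr.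
- by move=> f k; apply/funext => j; rewrite /s iterSr.
- by move=> [f tf] i; exact: h.
Qed.

Lemma kernel_eqP p n m (P : 'M[{poly R}]_(p, n)) (Q : 'M[{poly R}]_(p, m)) u y :
  L2loc u -> L2loc y ->
  (kernel_eq P Q u y <-> forall phi v, test_fun phi -> Lam u phi (v *m P) = Lam y phi (v *m Q)).
Proof.
move=> lu ly; split=> [h|h i phi tp]; last by rewrite !dpairE // !rowE; exact: h.
by apply: Lam_rows => phi i tp; rewrite -!dpairE //; exact: h.
Qed.

End Distr.

(** * The state equation in the sense of distributions *)

Section Kernel.
Variable R : realType.
Local Notation mu := (@lebesgue_measure R).
Implicit Types phi psi : R -> R.

Lemma eq_cont (f g : R -> R) : (forall t, f t = g t) -> continuous f -> continuous g.
Proof. by move=> /funext ->. Qed.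

Lemma L2loc_Lone q (w : R -> 'cV[R]_q) : L2loc w -> forall j, Lone (fun t => w t j 0).
Proof. by move=> /L2locP lw j; exact: Ltwo_Lone. Qed.

Lemma L2loc_cont q (w : R -> 'cV[R]_q) : (forall j, continuous (fun t => w t j 0)) -> L2loc w.
Proof. by move=> cw; apply/L2locP => j; exact: Ltwo_cont. Qed.

Lemma L2locD q (v w : R -> 'cV[R]_q) : L2loc v -> L2loc w -> L2loc (fun t => v t + w t).
Proof.
move=> /L2locP lv /L2locP lw; apply/L2locP => j.
by have := LtwoD (lv j) (lw j); congr Ltwo; apply/funext => t; rewrite mxE.
Qed.

Lemma L2locM p q (M : 'M[R]_(p, q)) (w : R -> 'cV[R]_q) : L2loc w -> L2loc (fun t => M *m w t).
Proof.
move=> /L2locP lw; apply/L2locP => i.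
have := Ltwo_sum (fun j => LtwoZ (M i j) (lw j)).
by congr Ltwo; apply/funext => t; rewrite mxE.
Qed.

Lemma L2loc0 q : L2loc (fun=> 0 : 'cV[R]_q).
Proof. by apply: L2loc_cont => j; exact: cst_continuous. Qed.

Lemma L2locZ q (c : R) (w : R -> 'cV[R]_q) : L2loc w -> L2loc (fun t => c *: w t).
Proof.
move=> /L2locP lw; apply/L2locP => i.
by have := LtwoZ c (lw i); congr Ltwo; apply/funext => t; rewrite mxE.
Qed.

Lemma LamM p q (M : 'M[R]_(p, q)) (w : R -> 'cV[R]_q) phi v : L2loc w -> test_fun phi ->
  Lam (fun t => M *m w t) phi v = Lam w phi (v *m cP M).
Proof.
move=> lw tp; rewrite -[in LHS](mulmx1 v); move: phi v tp; apply: Lam_rows => phi j tp.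
rewrite -cP1 -[row j (cP 1%:M)]/(row j (map_mx _ _)) -map_row -/(cP _) Lam_cP.
rewrite -[row j (cP M)]/(row j (map_mx _ _)) -map_row -/(cP _) Lam_cP.
rewrite (bigD1 j) //= big1 => [|i ij]; last by rewrite !mxE eq_sym (negbTE ij) mul0r.
rewrite !mxE eqxx mul1r addr0 ti_mulmx //; last exact: L2loc_Lone.
by apply: eq_bigr => i _; rewrite mxE.
Qed.

Lemma Lam_add q (w w' : R -> 'cV[R]_q) phi v : L2loc w -> L2loc w' -> test_fun phi ->
  Lam (fun t => w t + w' t) phi v = Lam w phi v + Lam w' phi v.
Proof.
move=> lw lw' tp; rewrite /Lam /lam -big_split; apply: eq_bigr => j _.
rewrite /lam1 -big_split; apply: eq_bigr => k _ /=.
rewrite -mulrDr; congr (_ * _); rewrite -tiDw; [|exact: L2loc_Lone..|exact: test_itern].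
by congr ti; apply/funext => t; rewrite mxE.
Qed.

Lemma Lam_ae q (w w' : R -> 'cV[R]_q) phi v : L2loc w -> L2loc w' -> test_fun phi ->
  {ae mu, forall t, w t = w' t} -> Lam w phi v = Lam w' phi v.
Proof.
move=> lw lw' tp e; rewrite /Lam /lam; apply: eq_bigr => j _.
rewrite /lam1; apply: eq_bigr => k _ /=; congr (_ * _).
apply: ti_ae; [exact: L2loc_Lone..|exact: test_itern|].
by move: e; apply: filterS; [exact: (ae_filter_ringOfSetsType mu)|move=> t /= ->].
Qed.

Definition is_sol d n (A : 'M[R]_d) (B : 'M[R]_(d, n))
    (u : R -> 'cV[R]_n) (x : R -> 'cV[R]_d) :=
  forall i, is_prim (fun t => (A *m x t + B *m u t) i 0) (fun t => x t i 0).

Section Fixed.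
Variables (d n m : nat) (A : 'M[R]_d) (B : 'M[R]_(d, n)) (Cm : 'M[R]_(m, d)) (D : 'M[R]_(m, n)).

Lemma L2loc_rhs u x : L2loc u -> L2loc x -> L2loc (fun t => A *m x t + B *m u t).
Proof. by move=> lu lx; apply: L2locD; exact: L2locM. Qed.

Lemma sol_cont u x : L2loc u -> L2loc x -> is_sol A B u x -> forall j, continuous (fun t => x t j 0).
Proof. by move=> lu lx sx j; apply: prim_cont (sx j); exact: L2loc_Lone (L2loc_rhs lu lx) j. Qed.

Lemma row_cP p q (M : 'M[R]_(p, q)) j : row j (cP M) = cP (row j M).
Proof. by rewrite /cP map_row. Qed.

Lemma Lam_delta q (w : R -> 'cV[R]_q) phi j :
  Lam w phi (cP (row j 1%:M)) = ti (fun t => w t j 0) phi.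
Proof.
rewrite Lam_cP (bigD1 j) //= big1 => [|i ij]; last by rewrite !mxE eq_sym (negbTE ij) mul0r.
by rewrite !mxE eqxx mul1r addr0.
Qed.

Lemma Lam_sol u x phi v : L2loc u -> L2loc x -> is_sol A B u x -> test_fun phi ->
  Lam x phi (v *m char_poly_mx A) = Lam u phi (v *m cP B).
Proof.
move=> lu lx sx tp; move: phi v tp; apply: Lam_rows => phi j tp.
have -> : row j (char_poly_mx A) = 'X *: cP (row j 1%:M) - cP (row j A).
  by apply/rowP => k; rewrite !mxE; case: (j == k); rewrite ?(mulr1n, mulr0n, polyC1, polyC0, mulr1, mulr0).
rewrite /Lam lamB -!/(Lam _ _ _) Lam_shift Lam_delta row_cP.
apply/eqP; rewrite subr_eq; apply/eqP.
have -> : ti (fun t => x t j 0) (nder phi) = - ti (fun t => x t j 0) (derive1 phi).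
  rewrite -mulN1r -tiZ; [|exact: L2loc_Lone|exact: test_derive1].
  by congr ti; apply/funext => t; rewrite mulN1r.
rewrite (ti_ibp _ (sx j)) ?opprK //; last exact: L2loc_Lone (L2loc_rhs lu lx) j.
have -> : ti (fun t => (A *m x t + B *m u t) j 0) phi =
   ti (fun t => (A *m x t) j 0) phi + ti (fun t => (B *m u t) j 0) phi.
  rewrite -tiDw //; [|exact: L2loc_Lone (L2locM A lx) j|exact: L2loc_Lone (L2locM B lu) j].
  by congr ti; apply/funext => t; rewrite mxE.
rewrite !ti_mulmx //; [|exact: L2loc_Lone..].
rewrite !Lam_cP addrC; congr (_ + _); by apply: eq_bigr => k _; rewrite mxE.
Qed.

(** Variation of constants: exp(tA) times the primitive of exp(-tA) B u, by the product rule for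
    primitives. *)
Lemma sol_exists u : L2loc u -> exists2 x, L2loc x & is_sol A B u x.
Proof.
move=> lu; pose f t := B *m u t; have lf : L2loc f by exact: L2locM.
pose g j t := (mexp A (- t) *m f t) j 0.
have sm i j : smooth (fun t => mexp A t i j).
  have := smooth_mexp A 1%:M 1%:M i j; congr smooth.
  by apply/funext => t; rewrite mul1mx mulmx1.
have smN i j : smooth (fun t => mexp A (- t) i j).
  have := smooth_aff (-1) 0 (sm i j); congr smooth.
  by apply/funext => t; rewrite mulN1r addr0.
have lg j : Lone (g j).
  have := Lone_sum (fun k => LoneMc (L2loc_Lone lf k) (smooth_cont (smN j k))).
  by congr Lone; apply/funext => t; rewrite /g mxE; apply: eq_bigr => k _; rewrite mulrC.
pose G t : 'cV[R]_d := \col_j prim (g j) t.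
have pG j := prim_is_prim (lg j).
pose x t := mexp A t *m G t.
have sx : is_sol A B u x.
  move=> i a b ab.
  have dm j : is_prim (fun t => (A *m mexp A t) i j) (fun t => mexp A t i j).
    apply: derive_prim => [|t].
      by apply: eq_cont (smooth_cont (smooth_mexp A A 1%:M i j)) => t; rewrite mulmx1.
    have := mexp_is_derive A 1%:M 1%:M i j t; rewrite mul1mx mulmx1.
    by under eq_fun => s do rewrite mul1mx mulmx1.
  have lm j : Lone (fun t => (A *m mexp A t) i j).
    by apply/Lone_cont/(eq_cont _ (smooth_cont (smooth_mexp A A 1%:M i j))) => t; rewrite mulmx1.
  have h j := is_primM (lm j) (lg j) (dm j) (pG j) ab.
  rewrite !mxE -sumrB.
  under eq_bigr => j _ do rewrite [G b j 0]mxE [G a j 0]mxE h.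
  rewrite -iv_sum; last first.
    move=> j; apply: LoneD; first by apply: LoneMc => //; exact: prim_cont (pG j).
    have := LoneMc (lg j) (smooth_cont (sm i j)); congr Lone.
    by apply/funext => t; rewrite mulrC.
  apply: iv_eq => t _; rewrite big_split /= /x mulmxA mxE; congr (_ + _).
    by rewrite [RHS]mxE; apply: eq_bigr => j _; rewrite [G t j 0]mxE.
  have -> : B *m u t = mexp A t *m (mexp A (- t) *m f t).
    by rewrite mulmxA mexpKN mul1mx.
  by rewrite [RHS]mxE.
exists x => //; apply: L2loc_cont => j.
have : continuous (fun t => \sum_k mexp A t j k * prim (g k) t).
  have -> : (fun t => \sum_k mexp A t j k * prim (g k) t) = \sum_k (fun t => mexp A t j k * prim (g k) t).
    by apply/funext => t; rewrite fct_sumE.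
  apply: (big_ind (fun f : R -> R => continuous f)) => [|v w cv cw|k _].
  - exact: cst_continuous.
  - by move=> t; apply: cvgD; [exact: cv|exact: cw].
  - by move=> t; apply: cvgM; [exact: (smooth_cont (sm j k))|exact: (prim_cont (lg k) (pG k))].
by apply: eq_cont => t; rewrite /x mxE; apply: eq_bigr => k _; rewrite [G t k 0]mxE.
Qed.

Lemma mexp_entry_derive p (z : 'M[R]_(d, p)) i j (t : R) :
  is_derive t 1 (fun s => (mexp A s *m z) i j) ((A *m mexp A t *m z) i j).
Proof.
have := mexp_is_derive A 1%:M z i j t; rewrite mul1mx.
by under eq_fun => s do rewrite mul1mx.
Qed.

Lemma mexp_entry_cont p q (L : 'M[R]_(p, d)) (z : 'M[R]_(d, q)) i j : continuous (fun s => (L *m mexp A s *m z) i j).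
Proof. exact: smooth_cont (smooth_mexp A L z i j). Qed.

Lemma free_sol z : is_sol A B (fun=> 0) (fun t => mexp A t *m z).
Proof.
move=> i; have h : is_prim (fun t => (A *m mexp A t *m z) i 0) (fun t => (mexp A t *m z) i 0).
  apply: derive_prim => [|t]; [exact: mexp_entry_cont|exact: mexp_entry_derive].
by move=> a b ab; rewrite h //; apply: iv_eq => t _; rewrite mulmx0 addr0 mulmxA.
Qed.

Lemma free_L2loc (z : 'cV[R]_d) : L2loc (fun t => mexp A t *m z).
Proof.
by apply: L2loc_cont => i; have := @mexp_entry_cont d 1 1%:M z i 0; apply: eq_cont => t; rewrite mul1mx.
Qed.

Lemma solD u u' x x' : L2loc u -> L2loc x -> L2loc u' -> L2loc x' ->
  is_sol A B u x -> is_sol A B u' x' -> is_sol A B (fun t => u t + u' t) (fun t => x t + x' t).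
Proof.
move=> lu lx lu' lx' sx sx' i a b ab.
rewrite [X in X - _]mxE [X in _ - X]mxE opprD addrACA (sx i a b ab) (sx' i a b ab) -ivD.
- by apply: iv_eq => t _; rewrite !mulmxDr addrACA [RHS]mxE.
- exact: L2loc_Lone (L2loc_rhs lu lx) i.
- exact: L2loc_Lone (L2loc_rhs lu' lx') i.
Qed.

Lemma solZ (c : R) u x : L2loc u -> L2loc x ->
  is_sol A B u x -> is_sol A B (fun t => c *: u t) (fun t => c *: x t).
Proof.
move=> lu lx sx i a b ab.
rewrite [X in X - _]mxE [X in _ - X]mxE -mulrBr (sx i a b ab) -ivZ.
  by apply: iv_eq => t _; rewrite -!scalemxAr -scalerDr [RHS]mxE.
exact: L2loc_Lone (L2loc_rhs lu lx) i.
Qed.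

(* Variation of constants: [exp(- t A) T] has zero derivative, hence is constant
   by [test_dubois]. *)
Lemma ode_functional (T : (R -> R) -> 'I_d -> R) :
  (forall phi psi i, test_fun phi -> test_fun psi ->
     T (fun t => phi t + psi t) i = T phi i + T psi i) ->
  (forall c phi i, test_fun phi -> T (fun t => c * phi t) i = c * T phi i) ->
  (forall phi i, test_fun phi -> T (nder phi) i = \sum_j A i j * T phi j) ->
  exists c : 'cV[R]_d, forall phi i, test_fun phi -> T phi i = ti (fun t => (mexp A t *m c) i 0) phi.
Proof.
move=> TD TZ TA.
have T0 i : T (fun=> 0) i = 0.
  by have := TZ 0 (fun=> 0) i (@test0 R); rewrite mul0r [0 * T _ _]mul0r.
have Tsum (I : finType) (f : I -> R -> R) i : (forall k, test_fun (f k)) ->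
    T (fun t => \sum_k f k t) i = \sum_k T (f k) i.
  move=> tf; have -> : (fun t => \sum_k f k t) = \sum_k f k by apply/funext => t; rewrite fct_sumE.
  suff [] : test_fun (\sum_k f k) /\ T (\sum_k f k) i = \sum_k T (f k) i by [].
  apply: (big_ind2 (fun u x => test_fun u /\ T u i = x)) => [|u x v y [hu <-] [hv <-]|k _].
  - by split; [exact: test0|exact: T0].
  - by split; [exact: testD|exact: TD].
  - by [].
have sm i j : smooth (fun t => mexp A t i j).
  have := smooth_mexp A 1%:M 1%:M i j; congr smooth.
  by apply/funext => t; rewrite mul1mx mulmx1.
have smN i j : smooth (fun t => mexp A (- t) i j).
  have := smooth_aff (-1) 0 (sm i j); congr smooth.
  by apply/funext => t; rewrite mulN1r addr0.
pose e i j t := mexp A (- t) i j.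
pose W i phi := \sum_j T (fun t => e i j t * phi t) j.
have te i j phi : test_fun phi -> test_fun (fun t => e i j t * phi t).
  by move=> tp; apply: testMs tp; exact: smN.
have WD i phi psi : test_fun phi -> test_fun psi -> W i (fun t => phi t + psi t) = W i phi + W i psi.
  move=> tp ts; rewrite /W -big_split; apply: eq_bigr => j _ /=.
  by rewrite -TD; [congr T; apply/funext => t; rewrite mulrDr|exact: te..].
have WZ i c phi : test_fun phi -> W i (fun t => c * phi t) = c * W i phi.
  move=> tp; rewrite /W mulr_sumr; apply: eq_bigr => j _ /=.
  by rewrite -TZ; [congr T; apply/funext => t; rewrite mulrCA|exact: te].
have Wd i phi : test_fun phi -> W i (derive1 phi) = 0.
  move=> tp.
  have ed j (t : R) : is_derive t 1 (e i j) (- \sum_k e i k t * A k j).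
    have h : is_derive (- t) 1 (fun s => mexp A s i j) ((mexp A (- t) *m A) i j).
      have := mexp_is_derive A 1%:M 1%:M i j (- t); rewrite mul1mx mulmx1 mexp_comm.
      by under eq_fun => s do rewrite mul1mx mulmx1.
    have hN : is_derive t 1 (fun s : R => - s) (-1) by apply: is_deriveN.
    apply: (@is_derive_eq _ _ _ _ _ _ _ _ (is_derive1_comp h hN)).
    by rewrite mulrN1 mxE.
  have h j : T (fun t => e i j t * derive1 phi t) j =
      - (\sum_k A j k * T (fun t => e i j t * phi t) k)
      + \sum_k A k j * T (fun t => e i k t * phi t) j.
    have ->: (fun t => e i j t * derive1 phi t) =
        (fun t => (-1) * nder (fun t => e i j t * phi t) t
               + \sum_k A k j * (e i k t * phi t)).
      apply/funext => t; rewrite mulN1r opprK.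
      have dp := smooth_is_derive ((testP phi).1 tp).1 t.
      have -> : derive1 (fun t => e i j t * phi t) t =
          e i j t * derive1 phi t + phi t * (- \sum_k e i k t * A k j).
        by rewrite derive1E; apply: derive_val; apply: is_deriveM.
      rewrite mulrN mulr_sumr -addrA -sumrN -big_split /= big1 ?addr0 //.
      by move=> k _; ring.
    have tn := test_nder (te i j _ tp).
    rewrite TD; [|exact: testZ|by apply: test_sum => k; apply: testZ; exact: te].
    rewrite TZ // TA ?mulN1r; last exact: te.
    rewrite Tsum; last by move=> k; apply: testZ; exact: te.
    by congr (_ + _); apply: eq_bigr => k _; rewrite TZ //; exact: te.
  rewrite /W (eq_bigr _ (fun j _ => h j)) big_split /= sumrN.
  by rewrite [X in _ + X]exchange_big /= addNr.
have hc i := test_dubois (WD i) (WZ i) (Wd i).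
have [c hcc] := choice hc.
exists (\col_i c i) => phi j tp.
have tf a b : test_fun (fun t => mexp A t a b * phi t) by apply: testMs tp; exact: sm.
have L1 : Lone (fun=> 1 : R) by apply: Lone_cont; exact: cst_continuous.
(* Since exp(tA) exp(-tA) = 1, the functionals [W] at the entries of exp(tA) times [phi] recover
   [T]. *)
transitivity (\sum_i W i (fun t => mexp A t j i * phi t)).
  rewrite /W exchange_big /=.
  transitivity (\sum_l T (fun t => (1%:M : 'M[R]_d) j l * phi t) l).
    rewrite (bigD1 j) //= big1 => [|l lj]; rewrite TZ // mxE ?eqxx ?mul1r ?addr0 //.
    by rewrite eq_sym (negbTE lj) mul0r.
  apply: eq_bigr => l _; rewrite -Tsum; last by move=> k; exact: te.
  congr T; apply/funext => t; rewrite -(mexpKN A t) mxE mulr_suml.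
  by apply: eq_bigr => k _; rewrite /e; ring.
have lm i : Lone (fun t => mexp A t j i) by apply: Lone_cont; exact: smooth_cont.
have /testP[_ [M HM]] := tp.
rewrite (ti_iv _ HM) (@iv_eq _ _ (fun t => \sum_i c i * (phi t * mexp A t j i))); last first.
  by move=> t _; rewrite mxE mulr_sumr; apply: eq_bigr => i _; rewrite mxE; ring.
rewrite iv_sum; last by move=> i; apply: LoneZ; exact: ti_Lone.
apply: eq_bigr => i _; rewrite (hcc i _ (tf j i)).
rewrite ivZ; last exact: ti_Lone.
rewrite -(ti_iv _ HM); congr (_ * _).
by congr (Rintegral _ _ _); apply/funext => t; ring.
Qed.

End Fixed.
End Kernel.

(** * External behavior and kernel of the representation *)

Section Behavior.
Variable R : realType.
Local Notation mu := (@lebesgue_measure R).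
Variables (d n m : nat) (A : 'M[R]_d) (B : 'M[R]_(d, n)) (Cm : 'M[R]_(m, d)) (D : 'M[R]_(m, n)).

Lemma BsP u y x : Bs A B Cm D u y x <->
  [/\ L2loc u, L2loc y, L2loc x, is_sol A B u x & {ae mu, forall t, y t = Cm *m x t + D *m u t}].
Proof.
split=> -[lu ly lx sx e]; split=> //.
  by move=> i a b ab; exact: sx.
by move=> a b ab i; exact: sx.
Qed.

Lemma Lam_mulB (q : nat) (w : R -> 'cV[R]_q) phi v v' : Lam w phi (v - v') = Lam w phi v - Lam w phi v'.
Proof. exact: lamB. Qed.
Lemma Lam_mulD (q : nat) (w : R -> 'cV[R]_q) phi v v' : Lam w phi (v + v') = Lam w phi v + Lam w phi v'.
Proof. exact: lamD. Qed.
Lemma Lam_mulN (q : nat) (w : R -> 'cV[R]_q) phi v : Lam w phi (- v) = - Lam w phi v.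
Proof. exact: lamN. Qed.
Lemma Lam_mulC (q : nat) (w : R -> 'cV[R]_q) phi c v : Lam w phi (c%:P *: v) = c * Lam w phi v.
Proof. exact: lamC. Qed.
Lemma Lam_sum (q : nat) (w : R -> 'cV[R]_q) phi (I : finType) (v : I -> 'rV_q) :
  Lam w phi (\sum_i v i) = \sum_i Lam w phi (v i).
Proof. exact: lam_sum. Qed.

Lemma cP_row_sum p q (N : 'M[R]_(p, q)) i :
  cP (row i N) = \sum_j (N i j)%:P *: cP (row j (1%:M : 'M[R]_q)).
Proof.
rewrite -[LHS]mulmx1 mulmx_sum_row; apply: eq_bigr => j _.
by rewrite -(row_cP (1%:M : 'M[R]_q)) cP1 !mxE.
Qed.

Section Rep.
Variables (Pi : 'M[R]_d) (Hs : 'M[{poly R}]_(d, m)) (M : 'M[{poly R}]_d).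
Variables (Q : 'M[{poly R}]_m) (E : 'M[{poly R}]_(m, d)) (S1 : 'M[{poly R}]_(d, m)) (S2 : 'M[{poly R}]_m).
Hypothesis ob : observer A Cm Pi Hs M.
Hypothesis kr : kernel_rep A Cm Pi Hs M Q E S1 S2.
Let P := E *m cP B + Q *m cP D.

Lemma behavior_sub_kernel u y x : Bs A B Cm D u y x -> kernel_eq P Q u y.
Proof.
move=> /BsP[lu ly lx sx e]; apply/kernel_eqP => // phi v tp.
have lCx := L2locM Cm lx; have lDu := L2locM D lu.
rewrite (Lam_ae _ ly (L2locD lCx lDu) tp e) Lam_add // !LamM //.
have -> : v *m Q *m cP Cm = v *m E *m char_poly_mx A by rewrite -!mulmxA -(kr_syz kr).
by rewrite (Lam_sol _ lu lx sx tp) -Lam_mulD /P mulmxDr !mulmxA.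
Qed.

(* The distribution [Hs (y - D u) - M B u] is the state projected along the
   unobservable subspace; it differs from the projection of any solution [x] of
   [x' = A x + B u] by a solution of [z' = Pi A z], which is an exponential. *)
Lemma kernel_sub_behavior u y : L2loc u -> L2loc y -> kernel_eq P Q u y -> Bs_ext A B Cm D u y.
Proof.
move=> lu ly /(kernel_eqP _ _ lu ly) ke.
have [x lx sx] := sol_exists A B lu.
pose yt t := y t + (- D) *m u t.
have lyt : L2loc yt by apply: L2locD => //; exact: L2locM.
have LytE phi v : test_fun phi -> Lam yt phi v = Lam y phi v - Lam u phi (v *m cP D).
  move=> tp; rewrite Lam_add //; last exact: L2locM.
  by rewrite LamM // cPN mulmxN Lam_mulN.
(* [Lo] pairs with test functions the observed state o. The facts [oA], [oC] and [oPi] say that Pi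
   (o' - A o - B u) = 0, C o = y - D u and Pi o = o. *)
pose Lo phi r := Lam yt phi (r *m Hs) - Lam u phi (r *m M *m cP B).
have LoD phi r r' : Lo phi (r + r') = Lo phi r + Lo phi r'.
  by rewrite /Lo !mulmxDl !Lam_mulD; ring.
have yQ phi v : test_fun phi -> Lam yt phi (v *m Q) = Lam u phi (v *m E *m cP B).
  move=> tp; rewrite LytE // -ke // /P mulmxDr Lam_mulD !mulmxA; ring.
have oA phi r : test_fun phi ->
    Lo phi (r *m cP Pi *m char_poly_mx A) = Lam u phi (r *m cP Pi *m cP B).
  move=> tp; have := yQ phi (r *m S1) tp.
  rewrite -!mulmxA (mulmxA S1 E) (kr_S1Q kr) (kr_S1E kr) mulmxDl (mulmxDr r) Lam_mulD /Lo !mulmxA => ->.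
  by ring.
have oC phi r : test_fun phi -> Lo phi (r *m cP Cm) = Lam yt phi r.
  move=> tp; have := yQ phi (r *m S2) tp.
  rewrite -!mulmxA (mulmxA S2 E) (kr_S2Q kr) (kr_S2E kr) mulmxBr mulmx1 Lam_mulB /Lo !mulmxA.
  by move=> h; lra.
have oPi phi r : Lo phi (r *m cP Pi) = Lo phi r.
  have e1 : r *m cP Pi *m Hs = r *m Hs by rewrite -mulmxA (obs_PiH ob).
  have e2 : r *m cP Pi *m M = r *m M by rewrite -mulmxA (obs_PiM ob).
  by rewrite /Lo e1 e2.
(* The error z = o - Pi x, which by [LzX] satisfies z' = Pi A z. *)
pose Lz phi r := Lo phi r - Lam x phi (r *m cP Pi).
have LzX phi r : test_fun phi -> Lz phi ('X *: r) = Lz phi (r *m cP (Pi *m A)).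
  move=> tp; rewrite /Lz.
  have e1 : 'X *: (r *m cP Pi) = r *m cP Pi *m char_poly_mx A + r *m cP (Pi *m A).
    rewrite /char_poly_mx mulmxBr mul_mx_scalar cPM -/(cP A) mulmxA subrK //.
  rewrite -[Lo phi ('X *: r)]oPi -!(scalemxAl 'X r) e1 Lam_mulD.
  rewrite LoD oA //.
  rewrite (Lam_sol _ lu lx sx tp).
  rewrite -[r *m cP (Pi *m A) *m cP Pi]mulmxA -cPM (obs_PiA ob).
  by ring.
pose T phi (i : 'I_d) := Lz phi (cP (row i 1%:M)).
have [|||c hc] := @ode_functional R d (Pi *m A) T.
- move=> phi psi i tp ts; rewrite /T /Lz /Lo !LamDphi //; ring.
- move=> a phi i tp; rewrite /T /Lz /Lo !LamZphi //; ring.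
- move=> phi i tp; rewrite /T.
  have <- : Lz phi ('X *: cP (row i 1%:M)) = Lz (nder phi) (cP (row i 1%:M)).
    by rewrite /Lz /Lo -!scalemxAl !Lam_shift.
  rewrite LzX // -cPM -row_mul mul1mx.
  rewrite (cP_row_sum (Pi *m A)).
  rewrite /Lz /Lo !mulmx_suml !Lam_sum -!sumrB; apply: eq_bigr => j _.
  by rewrite -!scalemxAl !Lam_mulC; ring.
(* The error evolves under [Pi A], but seen through [C] it is a free motion of [A], which can be
   added to [x]. *)
have eG t : Cm *m mexp (Pi *m A) t = Cm *m mexp A t.
  apply: mexp_eq; elim=> [|k IH]; first by rewrite !expr0.
  have pS (H : 'M[R]_d) : H ^+ k.+1 = H ^+ k *m H by rewrite exprSr mulmxE.
  by rewrite !pS !mulmxA IH (obs_CA ob).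
pose xt t := x t + mexp A t *m c.
have lm : L2loc (fun t => mexp A t *m c) by apply: free_L2loc.
have sm : is_sol A B (fun=> 0) (fun t => mexp A t *m c) by apply: free_sol.
have l0 : L2loc (fun=> 0 : 'cV[R]_n) by apply: L2loc0.
have sxt : is_sol A B u xt.
  have := solD lu lx l0 lm sx sm.
  by congr is_sol; apply/funext => t; rewrite addr0.
have lxt : L2loc xt by exact: L2locD.
exists xt; apply/BsP; split=> //.
have key i : {ae mu, forall t, y t i 0 - (Cm *m xt t + D *m u t) i 0 = 0}.
  pose w t := y t + (-1%:M) *m (Cm *m xt t + D *m u t).
  have lw : L2loc w by apply: L2locD => //; apply: L2locM; apply: L2locD; exact: L2locM.
  have : {ae mu, forall t, w t i 0 = 0}.
    apply: ti0_ae => [|phi tp]; first exact: L2loc_Lone.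
    rewrite -(Lam_delta w phi i).
    have l1 := L2locD (L2locM Cm lxt) (L2locM D lu).
    rewrite Lam_add //; last exact: L2locM.
    rewrite LamM // Lam_add; [|exact: L2locM..|by []].
    rewrite cPN cP1 mulmxN mulmx1 Lam_mulN !LamM //.
    have := LytE phi (cP (row i 1%:M)) tp; rewrite -oC // => h.
    have h2 : Lz phi (cP (row i 1%:M) *m cP Cm) =
       Lam (fun t => mexp A t *m c) phi (cP (row i 1%:M) *m cP Cm).
      rewrite -cPM -row_mul mul1mx.
      rewrite (cP_row_sum Cm).
      rewrite {1}/Lz /Lo !mulmx_suml !Lam_sum -!sumrB.
      transitivity (\sum_j Cm i j * ti (fun t => (mexp (Pi *m A) t *m c) j 0) phi).
        apply: eq_bigr => j _; rewrite -hc // /T /Lz /Lo -!scalemxAl !Lam_mulC; ring.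
      under [RHS]eq_bigr => j _ do rewrite Lam_mulC Lam_delta.
      have lg : L2loc (fun t => mexp (Pi *m A) t *m c) by apply: free_L2loc.
      have e1 := @ti_mulmx R m d Cm (fun t => mexp (Pi *m A) t *m c) i phi (L2loc_Lone lg) tp.
      have e2 := @ti_mulmx R m d Cm (fun t => mexp A t *m c) i phi (L2loc_Lone lm) tp.
      have e3 : (fun t => (Cm *m (mexp (Pi *m A) t *m c)) i 0) = (fun t => (Cm *m (mexp A t *m c)) i 0).
        by apply/funext => t; rewrite (mulmxA Cm (mexp (Pi *m A) t)) eG -mulmxA.
      by rewrite e3 in e1; exact: etrans (esym e1) e2.
    rewrite {1}/Lz -mulmxA -(cPM Cm Pi) in h2.
    have CPi : Cm *m Pi = Cm.
      have := obs_CA ob 0; rewrite expr0.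
      by have -> : Cm *m (1 : 'M[R]_d) = Cm by exact: mulmx1.
    rewrite CPi in h2.
    rewrite /xt Lam_add //; rewrite mulNmx Lam_mulN -h2 h; ring.
  apply: filterS; first exact: (ae_filter_ringOfSetsType mu).
  by move=> t <-; rewrite /w mulNmx mul1mx [RHS]mxE [in RHS]mxE.
have : {ae mu, forall t, forall i, y t i 0 - (Cm *m xt t + D *m u t) i 0 = 0}.
  exact: (filter_forall (ae_filter_ringOfSetsType mu)).
apply: filterS; first exact: (ae_filter_ringOfSetsType mu).
by move=> t h; apply/colP => i; apply/eqP; rewrite -subr_eq0 h.
Qed.

End Rep.
End Behavior.

(** * Syzygies from exponential trajectories *)

Section Syzygy.
Variable R : realType.

Lemma poly_mx_expand p q (N : 'M[{poly R}]_(p, q)) :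
  N = \sum_(k < degbound N) 'X^k *: cP (coefmx N k).
Proof.
apply/matrixP => i j; rewrite summxE.
have bound : (size (N i j) <= degbound N)%N.
  apply: (@leq_trans (\max_(j < q) size (N i j))%N).
    exact: (@leq_bigmax _ (fun j => size (N i j)) j).
  exact: (@leq_bigmax _ (fun i => \max_(j < q) size (N i j))%N i).
apply/polyP => l; rewrite coef_sum.
under eq_bigr => k _ do rewrite !mxE mulrC mul_polyC coefZ coefXn.
have [lN|Nl] := ltnP l (degbound N).
  rewrite (bigD1 (Ordinal lN)) //= eqxx mulr1 big1 ?addr0 // => k kl.
  have kl' : (l == k) = false by rewrite eq_sym; apply: negbTE.
  by rewrite kl' mulr0.
rewrite nth_default ?(leq_trans bound) // big1 // => k _.
by rewrite gtn_eqF ?mulr0 // (leq_trans (ltn_ord k)).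
Qed.

(* The constant remainder is the value of [N] at [H] on the right. *)
Lemma right_division p q (H : 'M[R]_q) (N : 'M[{poly R}]_(p, q)) :
  exists N1 N0, N = N1 *m char_poly_mx H + cP N0.
Proof.
have [Dl eD] := choice (delta_pow H).
exists (\sum_(k < degbound N) cP (coefmx N k) *m Dl k), (\sum_(k < degbound N) coefmx N k *m H ^+ k).
rewrite {1}[N]poly_mx_expand mulmx_suml /cP (raddf_sum (map_mx polyC)) -big_split /=.
apply: eq_bigr => k _; rewrite -mulmxA eD -!/(cP _) cPM mulmxBr mul_mx_scalar.
by rewrite subrK.
Qed.

Lemma ev_all0 p q (N : 'M[{poly R}]_(p, q)) : (forall s, ev s N = 0) -> N = 0.
Proof.
move=> h; apply/matrixP => i j; rewrite mxE; apply/eqP/negP => /negP N0.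
pose rs := [seq k%:R : R | k <- iota 0 (size (N i j))].
have urs : uniq rs.
  by rewrite map_inj_uniq ?iota_uniq // => x y /eqP; rewrite eqr_nat => /eqP.
have ars : all (root (N i j)) rs.
  apply/allP => x _; rewrite /root; have := congr1 (fun M : 'M[R]_(p, q) => M i j) (h x).
  by rewrite !mxE /horner_eval => ->.
by have := max_poly_roots N0 ars urs; rewrite size_map size_iota ltnn.
Qed.

Variables (d n m : nat) (A : 'M[R]_d) (B : 'M[R]_(d, n)) (Cm : 'M[R]_(m, d)) (D : 'M[R]_(m, n)).

Section Exponential.
Variables (s : R) (w0 : 'cV[R]_(d + n)).
Let H : 'M[R]_(d + n) := block_mx A B 0 s%:M.

(** The input solves u' = s u, so that state and input together follow the single matrix exponential
    of [H]. *)
Lemma exponential_trajectory :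
  let w t := mexp H t *m w0 in
  Bs A B Cm D (fun t => row_mx 0 1%:M *m w t) (fun t => row_mx Cm D *m w t)
     (fun t => row_mx 1%:M 0 *m w t).
Proof.
move=> w; have lw : L2loc w by apply: free_L2loc.
apply/BsP; split; try exact: L2locM.
- move=> i a b ab.
  have h : is_prim (fun t => (row_mx 1%:M 0 *m H *m mexp H t *m w0) i 0)
                   (fun t => (row_mx 1%:M 0 *m mexp H t *m w0) i 0).
    apply: derive_prim => [|t]; [exact: mexp_entry_cont|exact: mexp_is_derive].
  rewrite /w !mulmxA h //; apply: iv_eq => t _; congr (fun_of_matrix _ i 0).
  rewrite !mulmxA -!mulmxDl; congr (_ *m _ *m _).
  by rewrite mul_row_block !mul_mx_row !mul1mx !mul0mx !addr0 !mulmx1 !mulmx0 add_row_mx addr0 add0r.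
- apply: aeW => t; rewrite !mulmxA -!mulmxDl; congr (_ *m _ *m _).
  by rewrite !mul_mx_row !mulmx1 !mulmx0 add_row_mx addr0 add0r.
Qed.

End Exponential.

(** For each [s] the exponential trajectories of [H] satisfy the kernel equations from every initial
    vector, so [N] leaves the remainder 0 on right division by the characteristic matrix of [H]. The
    quotient yields [E] and the formula for [P] modulo multiples of ['X - s]. Cancellation makes [E]
    independent of [s], so the formula for [P] holds at every point. *)
Lemma rep_of_kernel (P : 'M[{poly R}]_(m, n)) (Q : 'M[{poly R}]_m) :
  (forall u y, Bs_ext A B Cm D u y -> kernel_eq P Q u y) ->
  exists E, E *m char_poly_mx A = Q *m cP Cm /\ P = E *m cP B + Q *m cP D.
Proof.
move=> hk.
have key s : exists E F, E *m char_poly_mx A = Q *m cP Cm /\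
    P = E *m cP B + Q *m cP D + ('X - s%:P) *: F.
  pose H : 'M[R]_(d + n) := block_mx A B 0 s%:M.
  pose N := P *m cP (row_mx 0 1%:M : 'M[R]_(n, d + n)) - Q *m cP (row_mx Cm D).
  have [N1 [N0 eN]] := right_division H N.
  have N00 : N0 = 0.
    apply/matrixP => i j; rewrite [RHS]mxE.
    pose w0 : 'cV[R]_(d + n) := delta_mx j 0; pose w t := mexp H t *m w0.
    have lw : L2loc w by apply: free_L2loc.
    have := hk _ _ (ex_intro _ _ (exponential_trajectory s w0)).
    rewrite -/H -/w => /(kernel_eqP _ _ (L2locM _ lw) (L2locM _ lw)) ke.
    have z0 phi : test_fun phi -> ti (fun t => (N0 *m w t) i 0) phi = 0.
      move=> tp; have := ke phi (row i 1%:M) tp; rewrite !LamM // => /eqP.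
      rewrite -subr_eq0 -Lam_mulB -!mulmxA -mulmxBr -/N eN mulmxDr Lam_mulD.
      have sw : is_sol H (0 : 'M[R]_(d + n, 0)) (fun=> 0) w by apply: free_sol.
      have l0 : L2loc (fun=> 0 : 'cV[R]_0) by apply: L2loc0.
      rewrite mulmxA (Lam_sol _ l0 lw sw tp) cP0 mulmx0.
      rewrite [X in X + _]/Lam lam0 add0r => /eqP <-.
      rewrite -(Lam_delta (fun t => N0 *m w t) phi i) LamM //.
      by rewrite -row_cP cP1.
    have cw : continuous (fun t => (N0 *m w t) i 0).
      by have := @mexp_entry_cont R _ H _ _ N0 w0 i 0; apply: eq_cont => t; rewrite /w mulmxA.
    have := cont_fundamental cw z0 0; rewrite /w mexp0 mul1mx -colE mxE.
    by [].
  move: eN; rewrite N00 cP0 addr0 => eN.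
  pose E := - lsubmx N1; pose F := rsubmx N1; exists E, F.
  have cH : char_poly_mx H = block_mx (char_poly_mx A) (- cP B) 0 ('X - s%:P)%:M.
    rewrite /char_poly_mx /H map_block_mx (@scalar_mx_block _ d n 'X) opp_block_mx add_block_mx.
    rewrite map_mx0 oppr0 !add0r map_scalar_mx; congr block_mx.
    by apply/matrixP => a b; rewrite !mxE mulrnBl.
  move: eN; rewrite -[N1]hsubmxK cH mul_row_block mulmx0 addr0 /N.
  have e1 : cP (row_mx 0 1%:M : 'M[R]_(n, d + n)) = row_mx 0 1%:M by rewrite /cP map_row_mx -!/(cP _) cP0 cP1.
  have e2 : cP (row_mx Cm D) = row_mx (cP Cm) (cP D) by rewrite /cP map_row_mx.
  rewrite e1 e2 !mul_mx_row mulmx0 mulmx1 opp_row_mx add_row_mx add0r => /eq_row_mx[h1 h2].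
  split; first by rewrite mulNmx -h1 opprK.
  have : P = (P - Q *m cP D) + Q *m cP D by rewrite subrK.
  rewrite h2 mulmxN mul_mx_scalar => {1}->; rewrite mulNmx /F.
  by rewrite addrAC.
have [E [_ [eE _]]] := key 0; exists E; split=> //.
apply/eqP; rewrite -subr_eq0; apply/eqP; apply: ev_all0 => s.
have [E' [F [eE' eP]]] := key s.
have -> : E = E' by apply: (@char_cancel _ _ _ A); rewrite eE eE'.
rewrite eP addrAC subrr add0r evZ hornerD hornerN hornerX hornerC subrr scale0r //.
Qed.

Lemma lmi_of_kernel (P : 'M[{poly R}]_(m, n)) (Q : 'M[{poly R}]_m) :
  bounded_real_pair P Q ->
  (forall u y, Bs_ext A B Cm D u y -> kernel_eq P Q u y) ->
  exists X, [/\ symmx X, psd X & psd (Lambda A B Cm D X)].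
Proof. by move=> br /rep_of_kernel[E [e1 e2]]; exact: kyp_real br e1 e2. Qed.

End Syzygy.

Definition tshift (R : realType) (c : R) : R -> measurableTypeR R := fun t => t + c.

Lemma meas_tshift (R : realType) (c : R) : measurable_fun setT (tshift c).
Proof. by apply: continuous_meas => t; apply: cvgD; [exact: cvg_id|exact: cvg_cst]. Qed.

HB.instance Definition _ (R : realType) (c : R) :=
  isMeasurableFun.Build _ _ _ _ (tshift c) (meas_tshift c).

(** * Available storage *)

Section Shift.
Variable R : realType.
Local Notation mu := (@lebesgue_measure R).
Variable c : R.
Local Notation sh := (tshift c).

Lemma tshift_itv (i j : bool) (a b : R) :
  sh @^-1` [set` Interval (BSide i a) (BSide j b)] =
  [set` Interval (BSide i (a - c)) (BSide j (b - c))].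
Proof.
apply/seteqP; split=> t; rewrite /tshift /= !in_itv /=; case: i; case: j => /=;
  rewrite ?(lerBlDr, lerBrDr, ltrBlDr, ltrBrDr) //.
Qed.

Lemma lebesgue_measure_tshift (S : set R) : measurable S -> pushforward mu sh S = mu S.
Proof.
move=> mS; apply/esym; apply: (@lebesgue_measure_unique R (pushforward mu sh)) => //.
  exact: meas_tshift.
move=> _ _ [[a b] _ <-] /=.
rewrite /pushforward tshift_itv !lebesgue_measure_itv /= !lte_fin.
by rewrite ltrD2r; case: ifP => // _; rewrite -!EFinB; congr (_%:E); ring.
Qed.

Lemma integral_tshift (g : R -> \bar R) (S : set R) :
  (\int[mu]_(t in S) g t = \int[pushforward mu sh]_(t in S) g t)%E.
Proof.
apply: eq_measure_integral; first exact: meas_tshift.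
by move=> h T mT _; exact/esym/lebesgue_measure_tshift.
Qed.

Lemma Lone_tshift f : Lone f -> Lone (fun t => f (t + c)).
Proof.
move=> [mf fi]; split; first exact: measurableT_comp mf (meas_tshift c).
move=> a b; have /integrableP[_ h] := fi (a + c) (b + c).
apply/integrableP; split.
  apply/measurable_EFinP; apply: measurable_funS (measurableT_comp mf (meas_tshift c)) => //.
move: h; rewrite integral_tshift ge0_integral_pushforward //.
- by rewrite tshift_itv !addrK.
- exact: meas_tshift.
- by apply/measurable_EFinP/measurableT_comp => //; exact: measurable_funS mf.
Qed.

Lemma iv_tshift f a b : Lone f -> iv (fun t => f (t + c)) a b = iv f (a + c) (b + c).
Proof.
move=> lf; have [mf fi] := lf; rewrite /iv /Rintegral; congr fine.
rewrite [RHS]integral_tshift integral_pushforward //.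
- by rewrite tshift_itv !addrK.
- exact: meas_tshift.
- by apply/measurable_EFinP.
- by rewrite tshift_itv !addrK; have [_] := Lone_tshift lf; exact.
Qed.

End Shift.

(** * Concatenation of trajectories *)

Section Concat.
Variable R : realType.
Local Notation mu := (@lebesgue_measure R).

Definition concat (T : Type) (c : R) (f g : R -> T) (t : R) : T := if t <= c then f t else g t.

Lemma concat_Ltwo c (f g : R -> R) : Ltwo f -> Ltwo g -> Ltwo (concat c f g).
Proof.
move=> lf lg.
have mc (f' g' : R -> R) : measurable_fun setT f' -> measurable_fun setT g' ->
    measurable_fun setT (concat c f' g').
  move=> mf mg; apply: measurable_fun_ifT => //.
  by apply: measurable_fun_ler.
split; first exact: mc lf.1 lg.1.
have -> : (fun t => concat c f g t ^+ 2) = concat c (fun t => f t ^+ 2) (fun t => g t ^+ 2).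
  by apply/funext => t; rewrite /concat; case: ifP.
apply: Lone_dom (LoneD lf.2 lg.2) _; first by apply: mc; [exact: lf.2.1|exact: lg.2.1].
by move=> t; rewrite /concat; case: ifP => _; rewrite ger0_norm ?sqr_ge0 // ?lerDl ?lerDr sqr_ge0.
Qed.

Lemma concat_L2loc q c (f g : R -> 'cV[R]_q) : L2loc f -> L2loc g -> L2loc (concat c f g).
Proof.
move=> /L2locP lf /L2locP lg; apply/L2locP => i.
have := concat_Ltwo c (lf i) (lg i); congr Ltwo; apply/funext => t.
by rewrite /concat; case: ifP.
Qed.

(** Half-open, because [concat] takes its first branch at the junction point. *)
Lemma iv_eq_oc (f g : R -> R) a b : Lone f -> Lone g ->
  (forall t, a < t <= b -> f t = g t) -> iv f a b = iv g a b.
Proof.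
move=> lf lg h; rewrite /iv -!Rintegral_itv_obnd_cbnd.
- by apply: eq_Rintegral => t; rewrite inE /= in_itv /=; exact: h.
- by apply: Lone_intD lg => //; exact: subset_itv_oc_cc.
- by apply: Lone_intD lf => //; exact: subset_itv_oc_cc.
Qed.

Lemma concat_prim c (f g F G : R -> R) : Lone f -> Lone g -> Lone (concat c f g) ->
  is_prim f F -> is_prim g G -> F c = G c -> is_prim (concat c f g) (concat c F G).
Proof.
move=> lf lg lc pF pG FG a b ab; rewrite /concat.
have [bc|cb] := leP b c.
  rewrite (le_trans ab bc) pF //; apply: iv_eq => t /andP[_ tb].
  by rewrite /concat (le_trans tb bc).
have [ac|ca] := leP a c; last first.
  rewrite pG //; apply: iv_eq_oc => // t /andP[at' _].
  by rewrite /concat leNgt (lt_trans ca at').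
rewrite (iv_split lc ac (ltW cb)).
have -> : iv (concat c f g) a c = iv f a c.
  by apply: iv_eq => t /andP[_ tc]; rewrite /concat tc.
have -> : iv (concat c f g) c b = iv g c b.
  by apply: iv_eq_oc => // t /andP[ct _]; rewrite /concat leNgt ct.
by rewrite -pF // -pG ?ltW // FG; ring.
Qed.

Lemma concat_sol d n (A : 'M[R]_d) (B : 'M[R]_(d, n)) c u x u' x' :
  L2loc u -> L2loc x -> L2loc u' -> L2loc x' ->
  is_sol A B u x -> is_sol A B u' x' -> x c = x' c ->
  is_sol A B (concat c u u') (concat c x x').
Proof.
move=> lu lx lu' lx' sx sx' xc i.
have e : (fun t => (A *m concat c x x' t + B *m concat c u u' t) i 0) =
  concat c (fun t => (A *m x t + B *m u t) i 0) (fun t => (A *m x' t + B *m u' t) i 0).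
  by apply/funext => t; rewrite /concat; case: ifP.
have e' : (fun t => concat c x x' t i 0) = concat c (fun t => x t i 0) (fun t => x' t i 0).
  by apply/funext => t; rewrite /concat; case: ifP.
rewrite e' e; apply: concat_prim => //.
- exact: L2loc_Lone (L2loc_rhs A B lu lx) i.
- exact: L2loc_Lone (L2loc_rhs A B lu' lx') i.
- rewrite -e; have := L2loc_rhs A B (concat_L2loc c lu lu') (concat_L2loc c lx lx').
  by move=> h; exact: L2loc_Lone h i.
- by rewrite xc.
Qed.

Lemma tshift_L2loc q c (f : R -> 'cV[R]_q) : L2loc f -> L2loc (fun t => f (t + c)).
Proof.
move=> /L2locP lf; apply/L2locP => i; have [mf fi] := lf i; split.
  exact: (measurableT_comp mf (meas_tshift c)).
exact: (Lone_tshift c fi).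
Qed.

Lemma tshift_sol d n (A : 'M[R]_d) (B : 'M[R]_(d, n)) c u x :
  L2loc u -> L2loc x -> is_sol A B u x -> is_sol A B (fun t => u (t + c)) (fun t => x (t + c)).
Proof.
move=> lu lx sx i a b ab; rewrite (sx i) ?lerD2r //.
rewrite -(@iv_tshift _ c (fun t => (A *m x t + B *m u t) i 0)) //.
exact: L2loc_Lone (L2loc_rhs A B lu lx) i.
Qed.

End Concat.

(** * Quadratic forms from the parallelogram law *)

Section Quadratic.
Variable R : realType.

(** For c >= 0, n times the defect g c - c g 1 is the defect at the fractional part of n c, hence
    bounded independently of n. *)
Lemma additive_bounded_linear (g : R -> R) (K : R) :
  (forall a b, g (a + b) = g a + g b) -> (forall c, 0 <= c <= 1 -> `|g c| <= K) ->
  forall c, g c = c * g 1.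
Proof.
move=> gD gK.
have g0 : g 0 = 0 by have := gD 0 0; rewrite addr0; lra.
have gN a : g (- a) = - g a by have := gD a (- a); rewrite subrr g0; lra.
have gn a k : g (k%:R * a) = k%:R * g a.
  elim: k => [|k IH]; first by rewrite !mul0r.
  by rewrite -natr1 !mulrDl !mul1r gD IH.
have pos c : 0 <= c -> g c = c * g 1.
  move=> c0; apply/eqP; rewrite -subr_eq0 -normr_le0; apply/ler_addgt0Pl => e e0; rewrite addr0.
  pose n := (Num.truncn ((K + `|g 1|) / e)).+1.
  have nK : K + `|g 1| <= n%:R * e.
    by rewrite -ler_pdivrMr //; apply/ltW/truncnS_gt.
  have n0 : 0 < n%:R :> R by rewrite ltr0n.
  pose k := Num.truncn (n%:R * c).
  have nc0 : 0 <= n%:R * c by rewrite mulr_ge0 // ltW.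
  have /andP[k1 k2] := truncn_itv nc0.
  rewrite -/k in k1 k2.
  have hk : 0 <= n%:R * c - k%:R <= 1.
    by rewrite subr_ge0 k1 /= lerBlDl natr1 ltW.
  have e1 : n%:R * (g c - c * g 1) = g (n%:R * c - k%:R) - (n%:R * c - k%:R) * g 1.
    have := gn 1 k; rewrite mulr1 => gk.
    by rewrite gD gN gk gn; ring.
  rewrite -(ler_pM2l n0); apply: le_trans nK.
  have -> : n%:R * `|g c - c * g 1| = `|n%:R * (g c - c * g 1)|.
    by rewrite normrM (ger0_norm (ltW n0)).
  rewrite e1; apply: (le_trans (ler_normB _ _)); apply: lerD; first exact: gK.
  rewrite normrM ger0_norm; last by case/andP: hk.
  by rewrite ler_piMl //; case/andP: hk.
move=> c; have [/pos//|c0] := leP 0 c.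
have := pos (- c); rewrite oppr_ge0 ltW // => /(_ isT); rewrite gN; lra.
Qed.

(** The polarization [f] is additive by the parallelogram law; homogeneity follows from
    [additive_bounded_linear], whose bound on [0, 1] is a consequence of [S >= 0]. The factor 1/4
    comes from [f x x = 4 S x]. *)
Lemma jordan_von_neumann d (S : 'cV[R]_d -> R) :
  (forall x, 0 <= S x) -> (forall c x, S (c *: x) = c ^+ 2 * S x) ->
  (forall x y, S (x + y) + S (x - y) = 2 * S x + 2 * S y) ->
  exists X : 'M[R]_d, symmx X /\ forall x, S x = (x^T *m X *m x) 0 0.
Proof.
move=> S0 SZ SP.
have SN x : S (- x) = S x by rewrite -scaleN1r SZ; ring.
pose f x y := S (x + y) - S (x - y).
have f0 y : f 0 y = 0 by rewrite /f add0r sub0r SN subrr.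
have fC x y : f x y = f y x by rewrite /f [y + x]addrC -(SN (y - x)) opprB.
have f2 x z y : f (x + z) y + f (x - z) y = 2 * f x y.
  have := SP (x + y) z; have := SP (x - y) z; rewrite /f.
  have -> : x + y + z = x + z + y by rewrite addrAC.
  have -> : x + y - z = x - z + y by rewrite addrAC.
  have -> : x - y + z = x + z - y by rewrite addrAC.
  have -> : x - y - z = x - z - y by rewrite addrAC.
  by move: (S _) (S _) (S _) (S _) (S _) (S _) (S _) => *; lra.
have fD a b y : f (a + b) y = f a y + f b y.
  pose x := 2^-1 *: (a + b); pose z := 2^-1 *: (a - b).
  have xz : x + z = a by apply/colP => i; rewrite !mxE; field.
  have xz' : x - z = b by apply/colP => i; rewrite !mxE; field.
  have := f2 x z y; rewrite xz xz' => ->.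
  have := f2 x x y; rewrite subrr f0 addr0 => <-; congr f.
  by apply/colP => i; rewrite !mxE; field.
have fZ c x y : f (c *: x) y = c * f x y.
  have := @additive_bounded_linear (fun c => f (c *: x) y) (2 * S x + 2 * S y).
  rewrite scale1r; apply=> [a b|a /andP[a0 a1]]; first by rewrite scalerDl fD.
  have := SP (a *: x) y; rewrite SZ /f.
  have a2 : a ^+ 2 <= 1 by rewrite exprn_ile1.
  have : a ^+ 2 * S x <= S x by rewrite ler_piMl.
  have := S0 (a *: x + y); have := S0 (a *: x - y); have := S0 x; have := S0 y.
  rewrite ler_norml; move: (S _) (S _) (S _) (S _) => p q r s h1 h2 h3 h4 h5 h6.
  by apply/andP; split; lra.
have fsum (I : finType) (v : I -> 'cV[R]_d) y : f (\sum_i v i) y = \sum_i f (v i) y.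
  by apply: (big_morph (fun x => f x y)) => [a b|]; [exact: fD|exact: f0].
pose e (i : 'I_d) : 'cV[R]_d := delta_mx i 0.
have xE (x : 'cV[R]_d) : x = \sum_i x i 0 *: e i.
  apply/colP => i; rewrite summxE (bigD1 i) //= !mxE !eqxx mulr1 big1 ?addr0 // => k ki.
  by rewrite !mxE eq_sym (negbTE ki) mulr0.
exists (\matrix_(i, j) (f (e i) (e j) / 4)); split.
  by apply/matrixP => i j; rewrite !mxE fC.
move=> x.
have -> : S x = f x x / 4.
  have -> : f x x = S (2 *: x) - S (0 *: x) by rewrite /f subrr scale0r scaler_nat.
  by rewrite !SZ; field.
have fx y : f x y = \sum_i x i 0 * f (e i) y.
  transitivity (f (\sum_i x i 0 *: e i) y); first by rewrite -xE.
  by rewrite fsum; apply: eq_bigr => i _; rewrite fZ.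
rewrite fx mulr_suml mxE.
under [RHS]eq_bigr => j _ do rewrite mxE mulr_suml.
rewrite [RHS]exchange_big; apply: eq_bigr => i _ /=.
rewrite fC fx mulr_sumr mulr_suml; apply: eq_bigr => j _.
by rewrite fC !mxE; ring.
Qed.

End Quadratic.

(** * Gains along trajectories *)

Section Storage.
Variable R : realType.
Local Notation mu := (@lebesgue_measure R).

Definition sqn k (v : 'cV[R]_k) : R := (v^T *m v) 0 0.

Lemma sqnE k (v : 'cV[R]_k) : sqn v = \sum_i v i 0 ^+ 2.
Proof. by rewrite /sqn mxE; apply: eq_bigr => i _; rewrite mxE. Qed.

Lemma sqn_ge0 k (v : 'cV[R]_k) : 0 <= sqn v.
Proof. by rewrite sqnE sumr_ge0 // => i _; exact: sqr_ge0. Qed.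

Lemma sqnZ k c (v : 'cV[R]_k) : sqn (c *: v) = c ^+ 2 * sqn v.
Proof. by rewrite !sqnE mulr_sumr; apply: eq_bigr => i _; rewrite mxE exprMn. Qed.

Lemma sqn_par k (v w : 'cV[R]_k) :
  sqn v + sqn w = 2 * sqn (2^-1 *: (v + w)) + 2 * sqn (2^-1 *: (v - w)).
Proof.
rewrite !sqnE !mulr_sumr -!big_split; apply: eq_bigr => i _ /=.
by rewrite !mxE; field.
Qed.

Lemma sqn_Lone k (w : R -> 'cV[R]_k) : L2loc w -> Lone (fun t => sqn (w t)).
Proof.
move=> /L2locP lw; have := Lone_sum (fun i => (lw i).2).
by congr Lone; apply/funext => t; rewrite sqnE.
Qed.

Variables (d n m : nat) (A : 'M[R]_d) (B : 'M[R]_(d, n)) (Cm : 'M[R]_(m, d)) (D : 'M[R]_(m, n)).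

Definition traj (u : R -> 'cV[R]_n) (x : R -> 'cV[R]_d) := [/\ L2loc u, L2loc x & is_sol A B u x].

Definition rate (u : R -> 'cV[R]_n) (x : R -> 'cV[R]_d) t := sqn (Cm *m x t + D *m u t) - sqn (u t).

Lemma output_L2loc u x : traj u x -> L2loc (fun t => Cm *m x t + D *m u t).
Proof. by move=> [lu lx _]; apply: L2locD; exact: L2locM. Qed.

Lemma LoneB (f g : R -> R) : Lone f -> Lone g -> Lone (fun t => f t - g t).
Proof.
move=> lf lg; have := LoneD lf (LoneZ (-1) lg).
by congr Lone; apply/funext => t; rewrite mulN1r.
Qed.

Lemma rate_Lone u x : traj u x -> Lone (rate u x).
Proof. by move=> tx; apply: LoneB; apply: sqn_Lone; [exact: output_L2loc|case: tx]. Qed.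

Lemma supplyE (u : R -> 'cV[R]_n) (y : R -> 'cV[R]_m) t : supply u y t = sqn (y t) - sqn (u t).
Proof. by rewrite /supply mxE [X in _ + X]mxE. Qed.

(* The values whose supremum is the available storage. *)
Definition gain (t0 : R) (x0 : 'cV[R]_d) : set R := [set r | exists t1 u x,
  [/\ t0 <= t1, traj u x, x t0 = x0 & r = iv (rate u x) t0 t1]].

Lemma avail_storageE t0 x0 : avail_storage A B Cm D t0 x0 = ereal_sup [set r%:E | r in gain t0 x0].
Proof.
rewrite /avail_storage; congr ereal_sup; apply/seteqP; split=> r /=.
  move=> [t1 [u [y [x [t01 /BsP[lu ly lx sx e] xt0 ->]]]]].
  have tx : traj u x by [].
  exists (iv (rate u x) t0 t1); first by exists t1, u, x.
  have lr := rate_Lone tx.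
  rewrite /iv /Rintegral fineK; last by apply: integrable_fin_num => //; exact: lr.2.
  apply: ae_eq_integral => //.
  - by apply/measurable_EFinP; apply: measurable_funS lr.1.
  - have ls : Lone (supply u y).
      have := LoneB (sqn_Lone ly) (sqn_Lone lu); congr Lone.
      by apply/funext => t; rewrite supplyE.
    by apply/measurable_EFinP; apply: measurable_funS ls.1.
  - move: e; apply: filterS; first exact: (ae_filter_ringOfSetsType mu).
    by move=> t /= e _; rewrite supplyE e.
move=> [_ [t1 [u [x [t01 tx xt0 ->]]]] <-].
exists t1, u, (fun t => Cm *m x t + D *m u t), x; split=> //.
  apply/BsP; have ly := output_L2loc tx; have [lu lx sx] := tx; split=> //.
  by apply: aeW.
rewrite /iv /Rintegral fineK; last first.
  by apply: integrable_fin_num => //; exact: (rate_Lone tx).2.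
by apply: eq_integral => t _; rewrite supplyE.
Qed.

Lemma traj_shift c u x : traj u x -> traj (fun t => u (t + c)) (fun t => x (t + c)).
Proof. by move=> [lu lx sx]; split; [exact: tshift_L2loc|exact: tshift_L2loc|exact: tshift_sol]. Qed.

Lemma gain_shift t0 t0' x0 r : gain t0 x0 r -> gain t0' x0 r.
Proof.
move=> [t1 [u [x [t01 tx xt0 ->]]]]; pose c := t0 - t0'.
exists (t1 - c), (fun t => u (t + c)), (fun t => x (t + c)); split.
- by rewrite /c; lra.
- exact: traj_shift.
- by rewrite /c addrC subrK.
- have := @iv_tshift R c (rate u x) t0' (t1 - c) (rate_Lone tx).
  by rewrite subrK /c [t0' + _]addrC subrK => <-.
Qed.

Lemma traj_concat c u x u' x' : traj u x -> traj u' x' -> x c = x' c ->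
  traj (concat c u u') (concat c x x').
Proof.
move=> [lu lx sx] [lu' lx' sx'] xc; split; [exact: concat_L2loc..|].
exact: concat_sol.
Qed.

Lemma rate_concat c u x u' x' : rate (concat c u u') (concat c x x') = concat c (rate u x) (rate u' x').
Proof. by apply/funext => t; rewrite /rate /concat; case: ifP. Qed.

Lemma iv_concat (f g : R -> R) a c b : Lone f -> Lone g -> Lone (concat c f g) -> a <= c -> c <= b ->
  iv (concat c f g) a b = iv f a c + iv g c b.
Proof.
move=> lf lg lc ac cb; rewrite (iv_split lc ac cb); congr (_ + _).
  by apply: iv_eq => t /andP[_ tc]; rewrite /concat tc.
by apply: iv_eq_oc => // t /andP[ct _]; rewrite /concat leNgt ct.
Qed.

Lemma traj_free c (z : 'cV[R]_d) : traj (fun=> 0) (fun t => mexp A (t - c) *m z).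
Proof.
have : traj (fun=> 0) (fun t => mexp A t *m z).
  by split; [apply: L2loc0|apply: free_L2loc|apply: free_sol].
exact: (@traj_shift (- c)).
Qed.

Lemma rate_free c z t : rate (fun=> 0) (fun t => mexp A (t - c) *m z) t = sqn (Cm *m (mexp A (t - c) *m z)).
Proof. by rewrite /rate mulmx0 addr0 {2}/sqn mulmx0 mxE subr0. Qed.

Lemma traj_extend t0 t1 T u x : t0 <= t1 -> t1 <= T -> traj u x ->
  exists u' x', [/\ traj u' x', x' t0 = x t0 & iv (rate u x) t0 t1 <= iv (rate u' x') t0 T].
Proof.
move=> t01 t1T tx; have tf := traj_free t1 (x t1).
have e : x t1 = mexp A (t1 - t1) *m x t1 by rewrite subrr mexp0 mul1mx.
have tc := traj_concat tx tf e.
exists (concat t1 u (fun=> 0)), (concat t1 x (fun t => mexp A (t - t1) *m x t1)); split=> //.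
  by rewrite /concat t01.
have := rate_Lone tc; rewrite rate_concat => lc.
rewrite iv_concat //; [|exact: rate_Lone..].
by rewrite lerDl iv_ge0 // => t _; rewrite rate_free sqn_ge0.
Qed.

Lemma trajD u x u' x' : traj u x -> traj u' x' -> traj (fun t => u t + u' t) (fun t => x t + x' t).
Proof. by move=> [lu lx sx] [lu' lx' sx']; split; [exact: L2locD..|exact: solD]. Qed.

Lemma trajZ c u x : traj u x -> traj (fun t => c *: u t) (fun t => c *: x t).
Proof. by move=> [lu lx sx]; split; [exact: L2locZ..|exact: solZ]. Qed.

Lemma trajB u x u' x' : traj u x -> traj u' x' -> traj (fun t => u t - u' t) (fun t => x t - x' t).
Proof.
move=> tx /(trajZ (-1)) tx'; have := trajD tx tx'.
by congr traj; apply/funext => t; rewrite scaleN1r.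
Qed.

Lemma gain0 t0 x0 : gain t0 x0 0.
Proof.
exists t0, (fun=> 0), (fun t => mexp A (t - t0) *m x0); split=> //.
- exact: traj_free.
- by rewrite subrr mexp0 mul1mx.
- by rewrite iv_pt.
Qed.

Lemma gainZ t0 c x0 r : gain t0 x0 r -> gain t0 (c *: x0) (c ^+ 2 * r).
Proof.
move=> [t1 [u [x [t01 tx xt0 ->]]]].
exists t1, (fun t => c *: u t), (fun t => c *: x t); split=> //; first exact: trajZ.
  by rewrite xt0.
rewrite -ivZ; last exact: rate_Lone.
by apply: iv_eq => t _; rewrite /rate -!scalemxAr -scalerDr !sqnZ mulrBr.
Qed.

(** Half sum and half difference of two trajectories, prolonged to a common horizon. One inequality
    is enough: for the suprema, applying it to [x + y] and [x - y] gives the reverse one. *)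
Lemma gain_par t0 x0 y0 r s : gain t0 (x0 + y0) r -> gain t0 (x0 - y0) s ->
  exists p q, [/\ gain t0 x0 p, gain t0 y0 q & r + s <= 2 * p + 2 * q].
Proof.
move=> [t1 [u1 [x1 [t01 tx1 xt1 ->]]]] [t2 [u2 [x2 [t02 tx2 xt2 ->]]]].
pose T := Num.max t1 t2.
have [t1T t2T] : t1 <= T /\ t2 <= T by rewrite !le_max !lexx orbT.
have [v1 [z1 [tz1 z1t h1]]] := traj_extend t01 t1T tx1.
have [v2 [z2 [tz2 z2t h2]]] := traj_extend t02 t2T tx2.
pose up t := 2^-1 *: (v1 t + v2 t); pose xp t := 2^-1 *: (z1 t + z2 t).
pose um t := 2^-1 *: (v1 t - v2 t); pose xm t := 2^-1 *: (z1 t - z2 t).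
have tp : traj up xp by apply: trajZ; exact: trajD.
have tm : traj um xm by apply: trajZ; exact: trajB.
exists (iv (rate up xp) t0 T), (iv (rate um xm) t0 T); split.
- exists T, up, xp; split=> //; first exact: le_trans t1T.
  by rewrite /xp z1t z2t xt1 xt2; apply/colP => i; rewrite !mxE; field.
- exists T, um, xm; split=> //; first exact: le_trans t1T.
  by rewrite /xm z1t z2t xt1 xt2; apply/colP => i; rewrite !mxE; field.
apply: (le_trans (lerD h1 h2)).
have [lp lm] := (rate_Lone tp, rate_Lone tm).
rewrite -ivD; [|exact: rate_Lone..].
rewrite -!ivZ // -ivD; [|exact: LoneZ..].
rewrite le_eqVlt; apply/orP; left; apply/eqP; apply: iv_eq => t _.
have hy : Cm *m xp t + D *m up t = 2^-1 *: ((Cm *m z1 t + D *m v1 t) + (Cm *m z2 t + D *m v2 t)).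
  by rewrite /xp /up -!scalemxAr -scalerDr !mulmxDr addrACA.
have hy' : Cm *m xm t + D *m um t = 2^-1 *: ((Cm *m z1 t + D *m v1 t) - (Cm *m z2 t + D *m v2 t)).
  by rewrite /xm /um -!scalemxAr -scalerDr !mulmxBr opprD addrACA.
rewrite /rate hy hy'.
have := sqn_par (Cm *m z1 t + D *m v1 t) (Cm *m z2 t + D *m v2 t).
have := sqn_par (v1 t) (v2 t); rewrite -/(up t) -/(um t).
by move: (sqn _) (sqn _) (sqn _) (sqn _) (sqn _) (sqn _) (sqn _) (sqn _) => *; lra.
Qed.

Lemma gain_dyn t0 t1 u x r : t0 <= t1 -> traj u x -> gain t0 (x t1) r ->
  gain t0 (x t0) (iv (rate u x) t0 t1 + r).
Proof.
move=> t01 tx /(gain_shift t1)[T [u' [x' [t1T tx' x't ->]]]].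
have tc := traj_concat tx tx' (esym x't).
exists T, (concat t1 u u'), (concat t1 x x'); split=> //; first exact: le_trans t1T.
  by rewrite /concat t01.
have := rate_Lone tc; rewrite rate_concat => lc.
by rewrite iv_concat //; exact: rate_Lone.
Qed.

Lemma lyapunov_prim (X : 'M[R]_d) u x : symmx X -> traj u x ->
  is_prim (fun t => 2 * ((X *m x t)^T *m (A *m x t + B *m u t)) 0 0)
          (fun t => ((x t)^T *m X *m x t) 0 0).
Proof.
move=> sX [lu lx sx]; pose f t := A *m x t + B *m u t.
have lf : L2loc f by exact: L2loc_rhs.
have cx := sol_cont lu lx sx.
pose g i t := \sum_j X i j * x t j 0; pose g' i t := \sum_j X i j * f t j 0.
have lg' i : Lone (g' i) by apply: Lone_sum => j; apply/LoneZ/L2loc_Lone.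
have pg i : is_prim (g' i) (g i).
  move=> a b ab; rewrite /g -sumrB /g' iv_sum; last by move=> j; apply/LoneZ/L2loc_Lone.
  apply: eq_bigr => j _; rewrite -mulrBr (sx j) // ivZ //; exact: L2loc_Lone.
have h i := is_primM (lg' i) (L2loc_Lone lf i) (pg i) (sx i).
have lp i : Lone (fun t => g' i t * x t i 0 + g i t * f t i 0).
  apply: LoneD; first exact: LoneMc.
  have := LoneMc (L2loc_Lone lf i) (prim_cont (lg' i) (pg i)).
  by congr Lone; apply/funext => t; rewrite mulrC.
move=> a b ab.
have sw (p q : 'cV[R]_d) : (p^T *m q) 0 0 = (q^T *m p) 0 0.
  by rewrite -[p^T *m q]trmxK trmx_mul trmxK mxE.
have gE i t : g i t = (X *m x t)^T 0 i by rewrite [RHS]mxE mxE.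
have gE' i t : g' i t = (X *m f t)^T 0 i by rewrite [RHS]mxE mxE.
have e t : ((x t)^T *m X *m x t) 0 0 = \sum_i g i t * x t i 0.
  by rewrite -mulmxA sw mxE; apply: eq_bigr => i _; rewrite gE.
rewrite !e -sumrB (eq_bigr _ (fun i _ => h i a b ab)) -iv_sum //.
apply: iv_eq => t _; rewrite big_split /= -/(f t).
have -> : \sum_i g i t * f t i 0 = ((X *m x t)^T *m f t) 0 0.
  by rewrite mxE; apply: eq_bigr => i _; rewrite gE.
have -> : \sum_i g' i t * x t i 0 = ((X *m x t)^T *m f t) 0 0.
  have -> : (X *m x t)^T *m f t = (x t)^T *m (X *m f t) by rewrite trmx_mul sX mulmxA.
  by rewrite sw mxE; apply: eq_bigr => i _; rewrite gE'.
by ring.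
Qed.

Lemma gain_le (X : 'M[R]_d) t0 x0 r : symmx X -> psd X -> psd (Lambda A B Cm D X) ->
  gain t0 x0 r -> r <= (x0^T *m X *m x0) 0 0.
Proof.
move=> sX pX lX [t1 [u [x [t01 tx xt0 ->]]]]; have [lu lx sx] := tx.
have lv : Lone (fun t => ((X *m x t)^T *m (A *m x t + B *m u t)) 0 0).
  have lXx := L2locM X lx; have lf := L2loc_rhs A B lu lx.
  have := Lone_sum (fun i => LtwoM ((L2locP _).1 lXx i) ((L2locP _).1 lf i)).
  by congr Lone; apply/funext => t; rewrite [RHS]mxE; apply: eq_bigr => i _; rewrite [in RHS]mxE.
have h := lyapunov_prim sX tx t01; rewrite xt0 in h.
have := pX (x t1); suff : iv (rate u x) t0 t1 + iv (fun t => 2 * ((X *m x t)^T *m (A *m x t + B *m u t)) 0 0) t0 t1 <= 0.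
  by rewrite -h; lra.
rewrite -ivD; [|exact: rate_Lone|exact: LoneZ].
have -> : 0 = iv (fun=> 0) t0 t1 :> R by rewrite /iv Rintegral_cst // mul0r.
apply: iv_le => [||t _]; [|exact: (Lone_cont (@cst_continuous _ _ (0 : R)))|].
  by apply: LoneD; [exact: rate_Lone|exact: LoneZ].
by have := lX (col_mx (x t) (u t)); rewrite quad_Lambda // /rate /sqn; lra.
Qed.

Lemma sup_quadratic t0 : (forall x0, (avail_storage A B Cm D t0 x0 < +oo)%E) ->
  exists X : 'M[R]_d, symmx X /\
    forall x0, avail_storage A B Cm D t0 x0 = ((x0^T *m X *m x0) 0 0)%:E.
Proof.
move=> fin; pose V x0 := avail_storage A B Cm D t0 x0; pose S x0 := fine (V x0).
have V0 x0 : (0 <= V x0)%E.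
  by rewrite /V avail_storageE; apply: ereal_sup_ubound; exists 0; [exact: gain0|].
have VS x0 : V x0 = (S x0)%:E by rewrite /S fineK // ge0_fin_numE // fin.
have ub x0 r : gain t0 x0 r -> r <= S x0.
  move=> g; rewrite -lee_fin -VS /V avail_storageE; apply: ereal_sup_ubound; by exists r.
have lub x0 M : (forall r, gain t0 x0 r -> r <= M) -> S x0 <= M.
  move=> h; rewrite -lee_fin -VS /V avail_storageE; apply: ge_ereal_sup => _ [r gr <-].
  by rewrite lee_fin h.
have S0 x0 : 0 <= S x0 by rewrite -lee_fin -VS.
have S00 : S 0 = 0.
  apply: le_anti; rewrite S0 andbT; apply/lub => r gr.
  rewrite leNgt; apply/negP => r0.
  (* Trajectories from 0 can be rescaled, so a positive gain [r] would give the gain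
     [k * r = S 0 + 1]. *)
  pose k := (S 0 + 1) / r.
  have k0 : 0 <= k by rewrite divr_ge0 ?ltW // ltr_wpDl.
  have := ub 0 _ (_ : gain t0 0 (Num.sqrt k ^+ 2 * r)).
  have h := gainZ (Num.sqrt k) gr; rewrite scaler0 in h => /(_ h).
  by rewrite sqr_sqrtr // /k divfK ?gt_eqF //; lra.
have SZ1 c x0 : c != 0 -> c ^+ 2 * S x0 <= S (c *: x0).
  move=> c0; have c2 : 0 < c ^+ 2 by rewrite exprn_even_gt0.
  rewrite -ler_pdivlMl //; apply/lub => r gr; rewrite ler_pdivlMl //.
  exact/ub/gainZ.
have SZ c x0 : S (c *: x0) = c ^+ 2 * S x0.
  have [->|c0] := eqVneq c 0; first by rewrite scale0r S00 expr0n mul0r.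
  apply: le_anti; rewrite SZ1 // andbT.
  have := SZ1 c^-1 (c *: x0); rewrite invr_eq0 c0 scalerA mulVf // scale1r => /(_ isT).
  by rewrite exprVn ler_pdivrMl // exprn_even_gt0.
have SP1 x y : S (x + y) + S (x - y) <= 2 * S x + 2 * S y.
  rewrite -lerBrDr; apply/lub => r gr; rewrite lerBrDr addrC -lerBrDr; apply/lub => s gs.
  have [p [q [/ub hp /ub hq h]]] := gain_par gr gs.
  by move: h hp hq; move: (S _) (S _) => *; lra.
have SP x y : S (x + y) + S (x - y) = 2 * S x + 2 * S y.
  apply: le_anti; rewrite SP1 /=; have := SP1 (x + y) (x - y).
  have -> : x + y + (x - y) = 2 *: x by apply/colP => i; rewrite !mxE; ring.
  have -> : x + y - (x - y) = 2 *: y by apply/colP => i; rewrite !mxE; ring.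
  by rewrite !SZ; move: (S _) (S _) (S _) (S _) => *; lra.
have [X [sX hX]] := jordan_von_neumann S0 SZ SP.
by exists X; split=> // x0; rewrite -/(V x0) VS hX.
Qed.

End Storage.

(** * Properties of the storage matrix *)

Section Available.
Variable R : realType.
Local Notation mu := (@lebesgue_measure R).

Lemma map_re_tc p q (N : 'M[R]_(p, q)) : map_mx (@complex.Re R) (tc N) = N.
Proof. by apply/matrixP => i j; rewrite !mxE. Qed.
Lemma map_im_tc p q (N : 'M[R]_(p, q)) : map_mx (@complex.Im R) (tc N) = 0.
Proof. by apply/matrixP => i j; rewrite !mxE. Qed.

Lemma psd_ker k (M : 'M[R]_k) (v : 'cV[R]_k) : symmx M -> psd M -> (v^T *m M *m v) 0 0 = 0 -> M *m v = 0.
Proof.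
move=> sM pM h.
have : tc M *m tc v = 0.
  apply: psdh_ker; [exact: tc_herm|exact: tc_psdh|].
  by rewrite rd_re_im re_tcM im_tcM map_re_tc map_im_tc trmx0 mul0mx mulmxA h mxE addr0.
by move=> /tc_mul_eq0[]; rewrite map_re_tc.
Qed.

Lemma right_derivative_ge0 (q : R -> R) t0 : continuous q ->
  (forall t1, t0 <= t1 -> 0 <= iv q t0 t1) -> 0 <= q t0.
Proof.
move=> cq h; rewrite leNgt; apply/negP => q0.
have e0 : 0 < - q t0 / 2 by lra.
have /cvgrPdist_lt/(_ _ e0)[d /= d0 hd] := cq t0.
have tt : t0 <= t0 + d / 2 by lra.
have := h _ tt.
have pc : is_prim (fun=> q t0 / 2) (fun t : R => q t0 / 2 * t).
  apply: derive_prim => [|t]; first exact: cst_continuous.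
  have := @is_deriveZ _ _ _ id (q t0 / 2) t 1 1 (is_derive_id _ _).
  by rewrite [_ *: 1]mulr1.
have le : iv q t0 (t0 + d / 2) <= iv (fun=> q t0 / 2) t0 (t0 + d / 2).
  apply: iv_le => [||t /andP[h1 h2]]; [exact: Lone_cont|exact: (Lone_cont (@cst_continuous _ _ _))|].
  have : `|t0 - t| < d by rewrite ltr_norml; lra.
  by move=> /hd; rewrite ltr_norml; lra.
rewrite -pc in le; last by lra.
have : q t0 / 2 * (d / 2) < 0 by rewrite pmulr_llt0; lra.
by move: le; rewrite mulrDr; lra.
Qed.

Variables (d n m : nat) (A : 'M[R]_d) (B : 'M[R]_(d, n)) (Cm : 'M[R]_(m, d)) (D : 'M[R]_(m, n)).

Lemma obsmx_null (z : 'cV[R]_d) : obsmx A Cm *m z = 0 <-> forall k, Cm *m A ^+ k *m z = 0.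
Proof.
split=> h.
  apply: obs_all => k kd; have := congr1 (fun N => submxcol N (Ordinal kd)) h.
  by rewrite /obsmx mxcol_mul mxcolK submxcol0.
by rewrite /obsmx mxcol_mul -[RHS]mxcol0; apply: eq_mxcol => k; rewrite h.
Qed.

Section Quad.
Variables (t0 : R) (X : 'M[R]_d).
Hypothesis sX : symmx X.
Hypothesis hX : forall x0, avail_storage A B Cm D t0 x0 = ((x0^T *m X *m x0) 0 0)%:E.

Lemma avail_ub x0 r : gain A B Cm D t0 x0 r -> r <= (x0^T *m X *m x0) 0 0.
Proof.
by move=> g; rewrite -lee_fin -hX avail_storageE; apply: ereal_sup_ubound; exists r.
Qed.

Lemma avail_lub x0 M : (forall r, gain A B Cm D t0 x0 r -> r <= M) -> (x0^T *m X *m x0) 0 0 <= M.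
Proof.
move=> h; rewrite -lee_fin -hX avail_storageE; apply: ge_ereal_sup => _ [r gr <-].
by rewrite lee_fin h.
Qed.

Lemma avail_psd : psd X.
Proof. by move=> x0; apply/avail_ub/gain0. Qed.

Lemma avail_min Y : symmx Y -> psd Y -> psd (Lambda A B Cm D Y) -> psd (Y - X).
Proof.
move=> sY pY lY x0; rewrite mulmxBr mulmxBl mxE [X in _ + X]mxE subr_ge0.
by apply: avail_lub => r; exact: gain_le.
Qed.

(** For [w0] made of a state and an input value, hold the input constant and start at that state.
    The dissipation inequality from [t0] says that [q] has nonnegative integrals over all intervals
    starting at [t0]; by continuity its initial value, the form of [Lambda] at [w0], is
    nonnegative. *)
Lemma avail_lmi : psd (Lambda A B Cm D X).
Proof.
move=> w0; pose H : 'M[R]_(d + n) := block_mx A B 0 (0 : R)%:M.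
pose w t := mexp H (t + - t0) *m w0.
pose u t : 'cV[R]_n := row_mx 0 1%:M *m w t; pose x t : 'cV[R]_d := row_mx 1%:M 0 *m w t.
have tx : traj A B u x.
  have /BsP[lu _ lx sx _] := exponential_trajectory A B Cm D 0 w0.
  by have := @traj_shift R d n A B (- t0) _ _ (And3 lu lx sx).
have xu t : col_mx (x t) (u t) = w t.
  by rewrite /x /u -mul_col_mx -block_mxEv -scalar_mx_block mul1mx.
have wt0 : w t0 = w0 by rewrite /w subrr mexp0 mul1mx.
pose q t := ((w t)^T *m Lambda A B Cm D X *m w t) 0 0.
have qE t : - q t = rate Cm D u x t + 2 * ((X *m x t)^T *m (A *m x t + B *m u t)) 0 0.
  by rewrite /q -xu quad_Lambda // /rate /sqn; ring.
have sw i : smooth (fun t => w t i 0).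
  have s0 : smooth (fun t => (mexp H t *m w0) i 0).
    have := smooth_mexp H 1%:M w0 i 0; congr smooth; apply/funext => t.
    by rewrite mul1mx.
  have := smooth_aff 1 (- t0) s0; congr smooth; apply/funext => t.
  by rewrite mul1r.
have sq : smooth q.
  have := smooth_sum (fun j => smoothM (smooth_sum (fun i => smoothM (sw i)
     (smooth_cst (Lambda A B Cm D X i j)))) (sw j)).
  congr smooth; apply/funext => t; rewrite /q; move: (w t) => y.
  rewrite mxE; apply: eq_bigr => j _; rewrite [(y^T *m _) 0 j]mxE.
  by congr (_ * _); apply: eq_bigr => i _; rewrite [y^T 0 i]mxE.
rewrite -wt0 -/(q t0); apply: right_derivative_ge0; first exact: smooth_cont.
move=> t1 t01.
have lq : Lone q by apply: Lone_cont; exact: smooth_cont.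
have lr := rate_Lone Cm D tx.
have hv := lyapunov_prim sX tx t01.
pose v t := 2 * ((X *m x t)^T *m (A *m x t + B *m u t)) 0 0; rewrite -/v in hv.
have -> : iv q t0 t1 = iv (fun t => -1 * rate Cm D u x t + -1 * v t) t0 t1.
  by apply: iv_eq => t _; have := qE t; rewrite /v => h; lra.
have lv : Lone v.
  have := LoneD (LoneZ (-1) lq) (LoneZ (-1) lr).
  by congr Lone; apply/funext => t; have := qE t; rewrite /v => h; lra.
rewrite ivD; [|exact: LoneZ..]; rewrite (ivZ (-1) _ _ lr) (ivZ (-1) _ _ lv) -hv.
have : iv (rate Cm D u x) t0 t1 + ((x t1)^T *m X *m x t1) 0 0 <= ((x t0)^T *m X *m x t0) 0 0.
  rewrite addrC -lerBrDr; apply: avail_lub => r gr; rewrite lerBrDr addrC; apply: avail_ub.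
  exact: gain_dyn.
by lra.
Qed.

(** From an unobservable [z] the free motion has no output; subtracting it turns a gain from [z]
    into the same gain from 0, which is at most 0. Conversely, if [X v = 0], the form of [Lambda] at
    (v, 0) is - |C v|^2, so [C v = 0], and then [Lambda] annihilates (v, 0), whose first block reads
    [X A v = 0]. *)
Lemma avail_null (z : 'cV[R]_d) : (forall k, Cm *m A ^+ k *m z = 0) <-> X *m z = 0.
Proof.
split=> [h|Xz k].
  apply: psd_ker sX avail_psd _; apply: le_anti; rewrite avail_psd andbT.
  apply: avail_lub => r [t1 [u [x [t01 tx xt0 ->]]]].
  have tf := traj_free A B t0 z.
  have tb := trajB tx tf.
  have g0 : gain A B Cm D t0 0 (iv (rate Cm D u x) t0 t1).
    exists t1, (fun t => u t - 0), (fun t => x t - mexp A (t - t0) *m z); split=> //.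
      by rewrite xt0 subrr mexp0 mul1mx subrr.
    apply: iv_eq => t _; rewrite /rate subr0; congr (sqn (_ + _) - _).
    by rewrite mulmxBr mulmxA (mexp_null _ h) subr0.
  by have := avail_ub g0; rewrite mulmx0 mxE.
have pL := avail_lmi.
have sL : symmx (Lambda A B Cm D X).
  have tB p q (M N : 'M[R]_(p, q)) : (M - N)^T = M^T - N^T by exact: linearB.
  have tN p q (M : 'M[R]_(p, q)) : (- M)^T = - M^T by exact: linearN.
  have tX : X^T = X := sX.
  rewrite /symmx /Lambda tr_block_mx !tB !trmx_mul trmx1 !tN !trmxK tX !mulmxN !mulNmx.
  by congr block_mx; rewrite [X in X - _]addrC.
have main (v : 'cV[R]_d) : X *m v = 0 -> Cm *m v = 0 /\ X *m (A *m v) = 0.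
  move=> Xv.
  have e : ((col_mx v 0)^T *m Lambda A B Cm D X *m col_mx v 0) 0 0 = - sqn (Cm *m v).
    have z0 : (0 : 'M[R]_1) 0 0 = 0 by rewrite mxE.
    by rewrite quad_Lambda // Xv !trmx0 !mul0mx !mulmx0 addr0 z0 sub0r mulr0 subr0.
  have Cv0 : (Cm *m v) = 0.
    have h0 : sqn (Cm *m v) = 0.
      apply: le_anti; rewrite sqn_ge0 andbT -oppr_ge0 -e; exact: pL.
    apply/matrixP => i j; rewrite [RHS]mxE ord1; apply/eqP; rewrite -sqrf_eq0.
    by move: h0; rewrite sqnE => /psumr_eq0P => -> // l _; exact: sqr_ge0.
  split=> //.
  have L0 : Lambda A B Cm D X *m col_mx v 0 = 0.
    by apply: psd_ker sL pL _; rewrite e Cv0 /sqn mulmx0 mxE oppr0.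
  move: L0; rewrite /Lambda mul_block_col !mulmx0 !addr0 => /eqP.
  rewrite col_mx_eq0 => /andP[/eqP + _].
  rewrite !mulmxBl -!mulmxA Cv0 Xv !mulmx0 subr0 sub0r => /eqP.
  by rewrite oppr_eq0 => /eqP.
have XA : X *m (A ^+ k *m z) = 0.
  elim: k => [|k IH]; first by rewrite expr0 [X in _ *m X]mul1mx.
  have [_ h0] := main _ IH.
  by have -> : A ^+ k.+1 *m z = A *m (A ^+ k *m z) by rewrite mulmxA mulmxE -exprS.
by rewrite -mulmxA; have [] := main _ XA.
Qed.

Definition Xminus (Xm : 'M[R]_d) :=
  [/\ symmx Xm, psd Xm, psd (Lambda A B Cm D Xm),
      (forall z : 'cV[R]_d, obsmx A Cm *m z = 0 <-> Xm *m z = 0)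
    & (forall Y, [/\ symmx Y, psd Y & psd (Lambda A B Cm D Y)] -> psd (Y - Xm))].

Lemma avail_Xminus : Xminus X.
Proof.
split=> //; [exact: avail_psd|exact: avail_lmi| |by move=> Y []; exact: avail_min].
by move=> z; rewrite obsmx_null; exact: avail_null.
Qed.

Lemma avail_kernel : exists (P : 'M[{poly R}]_(m, n)) (Q : 'M[{poly R}]_m),
  bounded_real_pair P Q /\ forall u y,
    Bs_ext A B Cm D u y <-> [/\ L2loc u, L2loc y & kernel_eq P Q u y].
Proof.
have [Pi [Hs [M ob]]] := observer_exists A Cm.
have [Q [E [S1 [S2 kr]]]] := kernel_rep_exists ob.
exists (E *m cP B + Q *m cP D), Q; split.
  apply: (@br_of_rep R d n m A B Cm D X sX) ob kr _ => [||z].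
  - exact: avail_psd.
  - exact: avail_lmi.
  - exact: avail_null.
move=> u y; split=> [[x hx]|[lu ly ke]]; last exact: (kernel_sub_behavior ob kr lu ly ke).
by split; [case: hx|case: hx|exact: (behavior_sub_kernel kr hx)].
Qed.

End Quad.

Lemma lmi_finite t0 X : symmx X -> psd X -> psd (Lambda A B Cm D X) ->
  forall x0, (avail_storage A B Cm D t0 x0 < +oo)%E.
Proof.
move=> sX pX lX x0; apply: (@le_lt_trans _ _ ((x0^T *m X *m x0) 0 0)%:E); last exact: ltry.
rewrite avail_storageE; apply: ge_ereal_sup => _ [r gr <-].
by rewrite lee_fin; exact: gain_le gr.
Qed.

Lemma observable_null : observable A Cm -> forall z : 'cV[R]_d, obsmx A Cm *m z = 0 -> z = 0.
Proof.
move=> ob z h; have rf : row_full (obsmx A Cm) by rewrite /row_full ob.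
have /row_fullP[G hG] := rf.
by rewrite -[z]mul1mx -hG -mulmxA h mulmx0.
Qed.

Lemma diss_rd X (v : 'cV[R[i]]_d) : symmx X -> psd (Lambda A B Cm D X) ->
  2 * rd (tc X *m v) (tc A *m v) <= - rd (tc Cm *m v) (tc Cm *m v).
Proof.
move=> sX lX; have := tc_diss sX lX v 0.
by rewrite !mulmx0 !addr0 mul1r rd0l sub0r.
Qed.

(** Observability gives [C v != 0] for an eigenvector [v], and the inequality with zero input makes
    Re l times the storage of [v] negative. *)
Lemma observable_hurw X : observable A Cm -> symmx X -> psd X -> psd (Lambda A B Cm D X) ->
  hurw (tc A).
Proof.
move=> ob sX pX lX l v v0 Av.
have Cv : tc Cm *m v != 0.
  apply/eqP => Cv0; case/eqP: v0.
  have h k : tc (Cm *m A ^+ k) *m v = 0.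
    rewrite tcM tc_pow -mulmxA.
    have -> : tc A ^+ k *m v = l ^+ k *: v.
      elim: k => [|k IH]; first by rewrite !expr0 [LHS]mul1mx scale1r.
      by rewrite exprSr -mulmxE -mulmxA Av -scalemxAr IH scalerA -exprS.
    by rewrite -scalemxAr Cv0 scaler0.
  apply: mx_re_im_eq0; apply: (observable_null ob); apply/obsmx_null => k;
    by have /tc_mul_eq0[] := h k.
have := diss_rd v sX lX; rewrite Av (herm_rd_scale _ _ (tc_herm sX)) rdC.
have := tc_psdh pX v; have := rd_gt0 Cv; move: (rd _ _) (rd _ _) => p q p0 q0 h.
by rewrite ltNge; apply/negP => l0; have := mulr_ge0 l0 q0; lra.
Qed.

Lemma hurwitz_of_hurw : hurw (tc A) -> hurwitz A.
Proof.
move=> h l /eigenvalueP[eta he eta0].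
have [v v0 hv] := left_right_eigen eta0 he; exact: h v0 hv.
Qed.

(** Lyapunov's theorem supplies the sign of [X], so that minimality of the storage matrix extends
    from the nonnegative solutions to all symmetric ones. *)
Lemma hurw_lmi_psd X : hurw (tc A) -> symmx X -> psd (Lambda A B Cm D X) -> psd X.
Proof.
move=> hA sX lX.
have pX : psdh (tc X).
  apply: (lyap_pos hA (tc_herm sX)) => v.
  by have := diss_rd v sX lX; have := rd_ge0 (tc Cm *m v); lra.
move=> v; have := pX (tc v).
by rewrite rd_re_im re_tcM im_tcM map_re_tc map_im_tc trmx0 mul0mx [X in _ + X]mxE addr0 mulmxA.
Qed.

End Available.

Theorem theorem20 (R : realType) (d n m : nat)
    (A : 'M[R]_d) (B : 'M[R]_(d, n)) (C : 'M[R]_(m, d)) (D : 'M[R]_(m, n))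
    (t0 : R) :
  let S := avail_storage A B C D t0 in
  let LMI := fun X : 'M[R]_d =>
    [/\ symmx X, psd X & psd (Lambda A B C D X)] in
  let Xminus_spec := fun Xm : 'M[R]_d =>
    [/\ symmx Xm, psd Xm, psd (Lambda A B C D Xm),
        (forall z : 'cV[R]_d, obsmx A C *m z = 0 <-> Xm *m z = 0)
      & (forall X : 'M[R]_d, LMI X -> psd (X - Xm))] in
  [<-> (forall x0 : 'cV[R]_d, (S x0 < +oo)%E);
       (exists (P : 'M[{poly R}]_(m, n)) (Q : 'M[{poly R}]_m),
          bounded_real_pair P Q /\
          forall (u : R -> 'cV[R]_n) (y : R -> 'cV[R]_m),
            Bs_ext A B C D u y <-> [/\ L2loc u, L2loc y & kernel_eq P Q u y]);
       (exists X : 'M[R]_d, LMI X);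
       (exists Xm : 'M[R]_d, Xminus_spec Xm /\
          forall x0 : 'cV[R]_d, S x0 = ((x0^T *m Xm *m x0) 0 0)%:E)]
  /\
  (observable A C ->
   (forall x0 : 'cV[R]_d, (S x0 < +oo)%E) ->
   hurwitz A /\
   forall Xm : 'M[R]_d,
     Xminus_spec Xm ->
     (forall x0 : 'cV[R]_d, S x0 = ((x0^T *m Xm *m x0) 0 0)%:E) ->
     forall X : 'M[R]_d, symmx X -> psd (Lambda A B C D X) -> psd (X - Xm)).
Proof.
move=> S LMI Xminus_spec; split.
  split; [|split; [|split]].
  - by move=> /sup_quadratic[X [sX hX]]; exact: (avail_kernel sX hX).
  - move=> [P [Q [br hPQ]]]; apply: (lmi_of_kernel br) => u y.
    by move=> /hPQ[].
  - move=> [X [sX pX lX]]; have [Xm [sXm hXm]] := sup_quadratic (lmi_finite t0 sX pX lX).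
    by exists Xm; split=> //; exact: avail_Xminus sXm hXm.
  - by move=> [Xm [_ hXm]] x0; rewrite hXm; exact: ltry.
move=> ob /sup_quadratic[X0 [sX0 hX0]].
have hA := observable_hurw ob sX0 (avail_psd hX0) (avail_lmi sX0 hX0).
split; first exact: hurwitz_of_hurw.
move=> Xm [_ _ _ _ least] _ X sX lX; apply: least; split=> //.
exact: hurw_lmi_psd lX.
Qed.
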